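(* Let $K_0$ be a $C^2$ surface patch in $\mathbb{R}^3$, contained in the boundary of a convex body, given for $(x_1,x_2)$ in a neighborhood of the origin by $$K_0(x_1,x_2)=\left(x_1,x_2,-\tfrac12(a_1x_1^2+a_2x_2^2)-h(x_1,x_2)\right),$$ where $a_1\ge 0$, $a_2\ge 0$, and $h$ is twice continuously differentiable with $h$ and all its first and second partial derivatives vanishing at $(0,0)$. Fix $r>0$ and let $K_r$ be the surface consisting of the points $K_0(x_1,x_2)+r\,\hat n(x_1,x_2)$. Then the projection $\Pi:K_r\to K_0$ does not preserve geodesics, unless, in that patch, (i) the Gaussian curvature is zero (i.e. the product of the two principal curvatures is zero), or (ii) the patch consists of umbilic points (i.e. the two principal curvatures are equal).
   Context: The convex body lies below the patch, so the outward unit normal to $K_0$ at the origin is $(0,0,1)$; $\hat n(x_1,x_2)$ denotes the outward unit normal to $K_0$ at the point $K_0(x_1,x_2)$. The numbers $a_1,a_2$ are the principal curvatures of $K_0$ at the origin (with sign chosen so that they are non-negative for a convex body). The projection $\Pi:K_r\to K_0$ sends a point of $K_r$ to the nearest point on $K_0$ in Euclidean distance; explicitly $\Pi(K_0(x_1,x_2)+r\hat n(x_1,x_2))=K_0(x_1,x_2)$. In this setting any non-singular reparametrization (i.e. with non-zero, possibly variable, speed) of a unit speed geodesic is also called a geodesic. A map between two surfaces preserves geodesics if it sends every geodesic of the first surface to a (possibly reparametrized) geodesic of the second surface. *)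

(* Defs.v *)
(* Points of R^n are row vectors over an abstract realType. *)
From HB Require Import structures.
From mathcomp Require Import all_boot all_order all_algebra.
From mathcomp Require Import all_classical all_reals all_analysis.

Set Implicit Arguments.
Unset Strict Implicit.
Unset Printing Implicit Defensive.

Import Order.TTheory GRing.Theory Num.Theory.
Import numFieldNormedType.Exports.

Local Open Scope classical_set_scope.
Local Open Scope ring_scope.

Definition vec3 (R : realType) (a b c : R) : 'rV[R]_3 :=
  \row_j [:: a; b; c]`_j.

(* The library norm on 'rV[R]_n is the sup norm; metric notions below use
   the Euclidean inner product and norm instead. *)
Definition inner (R : realType) (n : nat) (u v : 'rV[R]_n) : R :=
  \sum_i u 0 i * v 0 i.

Definition enorm (R : realType) (n : nat) (u : 'rV[R]_n) : R :=
  Num.sqrt (inner u u).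

Definition partial (R : realType) (V : normedModType R) (i : 'I_2)
    (F : 'rV[R]_2 -> V) : 'rV[R]_2 -> V :=
  fun x => 'D_(delta_mx 0 i) F x.

Definition C1_on (R : realType) (V : normedModType R) (U : set 'rV[R]_2)
    (F : 'rV[R]_2 -> V) : Prop :=
  forall i x, U x ->
    derivable F x (delta_mx 0 i) /\ {for x, continuous (partial i F)}.

Definition C2_on (R : realType) (V : normedModType R) (U : set 'rV[R]_2)
    (F : 'rV[R]_2 -> V) : Prop :=
  C1_on U F /\ forall i, C1_on U (partial i F).

Definition convex_body (R : realType) (C : set 'rV[R]_3) : Prop :=
  [/\ convex_set C, compact C & C° !=set0].

Definition boundary (R : realType) (C : set 'rV[R]_3) : set 'rV[R]_3 :=
  closure C `\` C°.

Definition normal_at (R : realType) (X : 'rV[R]_2 -> 'rV[R]_3)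
    (x : 'rV[R]_2) (v : 'rV[R]_3) : Prop :=
  forall i, inner v (partial i X x) = 0.

Definition outward_unit_normal (R : realType) (C : set 'rV[R]_3)
    (X : 'rV[R]_2 -> 'rV[R]_3) (x : 'rV[R]_2) (n : 'rV[R]_3) : Prop :=
  [/\ enorm n = 1, normal_at X x n
    & forall q, C q -> inner n (q - X x) <= 0].

Definition graph_patch (R : realType) (a1 a2 : R) (h : 'rV[R]_2 -> R) :
    'rV[R]_2 -> 'rV[R]_3 :=
  fun x => vec3 (x 0 0) (x 0 1)
    (- (2^-1 * (a1 * x 0 0 ^+ 2 + a2 * x 0 1 ^+ 2)) - h x).

Definition parallel_patch (R : realType) (X nu : 'rV[R]_2 -> 'rV[R]_3)
    (r : R) : 'rV[R]_2 -> 'rV[R]_3 :=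
  fun x => X x + r *: nu x.

Definition nearest_point_projection (R : realType) (A B : set 'rV[R]_3)
    (P : 'rV[R]_3 -> 'rV[R]_3) : Prop :=
  forall p, A p ->
    B (P p) /\ forall q, B q -> enorm (p - P p) <= enorm (p - q).

Definition first_form (R : realType) (X : 'rV[R]_2 -> 'rV[R]_3)
    (x : 'rV[R]_2) : 'M[R]_2 :=
  \matrix_(i, j) inner (partial i X x) (partial j X x).

(* The minus sign makes the curvatures of a convex body with respect to its
   outward normal non-negative. *)
Definition second_form (R : realType) (X nu : 'rV[R]_2 -> 'rV[R]_3)
    (x : 'rV[R]_2) : 'M[R]_2 :=
  \matrix_(i, j) - inner (partial i (partial j X) x) (nu x).

Definition shape_operator (R : realType) (X nu : 'rV[R]_2 -> 'rV[R]_3)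
    (x : 'rV[R]_2) : 'M[R]_2 :=
  second_form X nu x *m invmx (first_form X x).

(* k1 and k2 are the eigenvalues of the shape operator, with multiplicity. *)
Definition principal_curvatures (R : realType)
    (X nu : 'rV[R]_2 -> 'rV[R]_3) (x : 'rV[R]_2) (k1 k2 : R) : Prop :=
  char_poly (shape_operator X nu x) = ('X - k1%:P) * ('X - k2%:P).

Definition zero_gauss_curvature_at (R : realType)
    (X nu : 'rV[R]_2 -> 'rV[R]_3) (x : 'rV[R]_2) : Prop :=
  exists k1 k2, principal_curvatures X nu x k1 k2 /\ k1 * k2 = 0.

Definition umbilic_at (R : realType)
    (X nu : 'rV[R]_2 -> 'rV[R]_3) (x : 'rV[R]_2) : Prop :=
  exists k1 k2, principal_curvatures X nu x k1 k2 /\ k1 = k2.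

Definition open_interval (R : realType) (I : set R) : Prop :=
  open I /\ is_interval I.

(* A geodesic of the surface X @` U: a unit speed C^2 curve in the surface
   whose acceleration is everywhere normal to the surface. *)
Definition unit_speed_geodesic (R : realType) (X : 'rV[R]_2 -> 'rV[R]_3)
    (U : set 'rV[R]_2) (I : set R) (g : R -> 'rV[R]_3) : Prop :=
  open_interval I /\
  forall t, I t ->
    [/\ derivable g t 1,
        derivable (derive1 g) t 1,
        {for t, continuous (derive1 (derive1 g))},
        enorm (derive1 g t) = 1
      & exists x,
          [/\ U x, g t = X x & normal_at X x (derive1 (derive1 g) t)]].

Definition geodesic (R : realType) (X : 'rV[R]_2 -> 'rV[R]_3)
    (U : set 'rV[R]_2) (I : set R) (c : R -> 'rV[R]_3) : Prop :=
  open_interval I /\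
  exists J g (phi : R -> R),
    unit_speed_geodesic X U J g /\
    forall t, I t ->
      [/\ derivable phi t 1,
          {for t, continuous (derive1 phi)},
          derive1 phi t != 0,
          J (phi t)
        & c t = g (phi t)].

Definition preserves_geodesics (R : realType)
    (X Y : 'rV[R]_2 -> 'rV[R]_3) (U : set 'rV[R]_2)
    (P : 'rV[R]_3 -> 'rV[R]_3) : Prop :=
  forall I c, geodesic X U I c -> geodesic Y U I (P \o c).

(* Main.v *)
Require Import Defs.
From HB Require Import structures.
From mathcomp Require Import all_boot all_order all_algebra.
From mathcomp Require Import all_classical all_reals all_analysis.
From mathcomp Require Import ring lra.

(* Let T be the unit tangent of a geodesic of K_0 obtained by projecting a
   geodesic of K_r with unit tangent W.  Both T' and W' are normal to K_0, so the
   angle between T and W is constant; since W is parallel to (1 + rS)T, where S is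
   the shape operator, it vanishes exactly when T is a principal direction.
   Geodesics starting in a principal direction are therefore lines of curvature,
   and as such they are plane: the principal direction orthogonal to the line is
   constant along it.  Near a point with distinct nonzero principal curvatures,
   close up a small quadrilateral of four lines of curvature.  Its sides give
   tangents a, a' (in one family) and b, b' (in the other), each of a, a'
   orthogonal to each of b, b', which is impossible in R^3 since the normal
   rotates along the sides, so that a, a' and b, b' are independent.

   The data are only C^2, so the geodesic equation of K_r has a merely continuous
   right-hand side and existence of geodesics is Peano's theorem. *)

Set Implicit Arguments.
Unset Strict Implicit.
Unset Printing Implicit Defensive.

Import Order.TTheory GRing.Theory Num.Theory.
Import numFieldNormedType.Exports.

Local Open Scope classical_set_scope.
Local Open Scope ring_scope.

(** * Peano's existence theorem *)

(** Solutions of the geodesic equation need not be unique here, so lines of curvature form no flow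
    and provide no coordinates, and closing the quadrilateral needs another reason. It comes from
    planarity. Each of the last two sides lies in a plane whose normal is the end tangent of one of
    the first two sides; the intermediate value theorem makes the other late side reach that plane,
    and two such planes cut the surface near the base point in a single point. Opposite sides start
    with the same vector, because the direction orthogonal to a side stays constant along it; hence
    existence is proved with a length uniform in the starting point. The unknown of the geodesic
    equation is the point together with the unit tangent in R^3: an equation for the parameter
    velocity would involve third derivatives of the height. The local argument leaves, at each
    point, zero Gaussian curvature or an umbilic. Near a point of nonzero curvature the Gaussian
    curvature is then constant, and connectedness makes one alternative hold on the whole patch. *)

Fixpoint euler (R : realType) (V : normedModType R) (F : V -> V) (z0 : V)
    (h : R) (i : nat) : V :=
  if i is j.+1 then euler F z0 h j + h *: F (euler F z0 h j) else z0.

(** Serves twice: [G = 0], [e = M] bounds the increments, and [G] equal to the value of [F] at a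
    limit point identifies the derivative of the limit. *)
Lemma euler_dist (R : realType) (V : normedModType R) (F : V -> V) (z0 G : V)
    (h e : R) (i k : nat) : 0 <= h ->
  (forall l, (i <= l < i + k)%N -> `|F (euler F z0 h l) - G| <= e) ->
  `|euler F z0 h (i + k) - euler F z0 h i - (k%:R * h) *: G| <= k%:R * h * e.
Proof.
move=> h0; elim: k => [|k IH] He.
  by rewrite addn0 subrr !mul0r scale0r subrr normr0.
rewrite addnS /=; set E := euler F z0 h.
have -> : E (i + k)%N + h *: F (E (i + k)%N) - E i - (k.+1%:R * h) *: G =
  (E (i + k)%N - E i - (k%:R * h) *: G) + h *: (F (E (i + k)%N) - G).
  rewrite -natr1 mulrDl mul1r scalerDl scalerBr opprD !addrA.
  by congr (_ - _); rewrite [_ + _ - E i]addrAC [LHS]addrAC.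
rewrite (le_trans (ler_normD _ _))// -natr1 !mulrDl mul1r lerD//.
  apply: IH => l /andP[il lk]; apply: He; rewrite il/= addnS ltnS ltnW//.
rewrite normrZ ger0_norm// ler_wpM2l// He// leq_addr/= addnS ltnS//.
Qed.

Lemma euler_stays (R : realType) (V : normedModType R) (F : V -> V) (z0 : V)
    (h rho M : R) (i : nat) : 0 <= h -> 0 < M ->
  (forall z, `|z - z0| <= rho -> `|F z| <= M) -> i%:R * h <= rho / M ->
  `|euler F z0 h i - z0| <= i%:R * h * M.
Proof.
move=> h0 M0 FM; elim: i => [|i IH] hi /=; first by rewrite subrr normr0 !mul0r.
have hi' : i%:R * h <= rho / M.
  by apply: le_trans hi; rewrite ler_wpM2r// ler_nat.
have {}IH := IH hi'.
rewrite addrAC (le_trans (ler_normD _ _))// -natr1 !mulrDl mul1r lerD//.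
rewrite normrZ ger0_norm// ler_wpM2l// FM// (le_trans IH)//.
by rewrite -ler_pdivlMr.
Qed.

Lemma ultra_fmap (T U : Type) (f : T -> U) (F : set_system T) :
  UltraFilter F -> UltraFilter (f @ F).
Proof.
move=> FU; split=> [|G PG sG]; first exact: fmap_proper_filter.
apply/seteqP; split=> // A GA.
have [//|FnA] := in_ultra_setVsetC (f @^-1` A) FU.
have /filter_ex [x []//] : G (A `&` ~` A) by apply: filterI GA (sG _ _).
Qed.

Section peano.
Variables (R : realType) (n : nat) (F : 'rV[R]_n -> 'rV[R]_n) (z0 : 'rV[R]_n).
Variables (rho M : R).
Hypotheses (rho0 : 0 < rho) (M0 : 0 < M).
Hypothesis FM : forall z, `|z - z0| <= rho -> `|F z| <= M.
Hypothesis Fc : forall z, `|z - z0| <= rho -> {for z, continuous F}.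

Let T := rho / M.
Let h (k : nat) : R := k.+1%:R^-1.
Let idx (k : nat) (t : R) : nat := Num.truncn (t * k.+1%:R).
(** The Euler points are not interpolated: [Y k] is a step function, so the estimates carry an error
    proportional to the step [h k], which vanishes in the limit. *)
Let Y (k : nat) (t : R) := euler F z0 (h k) (idx k t).

Let h_gt0 k : 0 < h k. Proof. by rewrite invr_gt0. Qed.

Let idxP k t : 0 <= t -> (idx k t)%:R * h k <= t < (idx k t)%:R * h k + h k.
Proof.
move=> t0; have /truncn_itv : 0 <= t * k.+1%:R by rewrite mulr_ge0.
rewrite -/(idx k t) => /andP[l1 l2]; rewrite ler_pdivrMr// l1/=.
by rewrite -[X in _ + X]mul1r -mulrDl natr1 ltr_pdivlMr.
Qed.

Let idx_le k s t : s <= t -> (idx k s <= idx k t)%N.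
Proof. by move=> st; apply: le_truncn; rewrite ler_wpM2r. Qed.

(** The time covered by the completed steps differs from [t - s] by at most one step; this is the
    source of the last term. *)
Let Y_near k s t (G : 'rV[R]_n) e : 0 <= s -> s <= t -> 0 <= e ->
  (forall l, (idx k s <= l < idx k t)%N -> `|F (euler F z0 (h k) l) - G| <= e) ->
  `|Y k t - Y k s - (t - s) *: G| <= (t - s) * e + h k * (e + `|G|).
Proof.
move=> s0 st e0 He; have ist := idx_le k st.
have := @euler_dist _ _ F z0 G (h k) e (idx k s) (idx k t - idx k s) (ltW (h_gt0 k)).
rewrite subnKC// => /(_ He); rewrite -/(Y k t) -/(Y k s) natrB// => H.
have /andP[a1 a2] := idxP k s0; have /andP[b1 b2] := idxP k (le_trans s0 st).
set d := (_ - _) * h k in H.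
have dts : `|d - (t - s)| <= h k.
  by rewrite ler_distl /d mulrBl; apply/andP; split; lra.
have -> : Y k t - Y k s - (t - s) *: G = (Y k t - Y k s - d *: G) + (d - (t - s)) *: G.
  by rewrite [(d - _) *: _]scalerBl addrA subrK.
have /ler_normlP[d1 d2] := dts.
rewrite (le_trans (ler_normD _ _))// (le_trans (lerD H (lexx _)))//.
rewrite normrZ mulrDr addrA lerD// ?ler_wpM2r// -mulrDl ler_wpM2r//; lra.
Qed.

Let h_cvg : h k @[k --> \oo] --> 0.
Proof. exact: cvg_harmonic. Qed.

Let Y_stays k t l : 0 <= t <= T -> (l <= idx k t)%N ->
  `|euler F z0 (h k) l - z0| <= t * M /\ `|euler F z0 (h k) l - z0| <= rho.
Proof.
move=> tT lt; have /andP[t0 tT'] := tT; have /andP[i1 _] := idxP k t0.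
have lh : l%:R * h k <= t.
  by rewrite (le_trans _ i1)// ler_pM2r// ler_nat.
have H := euler_stays (ltW (h_gt0 k)) M0 FM (le_trans lh tT').
have H2 : `|euler F z0 (h k) l - z0| <= t * M.
  by rewrite (le_trans H)// ler_pM2r.
by split=> //; rewrite (le_trans H2)// -ler_pdivlMr.
Qed.

Let Y_lip k s t : 0 <= s -> s <= t -> t <= T ->
  `|Y k t - Y k s| <= (t - s) * M + h k * M.
Proof.
move=> s0 st tT; have := @Y_near k s t 0 M s0 st (ltW M0).
rewrite scaler0 subr0 normr0 addr0; apply => l /andP[_ lt].
have tT' : 0 <= t <= T by rewrite (le_trans s0 st).
by rewrite subr0 FM//; have [] := Y_stays tT' (ltnW lt).
Qed.

(* The Euler step functions converge pointwise along an ultrafilter, so no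
   equicontinuity argument is needed. *)
Lemma peano : exists y : R -> 'rV[R]_n,
  [/\ forall t, t <= 0 -> y t = z0,
      forall t, 0 <= t <= rho / M -> `|y t - z0| <= t * M,
      forall s t, 0 <= s -> s <= t -> t <= rho / M -> `|y t - y s| <= (t - s) * M
    & forall t, 0 < t < rho / M -> is_derive t 1 y (F (y t))].
Proof.
have [U [UU sU]] := ultraFilterLemma (@eventually_filter).
have PU : ProperFilter U by exact: ultra_proper.
have hU : h k @[k --> U] --> 0.
  by move=> A /h_cvg; exact: sU.
have cptB : compact (closed_ball z0 rho).
  apply: bounded_closed_compact; last exact: closed_ball_closed.
  rewrite closed_ballE//; exists (`|z0| + rho); split; first exact: num_real.
  move=> x xr v; rewrite /closed_ball_ /= distrC => vz.
  rewrite (le_trans _ (ltW xr))// -[v](subrK z0) (le_trans (ler_normD _ _))//.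
  by rewrite addrC lerD2l.
have Ycvg t : 0 <= t <= T -> exists l : 'rV[R]_n, Y k t @[k --> U] --> l.
  move=> tT; move: cptB; rewrite compact_ultra => /(_ (Y k t @[k --> U])).
  case=> [||l [_ /= Yl]]; last by exists l.
    exact: ultra_fmap.
    suff : \forall k \near U, closed_ball z0 rho (Y k t) by [].
    near=> k; rewrite closed_ballE// /closed_ball_ /= distrC.
    by have [] := Y_stays tT (leqnn (idx k t)).
(* The default value [z0] on the left of 0 makes the solution continuous at 0 from both sides, which
   is how its initial value is used later. *)
pose y t := if pselect (0 <= t <= T) is left tT then sval (cid (Ycvg t tT)) else z0.
have yP t : 0 <= t <= T -> Y k t @[k --> U] --> y t.
  by move=> tT; rewrite /y; case: pselect => // tT'; case: cid.
have y0 : y 0 = z0.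
  have T0 : 0 <= (0:R) <= T by rewrite lexx divr_ge0// ltW.
  have /cvg_lim <- // := yP 0 T0.
  by rewrite (_ : (fun k => Y k 0) = cst z0) ?lim_cst//; apply/funext => k;
     rewrite /Y /idx mul0r truncn0.
have ylip s t : 0 <= s -> s <= t -> t <= T -> `|y t - y s| <= (t - s) * M.
  move=> s0 st tT.
  have ys := yP s (introT andP (conj s0 (le_trans st tT))).
  have yt := yP t (introT andP (conj (le_trans s0 st) tT)).
  have c1 : `|Y k t - Y k s| - h k * M @[k --> U] --> `|y t - y s| - 0 * M.
    apply: cvgB; first by apply: cvg_norm; apply: cvgB.
    by apply: cvgMl; exact: hU.
  rewrite mul0r subr0 in c1; apply: (cvgr_to_le c1).
  by near=> k; rewrite lerBlDr Y_lip.
exists y; split; [| |exact: ylip|]; move=> t; [|move=> /andP[t0 tT]..].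
  rewrite le_eqVlt => /predU1P[->//|t0]; rewrite /y; case: pselect => // tT.
  by case/andP: (tT) => + _; rewrite leNgt t0.
  by have := ylip 0 t (lexx 0) t0 tT; rewrite y0 subr0.
have ytr : `|y t - z0| <= rho.
  have := ylip 0 t (lexx 0) (ltW t0) (ltW tT); rewrite y0 subr0 => H.
  by rewrite (le_trans H)// -ler_pdivlMr// ltW.
suff main e : 0 < e -> \forall d \near (0:R),
    `|y (d + t) - y t - d *: F (y t)| <= `|d| * e.
  have D : h^-1 *: (y (h *: 1 + t) - y t) @[h --> 0^'] --> F (y t).
    apply/cvgrPdist_le => e e0; near=> d.
    have d0 : d != 0 by near: d; exact: nbhs_dnbhs_neq.
    have -> : F (y t) - d^-1 *: (y (d *: 1 + t) - y t) =
        - (d^-1 *: (y (d + t) - y t - d *: F (y t))).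
      by rewrite [d *: 1]mulr1 [in RHS]scalerBr scalerA mulVf// scale1r opprB.
    rewrite normrN normrZ normfV ler_pdivrMl ?normr_gt0//.
    by near: d; apply: cvg_within; exact: main.
  by apply: DeriveDef; [apply/cvg_ex; exists (F (y t))|exact/cvg_lim].
move=> e0.
have /cvgrPdist_lt /(_ e e0) /nbhs_normP [eta /= eta0 Heta] := Fc ytr.
have HF z : `|y t - z| < eta -> `|F z - F (y t)| <= e.
  by move=> yz; rewrite distrC ltW// Heta.
(* Requiring only that one end of [[s, u]] be [t] covers increments to the right and to the left at
   once. *)
have near_s s u : 0 <= s -> s <= u -> u <= T -> s = t \/ u = t ->
    (u - s) * M < eta / 2 ->
    `|y u - y s - (u - s) *: F (y t)| <= (u - s) * e.
  move=> s0 su uT sut sueta.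
  have ys := yP s (introT andP (conj s0 (le_trans su uT))).
  have yu := yP u (introT andP (conj (le_trans s0 su) uT)).
  have yt := yP t (introT andP (conj (ltW t0) (ltW tT))).
  have c1 : `|Y k u - Y k s - (u - s) *: F (y t)| - h k * (e + `|F (y t)|)
      @[k --> U] --> `|y u - y s - (u - s) *: F (y t)| - 0 * (e + `|F (y t)|).
    apply: cvgB; last by apply: cvgMl; exact: hU.
    exact: (cvg_norm (cvgB (cvgB yu ys) (cvg_cst ((u - s) *: F (y t))))).
  rewrite mul0r subr0 in c1; apply: (cvgr_to_le c1).
  (* The radius [eta] is spent as [eta / 2] on the motion between [s] and [u], [eta / 4] on one
     further Euler step, and [eta / 4] on the distance from [Y k t] to its limit. *)
  have eta4 : 0 < eta / 4 by rewrite divr_gt0.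
  near=> k; rewrite lerBlDr; apply: Y_near => //; first exact: ltW.
  move=> l /andP[sl lu]; apply: HF.
  have hk : h k * M < eta / 4.
    rewrite -ltr_pdivlMr//; near: k; apply: (cvgr_lt 0 hU).
    by rewrite divr_gt0.
  have ytk : `|y t - Y k t| < eta / 4.
    by near: k; move/cvgrPdist_lt: yt; apply.
  have ik : (idx k s)%:R * h k <= s by have /andP[] := idxP k s0.
  have uk : u < (idx k u)%:R * h k + h k.
    by have /andP[] := idxP k (le_trans s0 su).
  have iu : (idx k u)%:R * h k <= u by have /andP[] := idxP k (le_trans s0 su).
  have sk : s < (idx k s)%:R * h k + h k by have /andP[] := idxP k s0.
  have dist i j : (idx k s <= i)%N -> (i <= j)%N -> (j <= idx k u)%N ->
      `|euler F z0 (h k) j - euler F z0 (h k) i| <= (u - s) * M + h k * M.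
    move=> si ij ju; have := @euler_dist _ _ F z0 0 (h k) M i (j - i) (ltW (h_gt0 k)).
    rewrite subnKC// scaler0 subr0 => H; apply: le_trans (H _) _.
      move=> m /andP[_ mj]; rewrite subr0 FM//.
      have uT' : 0 <= u <= T by rewrite (le_trans s0 su).
      by have [] := Y_stays uT' (leq_trans (ltnW mj) ju).
    rewrite -mulrDl ler_pM2r// natrB// mulrBl.
    have : j%:R * h k <= (idx k u)%:R * h k by rewrite ler_pM2r// ler_nat.
    have : (idx k s)%:R * h k <= i%:R * h k by rewrite ler_pM2r// ler_nat.
    lra.
  have : `|Y k t - euler F z0 (h k) l| <= (u - s) * M + h k * M.
    case: sut => <-; last by apply: dist => //; exact: ltnW.
    by rewrite distrC; apply: dist => //; exact: ltnW.
  move=> H; rewrite -(subrKA (Y k t)) (le_lt_trans (ler_normD _ _))//; lra.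
have etaM : 0 < eta / 2 / M by rewrite !divr_gt0.
near=> d.
have dM : `|d| * M < eta / 2.
  by rewrite -ltr_pdivlMr//; near: d; exact: (@nbhs0_lt _ R).
have dt : `|d| < t by near: d; exact: (@nbhs0_lt _ R).
have dT : `|d| < T - t.
  by near: d; apply: (@nbhs0_lt _ R); rewrite subr_gt0.
have [d0|d0] := leP 0 d.
  move: dM dt dT; rewrite !ger0_norm// => dM dt dT.
  have := near_s t (d + t); rewrite addrK; apply => //; [exact: ltW|lra|lra|by left].
move: dM dt dT; rewrite !ltr0_norm// => dM dt dT.
have := near_s (d + t) t; have -> : t - (d + t) = - d by ring.
rewrite scaleNr opprK.
have -> : y (d + t) - y t - d *: F (y t) = - (y t - y (d + t) + d *: F (y t)).
  by rewrite opprD opprB.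
by rewrite normrN; apply => //; [lra|lra|exact: ltW|right].
Unshelve. all: by end_near. Qed.
End peano.

(** * Calculus of C^1 functions of two variables *)

Section continuity_of_expressions.
Variables (R : realType) (T : topologicalType).
Implicit Types (f g : T -> R) (x : T).

Lemma continuous_addf f g x : {for x, continuous f} -> {for x, continuous g} ->
  {for x, continuous (fun y => f y + g y)}.
Proof. exact: continuousD. Qed.

Lemma continuous_oppf f x : {for x, continuous f} ->
  {for x, continuous (fun y => - f y)}.
Proof. exact: continuousN. Qed.

Lemma continuous_mulf f g x : {for x, continuous f} -> {for x, continuous g} ->
  {for x, continuous (fun y => f y * g y)}.
Proof. exact: continuousM. Qed.

Lemma continuous_invf f x : f x != 0 -> {for x, continuous f} ->
  {for x, continuous (fun y => (f y)^-1)}.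
Proof. exact: continuousV. Qed.

End continuity_of_expressions.

Definition pt (R : realType) (a b : R) : 'rV[R]_2 := \row_j [:: a; b]`_j.

Lemma pt0 (R : realType) (a b : R) : pt a b 0 0 = a. Proof. by rewrite mxE. Qed.
Lemma pt1 (R : realType) (a b : R) : pt a b 0 1 = b. Proof. by rewrite mxE. Qed.

Lemma rV2P (R : realType) (x y : 'rV[R]_2) : x 0 0 = y 0 0 -> x 0 1 = y 0 1 -> x = y.
Proof.
move=> e0 e1; apply/rowP => i; case: i => [[|[|//]] Hi].
- by rewrite (_ : Ordinal Hi = 0)//; apply/val_inj.
- by rewrite (_ : Ordinal Hi = 1)//; apply/val_inj.
Qed.

Lemma pt_eta (R : realType) (x : 'rV[R]_2) : pt (x 0 0) (x 0 1) = x.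
Proof. by apply: rV2P; rewrite ?pt0 ?pt1. Qed.

Lemma norm_rV2_lt (R : realType) (x : 'rV[R]_2) (e : R) :
  (`|x| < e) = (`|x 0 0| < e) && (`|x 0 1| < e).
Proof.
rewrite {1}/Num.Def.normr/= mx_normrE; apply/idP/andP => [xe|[x0 x1]].
  split; apply: le_lt_trans xe.
    exact: (le_bigmax _ (fun ij : 'I_1 * 'I_2 => `|x ij.1 ij.2|) (0, 0)).
  exact: (le_bigmax _ (fun ij : 'I_1 * 'I_2 => `|x ij.1 ij.2|) (0, 1)).
apply: bigmax_lt => [|[i j] _]; first by rewrite (le_lt_trans _ x0).
rewrite /= ord1; case: j => [[|[|//]] Hj].
- by rewrite (_ : Ordinal Hj = 0)//; apply/val_inj.
- by rewrite (_ : Ordinal Hj = 1)//; apply/val_inj.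
Qed.

Definition dir0 {R : realType} : 'rV[R]_2 := delta_mx 0 0.
Definition dir1 {R : realType} : 'rV[R]_2 := delta_mx 0 1.

(** The partial derivatives are named in the predicate, so that closed formulas such as [a00] can
    stand for them directly. *)
Definition has_grad (R : realType) (U : set 'rV[R]_2) (F d0 d1 : 'rV[R]_2 -> R) :=
  forall x, U x -> [/\ is_derive x dir0 F (d0 x), is_derive x dir1 F (d1 x),
    {for x, continuous d0} & {for x, continuous d1}].

Lemma MVT_ball (R : realType) (g dg : R -> R) (m rho a b : R) :
  (forall x, `|x - m| < rho -> is_derive x 1 g (dg x)) ->
  `|a - m| < rho -> `|b - m| < rho ->
  exists2 c, `|c - m| < rho & g b - g a = dg c * (b - a).
Proof.
move=> Hg.
wlog ab : a b / a <= b => [H|].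
  have [/H//|/ltW ba am bm] := leP a b.
  have [c cm e] := H _ _ ba bm am; exists c => //.
  by rewrite -opprB e -mulrN opprB.
move=> am bm.
have inr x : x \in `[a, b]%R -> `|x - m| < rho.
  rewrite in_itv/= => /andP[ax xb]; move: am bm.
  rewrite !ltr_norml => /andP[? ?] /andP[? ?]; apply/andP; split; lra.
have [||c /inr cab e] := @MVT_segment _ g dg _ _ ab; last by exists c.
- by move=> x xab; apply/Hg/inr; move: x xab; exact: subset_itv_oo_cc.
- by apply: derivable_within_continuous => x /inr /Hg [].
Qed.

Lemma is_derive_hline (R : realType) (F : 'rV[R]_2 -> R) (a b d : R) :
  is_derive (pt a b) dir0 F d -> is_derive a 1 (fun s => F (pt s b)) d.
Proof.
have E : (fun h : R => h^-1 *: (((fun s => F (pt s b)) \o shift a) (h *: 1) - F (pt a b)))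
   = (fun h => h^-1 *: ((F \o shift (pt a b)) (h *: dir0) - F (pt a b))).
  apply/funext => h /=; congr (_ *: (F _ - _)).
  by apply: rV2P; rewrite !mxE/= ?mulr1 ?mulr0 ?add0r ?[_%:A]mulr1.
by case=> Hd Hv; split; rewrite /derivable/derive E.
Qed.

Lemma is_derive_vline (R : realType) (F : 'rV[R]_2 -> R) (a b d : R) :
  is_derive (pt a b) dir1 F d -> is_derive b 1 (fun s => F (pt a s)) d.
Proof.
have E : (fun h : R => h^-1 *: (((fun s => F (pt a s)) \o shift b) (h *: 1) - F (pt a b)))
   = (fun h => h^-1 *: ((F \o shift (pt a b)) (h *: dir1) - F (pt a b))).
  apply/funext => h /=; congr (_ *: (F _ - _)).
  by apply: rV2P; rewrite !mxE/= ?mulr1 ?mulr0 ?add0r ?[_%:A]mulr1.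
by case=> Hd Hv; split; rewrite /derivable/derive E.
Qed.

(** Balls of the sup norm are squares, so the path that changes one coordinate at a time stays
    inside; its two legs give two distinct intermediate points. *)
Lemma grad_MVT (R : realType) (U : set 'rV[R]_2) (F d0 d1 : 'rV[R]_2 -> R)
    (m x y : 'rV[R]_2) (rho : R) :
  has_grad U F d0 d1 -> (forall z, `|z - m| < rho -> U z) ->
  `|x - m| < rho -> `|y - m| < rho ->
  exists u v, [/\ `|u - m| < rho, `|v - m| < rho &
    F y - F x = d0 u * (y 0 0 - x 0 0) + d1 v * (y 0 1 - x 0 1)].
Proof.
move=> HF mU; rewrite !norm_rV2_lt !mxE => /andP[x0 x1] /andP[y0 y1].
have [z z0|u um eu] := @MVT_ball _ (fun s => F (pt s (y 0 1)))
    (fun s => d0 (pt s (y 0 1))) (m 0 0) rho (x 0 0) (y 0 0) _ x0 y0.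
  apply: is_derive_hline.
  have /mU/HF[] // : `|pt z (y 0 1) - m| < rho.
  by rewrite norm_rV2_lt !mxE/= z0.
have [z z1|v vm ev] := @MVT_ball _ (fun s => F (pt (x 0 0) s))
    (fun s => d1 (pt (x 0 0) s)) (m 0 1) rho (x 0 1) (y 0 1) _ x1 y1.
  apply: is_derive_vline.
  have /mU/HF[] // : `|pt (x 0 0) z - m| < rho.
  by rewrite norm_rV2_lt !mxE/= x0.
exists (pt u (y 0 1)), (pt (x 0 0) v); split.
- by rewrite norm_rV2_lt !mxE/= um.
- by rewrite norm_rV2_lt !mxE/= x0.
- by rewrite -eu -ev !pt_eta addrA subrK.
Qed.

Lemma open_ballP (R : realType) (U : set 'rV[R]_2) x : open U -> U x ->
  exists2 rho : R, 0 < rho & forall z, `|z - x| < rho -> U z.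
Proof.
move=> oU Ux; have /nbhs_normP[rho /= rho0 H] : nbhs x U by exact: open_nbhs_nbhs.
by exists rho => // z zx; apply: H; rewrite /ball_/= distrC.
Qed.

(** By [grad_MVT] the remainder is the increment of the partial derivatives times the displacement,
    and their continuity makes it negligible. The chain rule along curves rests on this. *)
Lemma grad_diff (R : realType) (U : set 'rV[R]_2) (F d0 d1 : 'rV[R]_2 -> R) x :
  open U -> has_grad U F d0 d1 -> U x ->
  differentiable F x /\
  'd F x = (fun v => v 0 0 * d0 x + v 0 1 * d1 x) :> ('rV[R]_2 -> R).
Proof.
move=> oU HF Ux.
pose L (v : 'rV[R]_2) : R := v 0 0 * d0 x + v 0 1 * d1 x.
have linL : linear L by move=> k u v; rewrite /L !mxE /GRing.scale/=; ring.
pose LM := GRing.isLinear.Build _ _ _ _ _ linL.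
pose LL : {linear 'rV[R]_2 -> R} := HB.pack L LM.
have Lc : continuous (LL : 'rV[R]_2 -> R).
  have : continuous L.
    move=> v; suff : {for v, continuous (fun v : 'rV[R]_2 => v 0 0 * d0 x + v 0 1 * d1 x)} by [].
    apply: continuous_addf; apply: continuous_mulf; try exact: cst_continuous.
      exact: coord_continuous.
    exact: coord_continuous.
  by [].
have main : (F : 'rV[R]_2 -> R^o) \o shift x =
    cst (F x) + (LL : 'rV[R]_2 -> R^o) +o_ (0 : 'rV[R]_2) id.
  apply/eqaddoP => e egt0.
  have [_ _ c0 c1] := HF _ Ux.
  have [rho0 r0 HU] := open_ballP oU Ux.
  have e2 : 0 < e / 2 by rewrite divr_gt0.
  have /cvgrPdist_le /(_ _ e2) /nbhs_normP [rho1 /= r1 H0] := c0.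
  have /cvgrPdist_le /(_ _ e2) /nbhs_normP [rho2 /= r2 H1] := c1.
  pose rho := Num.min rho0 (Num.min rho1 rho2).
  have rr : 0 < rho by rewrite !lt_min r0 r1.
  have Hr : \forall h \near (0 : 'rV[R]_2), `|h| < rho.
    by apply/nbhs_normP; exists rho => //= z; rewrite /ball_/= sub0r normrN.
  apply: filterS Hr => h hr.
  have [|||u [v [ux vx E]]] := @grad_MVT _ _ _ _ _ x x (h + x) rho HF.
  - by move=> z; rewrite !lt_min => /and3P[/HU].
  - by rewrite subrr normr0.
  - by rewrite addrK.
  have -> : (F \o shift x - (cst (F x) + LL)) h =
      (d0 u - d0 x) * h 0 0 + (d1 v - d1 x) * h 0 1.
    transitivity (F (h + x) - (F x + L h)); first by [].
    by rewrite opprD addrA E /L !mxE; ring.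
  have hh j : `|h 0 j| <= `|h|.
    rewrite [leRHS]/Num.Def.normr/= mx_normrE.
    exact: (le_bigmax _ (fun ij : 'I_1 * 'I_2 => `|h ij.1 ij.2|) (0, j)).
  rewrite (le_trans (ler_normD _ _))// !normrM (splitr e) [leRHS]mulrDl lerD//.
    apply: ler_pM => //; rewrite distrC H0// /ball_/= distrC.
    by move: ux; rewrite !lt_min => /and3P[].
  apply: ler_pM => //; rewrite distrC H1// /ball_/= distrC.
  by move: vx; rewrite !lt_min => /and3P[].
have dF : 'd F x = LL :> ('rV[R]_2 -> R) by exact: diff_unique.
by split=> //; apply/diff_locallyP; rewrite dF; split.
Unshelve. all: by end_near. Qed.

Lemma grad_continuous (R : realType) (U : set 'rV[R]_2) (F d0 d1 : 'rV[R]_2 -> R) x :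
  open U -> has_grad U F d0 d1 -> U x -> {for x, continuous F}.
Proof. by move=> oU HF /(grad_diff oU HF)[/differentiable_continuous]. Qed.

Lemma grad_chain (R : realType) (U : set 'rV[R]_2) (F d0 d1 : 'rV[R]_2 -> R)
    (x : R -> 'rV[R]_2) (t : R) (dx : 'rV[R]_2) :
  open U -> has_grad U F d0 d1 -> U (x t) -> is_derive t 1 x dx ->
  is_derive t 1 (fun s => F (x s)) (dx 0 0 * d0 (x t) + dx 0 1 * d1 (x t)).
Proof.
move=> oU HF Ut [hp ep].
have [dF EF] := grad_diff oU HF Ut.
have dp : differentiable x t by apply/derivable1_diffP.
have dc : differentiable (F \o x) t by exact: differentiable_comp.
split; first by apply/derivable1_diffP.
by rewrite -[fun s => _]/(F \o x) deriveE// diff_comp// /= EF -(deriveE _ dp) ep.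
Qed.

Lemma is_derive_line (R : realType) (V W : normedModType R) (f : V -> W) (x v : V)
    (d : W) :
  is_derive x v f d <-> is_derive (0 : R) 1 (fun h => f (h *: v + x)) d.
Proof.
have E : (fun h : R => h^-1 *: (((fun h => f (h *: v + x)) \o shift 0) (h *: 1)
     - f (0 *: v + x))) = (fun h => h^-1 *: ((f \o shift x) (h *: v) - f x)).
  by apply/funext => h /=; rewrite addr0 scale0r add0r [_%:A]mulr1.
by split=> -[Hd Hv]; split; move: Hd Hv; rewrite /derivable/derive E.
Qed.

Lemma comp_is_derive (R : realType) (V : normedModType R) (q : V -> R) (phi : R -> R)
    (x v : V) (dq dphi : R) :
  is_derive x v q dq -> is_derive (q x) 1 phi dphi ->
  is_derive x v (fun y => phi (q y)) (dphi * dq).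
Proof.
move=> /is_derive_line[hq eq] [hp ep]; apply/is_derive_line.
have q0 : q (0 *: v + x) = q x by rewrite scale0r add0r.
have hp' : derivable phi (q (0 *: v + x)) 1 by rewrite q0.
have dq' := (derivable1_diffP _ _).1 hq; have dp' := (derivable1_diffP _ _).1 hp'.
have E := derive1_comp hq hp'; rewrite q0 !derive1E ep eq in E.
by split; [exact: ((derivable1_diffP _ _).2 (differentiable_comp dq' dp'))|exact: E].
Qed.

Lemma is_derive_coord (R : realType) (n : nat) (y : R -> 'rV[R]_n) (t : R) d j :
  is_derive t 1 y d -> is_derive t 1 (fun s => y s 0 j) (d 0 j).
Proof.
move=> [hy ey]; split; first by move/derivable_mxP : hy.
by rewrite -ey derive_mx// mxE.
Qed.

Lemma is_derive_row (R : realType) (n : nat) (y : R -> 'rV[R]_n) (t : R) (d : 'rV[R]_n) :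
  (forall j, is_derive t 1 (fun s => y s 0 j) (d 0 j)) -> is_derive t 1 y d.
Proof.
move=> H; have D : derivable y t 1.
  by apply/derivable_mxP => i j; rewrite ord1; case: (H j).
split=> //; rewrite derive_mx//; apply/rowP => j; rewrite mxE; by case: (H j).
Qed.

Lemma is_derive_pt (R : realType) (u v : R -> R) (t du dv : R) :
  is_derive t 1 u du -> is_derive t 1 v dv ->
  is_derive t 1 (fun s => pt (u s) (v s)) (pt du dv).
Proof.
move=> hu hv; apply: is_derive_row => -[[|[|//]] Hj]; rewrite mxE/=.
- by under eq_fun do rewrite mxE/=.
- by under eq_fun do rewrite mxE/=.
Qed.

Lemma continuous_row (R : realType) (T : topologicalType) (n : nat) (y : T -> 'rV[R]_n) t :
  (forall j, {for t, continuous (fun s => y s 0 j)}) -> {for t, continuous y}.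
Proof.
move=> H; apply/cvgrPdist_le => /= e e0; near=> s.
rewrite [leLHS]/Num.Def.normr/= mx_normrE (bigmax_le _ (ltW e0))//= => -[i j] _.
rewrite !mxE/= ord1; move: j; near: s; apply: filter_forall => j.
exact: ((cvgrPdist_le _ _).1 (H j)).
Unshelve. all: by end_near. Qed.

Lemma vec3_0 (R : realType) (a b c : R) : vec3 a b c 0 0 = a.
Proof. by rewrite mxE. Qed.
Lemma vec3_1 (R : realType) (a b c : R) : vec3 a b c 0 1 = b.
Proof. by rewrite mxE. Qed.
Lemma vec3_2 (R : realType) (a b c : R) : vec3 a b c 0 2 = c.
Proof. by rewrite mxE. Qed.
Definition vec3E := (vec3_0, vec3_1, vec3_2).

Lemma ord3P (P : 'I_3 -> Prop) : P 0 -> P 1 -> P 2 -> forall i, P i.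
Proof.
move=> P0 P1 P2 [[|[|[|//]]] Hi].
- by rewrite (_ : Ordinal Hi = 0)//; apply/val_inj.
- by rewrite (_ : Ordinal Hi = 1)//; apply/val_inj.
- by rewrite (_ : Ordinal Hi = 2)//; apply/val_inj.
Qed.

Lemma rV3P (R : realType) (u v : 'rV[R]_3) :
  u 0 0 = v 0 0 -> u 0 1 = v 0 1 -> u 0 2 = v 0 2 -> u = v.
Proof. by move=> *; apply/rowP; apply: ord3P. Qed.

Lemma inner3E (R : realType) (u v : 'rV[R]_3) :
  inner u v = u 0 0 * v 0 0 + u 0 1 * v 0 1 + u 0 2 * v 0 2.
Proof.
rewrite /inner !big_ord_recl big_ord0 addr0 addrA.
by congr (_ + _ * _ + _ * _); congr (_ _ _); apply/val_inj.
Qed.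

Lemma is_derive_vec3 (R : realType) (u v w : R -> R) (t du dv dw : R) :
  is_derive t 1 u du -> is_derive t 1 v dv -> is_derive t 1 w dw ->
  is_derive t 1 (fun s => vec3 (u s) (v s) (w s)) (vec3 du dv dw).
Proof.
move=> hu hv hw; apply: is_derive_row; apply: ord3P; rewrite vec3E.
- by under eq_fun do rewrite vec3E.
- by under eq_fun do rewrite vec3E.
- by under eq_fun do rewrite vec3E.
Qed.

Lemma is_derive_inner (R : realType) (u v : R -> 'rV[R]_3) (t : R) (du dv : 'rV[R]_3) :
  is_derive t 1 u du -> is_derive t 1 v dv ->
  is_derive t 1 (fun s => inner (u s) (v s)) (inner du (v t) + inner (u t) dv).
Proof.
move=> hu hv; under eq_fun do rewrite inner3E.
have := is_derive_coord 0 hu; have := is_derive_coord 1 hu.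
have := is_derive_coord 2 hu; have := is_derive_coord 0 hv.
have := is_derive_coord 1 hv; have := is_derive_coord 2 hv => v2 v1 v0 u2 u1 u0.
apply: is_derive_eq; rewrite !inner3E /GRing.scale/=; ring.
Qed.

Lemma continuous_inner (R : realType) (T : topologicalType) (u v : T -> 'rV[R]_3) t :
  {for t, continuous u} -> {for t, continuous v} ->
  {for t, continuous (fun s => inner (u s) (v s))}.
Proof.
move=> hu hv; rewrite (_ : (fun s => _) = (fun s => u s 0 0 * v s 0 0 +
  u s 0 1 * v s 0 1 + u s 0 2 * v s 0 2)); last by apply/funext => s; exact: inner3E.
by do 2?[apply: continuous_addf]; apply: continuous_mulf;
   apply: (continuous_comp _ (@coord_continuous _ _ _ _ _ _)).
Qed.

Lemma const_on (R : realType) (g : R -> R) (a s t : R) :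
  (forall x, 0 < x < a -> is_derive x 1 g 0) -> 0 < s < a -> 0 < t < a -> g s = g t.
Proof.
move=> Hg /andP[s0 sa] /andP[t0 ta].
have [|||c _] := @MVT_ball _ g (fun=> 0) (a / 2) (a / 2) s t.
- move=> x; rewrite ltr_norml => /andP[? ?]; apply: Hg; apply/andP; split; lra.
- by rewrite ltr_norml; apply/andP; split; lra.
- by rewrite ltr_norml; apply/andP; split; lra.
- by rewrite mul0r => /eqP; rewrite subr_eq0 => /eqP.
Qed.

(* The derivative may be missing at the left end 0, where continuity suffices. *)
Lemma is_derive_MVT0 (R : realType) (g dg : R -> R) (a t : R) :
  (forall x, 0 < x < a -> is_derive x 1 g (dg x)) -> {for 0, continuous g} ->
  0 < t < a -> exists2 c, 0 < c < t & g t - g 0 = dg c * t.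
Proof.
move=> Hg g0 /andP[t0 ta].
have [|| c ct E] := @MVT _ g dg 0 t t0.
- by move=> x; rewrite in_itv/= => /andP[x0 xt]; apply: Hg; rewrite x0 (lt_trans xt).
- apply: continuous_in_subspaceT => x; rewrite inE/= in_itv/= => /andP[].
  rewrite le_eqVlt => /predU1P[<-//|x0] xt.
  apply: differentiable_continuous; apply/derivable1_diffP.
  by have [] := Hg x; rewrite ?x0 ?(le_lt_trans xt).
- by exists c; [move: ct; rewrite in_itv|rewrite E subr0].
Qed.

Lemma const_on0 (R : realType) (g : R -> R) (a t : R) :
  (forall x, 0 < x < a -> is_derive x 1 g 0) -> {for 0, continuous g} ->
  0 <= t < a -> g t = g 0.
Proof.
move=> Hg g0 /andP[]; rewrite le_eqVlt => /predU1P[->//|t0 ta].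
have [|c _] := is_derive_MVT0 Hg g0 (t := t); first by rewrite t0.
by rewrite mul0r => /eqP; rewrite subr_eq0 => /eqP.
Qed.

(** * Graph of a concave C^2 function *)

Lemma is_derive1_invsqrt (R : realType) (s : R) : 0 < s ->
  is_derive s 1 (fun s => (Num.sqrt s)^-1) (- 2^-1 * (Num.sqrt s)^-1 ^+ 3).
Proof.
move=> s0; have r0 : Num.sqrt s != 0 by rewrite gt_eqF// sqrtr_gt0.
have [hd ed] := is_derive1_sqrt s0.
split; first exact: derivableV.
rewrite deriveV// ed /GRing.scale/= invfM; field.
by rewrite r0.
Qed.

(** Isolates what the differential geometry uses of the convex body: the sign of the Hessian. In
    [hessij] the index [i] is that of the later derivative; the two mixed ones arise from different
    slopes and are identified by [hess_sym]. *)
Record concave_graph (R : realType) := ConcaveGraph {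
  dom : set 'rV[R]_2;
  height : 'rV[R]_2 -> R;
  slope0 : 'rV[R]_2 -> R;
  slope1 : 'rV[R]_2 -> R;
  hess00 : 'rV[R]_2 -> R;
  hess01 : 'rV[R]_2 -> R;
  hess10 : 'rV[R]_2 -> R;
  hess11 : 'rV[R]_2 -> R;
  dom_open : open dom;
  grad_height : has_grad dom height slope0 slope1;
  grad_slope0 : has_grad dom slope0 hess00 hess10;
  grad_slope1 : has_grad dom slope1 hess01 hess11;
  hess_sym : forall x, dom x -> hess01 x = hess10 x;
  hess_npos : forall x (a b : R), dom x ->
    hess00 x * a ^+ 2 + 2 * hess01 x * a * b + hess11 x * b ^+ 2 <= 0
}.

Section graph_surface.
Variables (R : realType) (G : concave_graph R).
Local Notation U := (dom G).
Local Notation f := (height G).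
Local Notation p0 := (slope0 G).
Local Notation p1 := (slope1 G).
Local Notation h00 := (hess00 G).
Local Notation h01 := (hess01 G).
Local Notation h10 := (hess10 G).
Local Notation h11 := (hess11 G).
Let oU := @dom_open R G.
Let gf : has_grad U f p0 p1 := @grad_height R G.
Let gp0 : has_grad U p0 h00 h10 := @grad_slope0 R G.
Let gp1 : has_grad U p1 h01 h11 := @grad_slope1 R G.

Definition gsurf (x : 'rV[R]_2) : 'rV[R]_3 := vec3 (x 0 0) (x 0 1) (f x).
Definition gdiff x (v : 'rV[R]_2) : 'rV[R]_3 :=
  vec3 (v 0 0) (v 0 1) (v 0 0 * p0 x + v 0 1 * p1 x).

Definition gn2 x := (Num.sqrt (1 + p0 x ^+ 2 + p1 x ^+ 2))^-1.
Definition gn0 x := - p0 x * gn2 x.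
Definition gn1 x := - p1 x * gn2 x.
Definition gnormal x : 'rV[R]_3 := vec3 (gn0 x) (gn1 x) (gn2 x).

(* [aij] is the i-th partial derivative of [gnj], the entry of the shape
   operator in the coordinate basis. *)
Definition a00 x := - ((1 + p1 x ^+ 2) * h00 x - p0 x * p1 x * h01 x) * gn2 x ^+ 3.
Definition a01 x := - ((1 + p0 x ^+ 2) * h01 x - p0 x * p1 x * h00 x) * gn2 x ^+ 3.
Definition a10 x := - ((1 + p1 x ^+ 2) * h10 x - p0 x * p1 x * h11 x) * gn2 x ^+ 3.
Definition a11 x := - ((1 + p0 x ^+ 2) * h11 x - p0 x * p1 x * h10 x) * gn2 x ^+ 3.

(** The shape operator in parameter coordinates: by [is_derive_gnormal], the normal along a curve
    moves with velocity [gdiff] of this vector. For the outward normal of a convex body it is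
    non-negative. *)
Definition weingarten x (v : 'rV[R]_2) : 'rV[R]_2 :=
  pt (v 0 0 * a00 x + v 0 1 * a10 x) (v 0 0 * a01 x + v 0 1 * a11 x).

Definition detA x := a00 x * a11 x - a01 x * a10 x.
Definition trA x := a00 x + a11 x.

Lemma gq_gt0 x : 0 < 1 + p0 x ^+ 2 + p1 x ^+ 2.
Proof. by have := sqr_ge0 (p0 x); have := sqr_ge0 (p1 x); lra. Qed.

Lemma gn2_gt0 x : 0 < gn2 x.
Proof. by rewrite invr_gt0 sqrtr_gt0 gq_gt0. Qed.

Lemma gn2_sqr x : gn2 x ^+ 2 * (1 + p0 x ^+ 2 + p1 x ^+ 2) = 1.
Proof.
have q := gq_gt0 x; rewrite /gn2; set Q := 1 + _ + _ in q *.
by rewrite -{2}(sqr_sqrtr (ltW q)) -exprMn mulVf ?expr1n// gt_eqF// sqrtr_gt0.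
Qed.

Lemma continuous_p0 x : U x -> {for x, continuous p0}.
Proof. exact: grad_continuous oU gp0. Qed.

Lemma continuous_p1 x : U x -> {for x, continuous p1}.
Proof. exact: grad_continuous oU gp1. Qed.

Lemma continuous_gn2 x : U x -> {for x, continuous gn2}.
Proof.
move=> Ux; apply: continuous_invf; first by rewrite gt_eqF// sqrtr_gt0 gq_gt0.
apply: (@continuous_comp _ _ _ (fun x => 1 + p0 x ^+ 2 + p1 x ^+ 2) Num.sqrt);
  last exact: sqrt_continuous.
apply: continuous_addf; first apply: continuous_addf; first exact: cst_continuous.
  by apply: continuous_mulf; exact: continuous_p0.
by apply: continuous_mulf; exact: continuous_p1.
Qed.

Lemma continuous_shape x : U x -> [/\ {for x, continuous a00},
  {for x, continuous a01}, {for x, continuous a10} & {for x, continuous a11}].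
Proof.
move=> Ux.
have c0 := continuous_p0 Ux; have c1 := continuous_p1 Ux.
have c2 := continuous_gn2 Ux.
have [_ _ c00 c10] := gp0 Ux; have [_ _ c01 c11] := gp1 Ux.
have c23 : {for x, continuous (fun x => gn2 x ^+ 3)}.
  by apply: continuous_mulf => //; apply: continuous_mulf.
have c1q (p : 'rV[R]_2 -> R) : {for x, continuous p} ->
    {for x, continuous (fun x => 1 + p x ^+ 2)}.
  move=> cp; apply: continuous_addf; first exact: cst_continuous.
  exact: continuous_mulf.
have gen (p h k : 'rV[R]_2 -> R) : {for x, continuous p} -> {for x, continuous h} ->
    {for x, continuous k} -> {for x, continuous (fun x =>
      - ((1 + p x ^+ 2) * h x - p0 x * p1 x * k x) * gn2 x ^+ 3)}.
  move=> cp ch ck.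
  have A := continuous_mulf (c1q p cp) ch.
  have B := continuous_oppf (continuous_mulf (continuous_mulf c0 c1) ck).
  exact: (continuous_mulf (continuous_oppf (continuous_addf A B)) c23).
by split; [exact: (gen _ _ _ c1 c00 c01)|exact: (gen _ _ _ c0 c01 c00)|
           exact: (gen _ _ _ c1 c10 c11)|exact: (gen _ _ _ c0 c11 c10)].
Qed.

Lemma continuous_detA x : U x -> {for x, continuous detA}.
Proof.
move=> /continuous_shape[? ? ? ?].
by apply: continuous_addf; do ?apply: continuous_oppf; exact: continuous_mulf.
Qed.

Lemma continuous_trA x : U x -> {for x, continuous trA}.
Proof. by move=> /continuous_shape[? ? ? ?]; exact: continuous_addf. Qed.

Let is_derive_gn2 x v d0 d1 : is_derive x v p0 d0 -> is_derive x v p1 d1 ->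
  is_derive x v gn2 (- (p0 x * d0 + p1 x * d1) * gn2 x ^+ 3).
Proof.
move=> H0 H1.
have Hq : is_derive x v (fun x => 1 + p0 x ^+ 2 + p1 x ^+ 2)
   (2 * (p0 x * d0 + p1 x * d1)).
  apply: is_derive_eq; rewrite /GRing.scale/=; ring.
have := comp_is_derive Hq (is_derive1_invsqrt (gq_gt0 x)).
rewrite -/(gn2 x) => H; by apply: is_derive_eq H _; field.
Qed.

(** The third component follows from the other two: the derivative of a unit normal is tangent,
    hence of the form [gdiff]. *)
Lemma grad_gn2 : has_grad U gn2 (fun x => p0 x * a00 x + p1 x * a01 x)
  (fun x => p0 x * a10 x + p1 x * a11 x).
Proof.
move=> x Ux; have [d00 d10 _ _] := gp0 Ux; have [d01 d11 _ _] := gp1 Ux.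
have [? ? ? ?] := continuous_shape Ux.
have c0 := continuous_p0 Ux; have c1 := continuous_p1 Ux.
split; first 2 last.
- by apply: continuous_addf; apply: continuous_mulf.
- by apply: continuous_addf; apply: continuous_mulf.
- apply: is_derive_eq (is_derive_gn2 d00 d01) _.
  rewrite /a00 /a01; ring.
- apply: is_derive_eq (is_derive_gn2 d10 d11) _.
  rewrite /a10 /a11; ring.
Qed.

Lemma grad_gn0 : has_grad U gn0 a00 a10.
Proof.
move=> x Ux; have [d00 d10 _ _] := gp0 Ux; have [d01 d11 _ _] := gp1 Ux.
have [? ? ? ?] := continuous_shape Ux; have e := gn2_sqr x.
split=> //.
- have H := is_derive_gn2 d00 d01.
  apply: is_derive_eq; rewrite /GRing.scale/= /a00; apply/subr0_eq.
  (* The square root is opaque to [ring]; the difference of the two sides is exhibited as a multiple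
     of the relation [gn2_sqr]. Later computations follow the same pattern. *)
  transitivity (gn2 x * h00 x * (gn2 x ^+ 2 * (1 + p0 x ^+ 2 + p1 x ^+ 2) - 1)).
    ring.
  by rewrite e subrr mulr0.
- have H := is_derive_gn2 d10 d11.
  apply: is_derive_eq; rewrite /GRing.scale/= /a10; apply/subr0_eq.
  transitivity (gn2 x * h10 x * (gn2 x ^+ 2 * (1 + p0 x ^+ 2 + p1 x ^+ 2) - 1)).
    ring.
  by rewrite e subrr mulr0.
Qed.

Lemma grad_gn1 : has_grad U gn1 a01 a11.
Proof.
move=> x Ux; have [d00 d10 _ _] := gp0 Ux; have [d01 d11 _ _] := gp1 Ux.
have [? ? ? ?] := continuous_shape Ux; have e := gn2_sqr x.
split=> //.
- have H := is_derive_gn2 d00 d01.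
  apply: is_derive_eq; rewrite /GRing.scale/= /a01; apply/subr0_eq.
  transitivity (gn2 x * h01 x * (gn2 x ^+ 2 * (1 + p0 x ^+ 2 + p1 x ^+ 2) - 1)).
    ring.
  by rewrite e subrr mulr0.
- have H := is_derive_gn2 d10 d11.
  apply: is_derive_eq; rewrite /GRing.scale/= /a11; apply/subr0_eq.
  transitivity (gn2 x * h11 x * (gn2 x ^+ 2 * (1 + p0 x ^+ 2 + p1 x ^+ 2) - 1)).
    ring.
  by rewrite e subrr mulr0.
Qed.

Lemma is_derive_gsurf (x : R -> 'rV[R]_2) t dx : U (x t) -> is_derive t 1 x dx ->
  is_derive t 1 (fun s => gsurf (x s)) (gdiff (x t) dx).
Proof.
move=> Ut hx; apply: is_derive_vec3; try exact: is_derive_coord.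
exact: (grad_chain oU gf).
Qed.

Lemma is_derive_gnormal (x : R -> 'rV[R]_2) t dx : U (x t) -> is_derive t 1 x dx ->
  is_derive t 1 (fun s => gnormal (x s)) (gdiff (x t) (weingarten (x t) dx)).
Proof.
move=> Ut hx; rewrite /gdiff pt0 pt1; apply: is_derive_vec3.
- exact: (grad_chain oU grad_gn0).
- exact: (grad_chain oU grad_gn1).
- apply: is_derive_eq (grad_chain oU grad_gn2 Ut hx) _; ring.
Qed.

Lemma gnormal_unit x : inner (gnormal x) (gnormal x) = 1.
Proof. by rewrite inner3E !vec3E /gn0 /gn1 -[RHS](gn2_sqr x); ring. Qed.

Lemma gnormal_gdiff x v : inner (gnormal x) (gdiff x v) = 0.
Proof. by rewrite inner3E !vec3E /gn0 /gn1; ring. Qed.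

Lemma gdiff_proj x (w : 'rV[R]_3) : inner (gnormal x) w = 0 ->
  gdiff x (pt (w 0 0) (w 0 1)) = w.
Proof.
rewrite inner3E !vec3E /gn0 /gn1 => H.
apply: rV3P; rewrite vec3E ?pt0 ?pt1//.
have n0 := lt0r_neq0 (gn2_gt0 x).
apply: (mulfI n0); rewrite -[RHS](subr0) -H; ring.
Qed.

Lemma second_formE x v w : U x -> inner (gdiff x (weingarten x v)) (gdiff x w) =
  - gn2 x * (h00 x * v 0 0 * w 0 0 + h01 x * (v 0 0 * w 0 1 + v 0 1 * w 0 0)
    + h11 x * v 0 1 * w 0 1).
Proof.
move=> Ux; rewrite inner3E !vec3E !pt0 !pt1 /a00 /a01 /a10 /a11 -(hess_sym Ux).
apply/subr0_eq; transitivity (- gn2 x * (h00 x * v 0 0 * w 0 0 +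
  h01 x * (v 0 0 * w 0 1 + v 0 1 * w 0 0) + h11 x * v 0 1 * w 0 1) *
  (gn2 x ^+ 2 * (1 + p0 x ^+ 2 + p1 x ^+ 2) - 1)); first by ring.
by rewrite gn2_sqr subrr mulr0.
Qed.

Lemma shape_self_adjoint x v w : U x ->
  inner (gdiff x (weingarten x v)) (gdiff x w) = inner (gdiff x v) (gdiff x (weingarten x w)).
Proof.
move=> Ux; rewrite [RHS](_ : _ = inner (gdiff x (weingarten x w)) (gdiff x v)).
  by rewrite !second_formE//; ring.
by rewrite !inner3E; ring.
Qed.

Lemma shape_nneg x v : U x -> 0 <= inner (gdiff x (weingarten x v)) (gdiff x v).
Proof.
move=> Ux; rewrite second_formE// mulNr oppr_ge0.
have := hess_npos (v 0 0) (v 0 1) Ux => H.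
rewrite pmulr_rle0 ?gn2_gt0//; nra.
Qed.

(** The classical Gaussian curvature of a graph: the Hessian determinant divided by the square of
    [1 + p0^2 + p1^2]. *)
Lemma detAE x : U x -> detA x = (h00 x * h11 x - h01 x ^+ 2) * gn2 x ^+ 4.
Proof.
move=> Ux; rewrite /detA /a00 /a01 /a10 /a11 -(hess_sym Ux).
apply/subr0_eq; transitivity ((h00 x * h11 x - h01 x ^+ 2) * gn2 x ^+ 4 *
  (gn2 x ^+ 2 * (1 + p0 x ^+ 2 + p1 x ^+ 2) - 1)); first by ring.
by rewrite gn2_sqr subrr mulr0.
Qed.

Lemma detA_ge0 x : U x -> 0 <= detA x.
Proof.
move=> Ux; rewrite detAE// mulr_ge0 ?exprn_ge0 ?(ltW (gn2_gt0 x))//.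
have H := hess_npos _ _ Ux.
have H0 : h00 x <= 0 by have := H 1 0; lra.
have H1 : h11 x <= 0 by have := H 0 1; lra.
have [z|nz] := eqVneq (h00 x) 0.
  (* With [h00 = 0] this vector gives [h01^2 * (2 - h11) <= 0], while [2 - h11 > 0]; so
     [h01 = 0]. *)
  have := H (1 - h11 x) (h01 x); rewrite z => b.
  have -> : h01 x ^+ 2 = 0.
    by apply/eqP; rewrite eq_le sqr_ge0 andbT -(@pmulr_rle0 _ (2 - h11 x)); [nra|lra].
  by rewrite mul0r subr0.
(* On this vector the form equals [h00 * (h00 * h11 - h01^2)], and [h00 < 0]. *)
have := H (h01 x) (- h00 x) => b.
have hn : h00 x < 0 by rewrite lt_neqAle nz.
rewrite -(nmulr_rle0 _ hn); nra.
Qed.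

Lemma trA_ge0 x : U x -> 0 <= trA x.
Proof.
move=> Ux; have H := hess_npos _ _ Ux.
(* The trace is [- gn2^3] times the sum of the Hessian form over these three vectors. *)
have := H 1 0; have := H 0 1; have := H (p1 x) (- p0 x) => b0 b1 b2.
have n3 : 0 < gn2 x ^+ 3 by rewrite exprn_gt0 ?gn2_gt0.
rewrite /trA /a00 /a11 -(hess_sym Ux) -mulrDl pmulr_lge0//; lra.
Qed.

End graph_surface.

(** * Geodesics of the parallel surface *)

Lemma coord_le_norm (R : realType) (n : nat) (z : 'rV[R]_n) j : `|z 0 j| <= `|z|.
Proof.
rewrite [leRHS]/Num.Def.normr/= mx_normrE.
exact: (le_bigmax _ (fun ij : 'I_1 * 'I_n => `|z ij.1 ij.2|) (0, j)).
Qed.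

Lemma norm_row_lt (R : realType) (n : nat) (z : 'rV[R]_n) (e : R) : 0 < e ->
  (forall j, `|z 0 j| < e) -> `|z| < e.
Proof.
move=> e0 H; rewrite /Num.Def.normr/= mx_normrE; apply: bigmax_lt => // -[i j] _.
by rewrite /= ord1.
Qed.

Lemma continuous_coord (R : realType) (T : topologicalType) (t : T) (n : nat)
    (j : 'I_n) (y : T -> 'rV[R]_n) :
  {for t, continuous y} -> {for t, continuous (fun s => y s 0 j)}.
Proof.
by move=> cy; exact: (continuous_comp cy (@coord_continuous _ _ _ _ _ _)).
Qed.
Arguments continuous_coord {R T t n} j [y] _.

Section parallel_flow.
Variables (R : realType) (G : concave_graph R) (r : R).
Hypothesis r0 : 0 < r.
Local Notation U := (dom G).

Definition par_det x := (1 + r * a00 G x) * (1 + r * a11 G x) - r * a01 G x * (r * a10 G x).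

(** Cramer's rule for the inverse of [v |-> v + r S v]: it turns a tangent of the parallel surface,
    in coordinates, into the parameter velocity. *)
Definition unpar x (w : 'rV[R]_2) : 'rV[R]_2 :=
  pt ((w 0 0 * (1 + r * a11 G x) - w 0 1 * (r * a10 G x)) / par_det x)
     ((w 0 1 * (1 + r * a00 G x) - w 0 0 * (r * a01 G x)) / par_det x).

(** The determinant is [1 + r tr S + r^2 det S], and convexity makes both invariants non-negative:
    the parallel surface is regular for every [r > 0]. *)
Lemma par_det_ge1 x : U x -> 1 <= par_det x.
Proof.
move=> Ux; have := detA_ge0 Ux; have := trA_ge0 Ux; rewrite /detA /trA => T D.
have -> : par_det x = 1 + r * (a00 G x + a11 G x) +
  r ^+ 2 * (a00 G x * a11 G x - a01 G x * a10 G x) by rewrite /par_det; ring.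
rewrite -addrA lerDl addr_ge0// mulr_ge0 ?sqr_ge0//; exact: ltW.
Qed.

Lemma unparK x w : U x -> unpar x w + r *: weingarten G x (unpar x w) = w.
Proof.
move=> /par_det_ge1 D1; have D0 : par_det x != 0 by rewrite gt_eqF//; lra.
by apply: rV2P; rewrite !mxE/= ?pt0 ?pt1; move: D0; rewrite /par_det => D0; field.
Qed.

Lemma weingartenZ x c v : weingarten G x (c *: v) = c *: weingarten G x v.
Proof. by apply: rV2P; rewrite !mxE/=; ring. Qed.

Lemma par_inj x v w : U x ->
  v + r *: weingarten G x v = w + r *: weingarten G x w -> v = w.
Proof.
have K u : U x -> u = unpar x (u + r *: weingarten G x u).
  move=> /par_det_ge1 D1; have D0 : par_det x != 0 by rewrite gt_eqF//; lra.
  by apply: rV2P; rewrite !mxE/= ?pt0 ?pt1; move: D0; rewrite /par_det => D0; field.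
by move=> Ux E; rewrite [LHS]K// E -K.
Qed.

Definition tproj (w : 'rV[R]_3) : 'rV[R]_2 := pt (w 0 0) (w 0 1).

(** If [W'] is a multiple of [N], differentiating [inner N W = 0] forces the factor [- inner W N'];
    here [N'] is taken along the parameter velocity [unpar x (tproj w)]. *)
Definition gcurv x (w : 'rV[R]_3) : R :=
  inner w (gdiff G x (weingarten G x (unpar x (tproj w)))).

Let xof (z : 'rV[R]_5) : 'rV[R]_2 := pt (z 0 0) (z 0 1).
Let wof (z : 'rV[R]_5) : 'rV[R]_3 := vec3 (z 0 2) (z 0 3) (z 0 4).
(** The first two coordinates are the parameter point, the other three the tangent [W]. The field
    contains only second derivatives of the height, so it is continuous. Tangency and unit length of
    [W] are not imposed; they are recovered as first integrals in [principal_along]. *)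
Let field (z : 'rV[R]_5) : 'rV[R]_5 :=
  \row_j [:: unpar (xof z) (tproj (wof z)) 0 0; unpar (xof z) (tproj (wof z)) 0 1;
    - gcurv (xof z) (wof z) * gn0 G (xof z);
    - gcurv (xof z) (wof z) * gn1 G (xof z);
    - gcurv (xof z) (wof z) * gn2 G (xof z)]`_j.

Section continuity.
Variables (T : topologicalType) (t : T).

Lemma continuous_pt (u v : T -> R) : {for t, continuous u} -> {for t, continuous v} ->
  {for t, continuous (fun s => pt (u s) (v s))}.
Proof.
move=> cu cv; apply: continuous_row => -[[|[|//]] Hj].
- by rewrite (_ : (fun s => _) = u)//; apply/funext => s; rewrite mxE.
- by rewrite (_ : (fun s => _) = v)//; apply/funext => s; rewrite mxE.
Qed.

Lemma continuous_vec3 (u v w : T -> R) : {for t, continuous u} ->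
  {for t, continuous v} -> {for t, continuous w} ->
  {for t, continuous (fun s => vec3 (u s) (v s) (w s))}.
Proof.
move=> cu cv cw; apply: continuous_row; apply: ord3P.
- by rewrite (_ : (fun s => _) = u)//; apply/funext => s; rewrite vec3E.
- by rewrite (_ : (fun s => _) = v)//; apply/funext => s; rewrite vec3E.
- by rewrite (_ : (fun s => _) = w)//; apply/funext => s; rewrite vec3E.
Qed.

Variables (x v : T -> 'rV[R]_2).
Hypotheses (Ut : U (x t)) (cx : {for t, continuous x}).
Hypothesis cv : {for t, continuous v}.

Let continuous_at_x (F : 'rV[R]_2 -> R) :
  {for x t, continuous F} -> {for t, continuous (fun s => F (x s))}.
Proof. exact: continuous_comp. Qed.

Let acont : [/\ {for t, continuous (fun s => a00 G (x s))},
  {for t, continuous (fun s => a01 G (x s))},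
  {for t, continuous (fun s => a10 G (x s))} &
  {for t, continuous (fun s => a11 G (x s))}].
Proof.
by have [? ? ? ?] := continuous_shape Ut; split; exact: continuous_at_x.
Qed.

Lemma continuous_shape_curve : {for t, continuous (fun s => weingarten G (x s) (v s))}.
Proof.
have [? ? ? ?] := acont; have v0 := continuous_coord 0 cv.
have v1 := continuous_coord 1 cv.
by apply: continuous_pt; apply: continuous_addf; apply: continuous_mulf.
Qed.

Lemma continuous_gdiff_curve : {for t, continuous (fun s => gdiff G (x s) (v s))}.
Proof.
have v0 := continuous_coord 0 cv; have v1 := continuous_coord 1 cv.
apply: continuous_vec3 => //; apply: continuous_addf; apply: continuous_mulf => //.
  by apply: continuous_at_x; exact: continuous_p0.
by apply: continuous_at_x; exact: continuous_p1.
Qed.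

Lemma continuous_gnormal_curve : {for t, continuous (fun s => gnormal G (x s))}.
Proof.
apply: continuous_vec3; apply: continuous_at_x.
- exact: grad_continuous (@dom_open _ G) (@grad_gn0 _ G) Ut.
- exact: grad_continuous (@dom_open _ G) (@grad_gn1 _ G) Ut.
- exact: continuous_gn2.
Qed.

Lemma continuous_gsurf_curve : {for t, continuous (fun s => gsurf G (x s))}.
Proof.
apply: continuous_vec3; [exact: continuous_coord..|].
apply: continuous_at_x.
exact: grad_continuous (@dom_open _ G) (@grad_height _ G) Ut.
Qed.

Lemma continuous_unpar_curve : {for t, continuous (fun s => unpar (x s) (v s))}.
Proof.
have [c00 c01 c10 c11] := acont; have v0 := continuous_coord 0 cv.
have v1 := continuous_coord 1 cv.
have rc (F : T -> R) : {for t, continuous F} -> {for t, continuous (fun s => r * F s)}.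
  by move=> cF; apply: continuous_mulf => //; exact: cst_continuous.
have r1c (F : T -> R) : {for t, continuous F} ->
    {for t, continuous (fun s => 1 + r * F s)}.
  by move=> cF; apply: continuous_addf; [exact: cst_continuous|exact: rc].
have cD : {for t, continuous (fun s => (par_det (x s))^-1)}.
  apply: continuous_invf; first by rewrite gt_eqF// (lt_le_trans ltr01)// par_det_ge1.
  apply: continuous_addf; first by apply: continuous_mulf; exact: r1c.
  by apply: continuous_oppf; apply: continuous_mulf; exact: rc.
have A := continuous_addf (continuous_mulf v0 (r1c _ c11))
  (continuous_oppf (continuous_mulf v1 (rc _ c10))).
have B := continuous_addf (continuous_mulf v1 (r1c _ c00))
  (continuous_oppf (continuous_mulf v0 (rc _ c01))).
exact: (continuous_pt (continuous_mulf A cD) (continuous_mulf B cD)).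
Qed.

End continuity.

Lemma continuous_gcurv_curve (T : topologicalType) (t : T) (x : T -> 'rV[R]_2) (w : T -> 'rV[R]_3) :
  U (x t) -> {for t, continuous x} -> {for t, continuous w} ->
  {for t, continuous (fun s => gcurv (x s) (w s))}.
Proof.
move=> Ut cx cw; apply: continuous_inner => //.
apply: continuous_gdiff_curve => //; apply: continuous_shape_curve => //.
by apply: continuous_unpar_curve => //; apply: continuous_pt; exact: continuous_coord.
Qed.

Let ord5P (P : 'I_5 -> Prop) : P 0 -> P 1 -> P 2 -> P 3 -> P 4 -> forall i, P i.
Proof.
move=> P0 P1 P2 P3 P4 [[|[|[|[|[|//]]]]] Hi].
- by rewrite (_ : Ordinal Hi = 0)//; apply/val_inj.
- by rewrite (_ : Ordinal Hi = 1)//; apply/val_inj.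
- by rewrite (_ : Ordinal Hi = 2)//; apply/val_inj.
- by rewrite (_ : Ordinal Hi = 3)//; apply/val_inj.
- by rewrite (_ : Ordinal Hi = 4)//; apply/val_inj.
Qed.

Let field_continuous z : U (xof z) -> {for z, continuous field}.
Proof.
move=> Uz.
have cid : {for z, continuous (fun z : 'rV[R]_5 => z)} by [].
have cz j : {for z, continuous (fun z : 'rV[R]_5 => z 0 j)} := continuous_coord j cid.
have cx : {for z, continuous xof} := continuous_pt (cz 0) (cz 1).
have cw : {for z, continuous wof} := continuous_vec3 (cz 2) (cz 3) (cz 4).
have cp : {for z, continuous (fun z => tproj (wof z))} :=
  continuous_pt (continuous_coord 0 cw) (continuous_coord 1 cw).
have cu := continuous_unpar_curve Uz cx cp.
have cn := continuous_gnormal_curve Uz cx.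
have cc := continuous_oppf (continuous_gcurv_curve Uz cx cw).
have E j g : (forall z, field z 0 j = g z) -> {for z, continuous g} ->
    {for z, continuous (fun z => field z 0 j)}.
  by move=> E; rewrite (_ : (fun z => _) = g)//; exact/funext.
have nE j g : (forall x, gnormal G x 0 j = g x) ->
    {for z, continuous (fun z => - gcurv (xof z) (wof z) * g (xof z))}.
  move=> ng; apply: continuous_mulf => //.
  rewrite (_ : (fun z => _) = (fun z => gnormal G (xof z) 0 j)).
    exact: (continuous_coord j cn).
  by apply/funext => y; rewrite ng.
apply: continuous_row; apply: ord5P.
- by apply: E (continuous_coord 0 cu) => y; rewrite mxE.
- by apply: E (continuous_coord 1 cu) => y; rewrite mxE.
- by apply: E (nE 0 _ _) => y; rewrite ?mxE.
- by apply: E (nE 1 _ _) => y; rewrite ?mxE.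
- by apply: E (nE 2 _ _) => y; rewrite ?mxE.
Qed.

(** The radius and the lifetime are chosen before [x0]: the late sides of the quadrilateral start at
    points that depend on the early ones, yet need a guaranteed length. *)
Lemma parallel_flow p (W0 : 'rV[R]_3) (eta : R) : U p -> 0 < eta ->
  exists rho a, [/\ 0 < rho, 0 < a & forall x0, `|x0 - p| < rho ->
  exists (x : R -> 'rV[R]_2) (W : R -> 'rV[R]_3),
  [/\ x 0 = x0 /\ W 0 = W0, {for 0, continuous x}, {for 0, continuous W},
    forall t, 0 <= t < a -> [/\ `|x t - p| < eta, U (x t) & `|W t - W0| < eta]
  & forall t, 0 < t < a -> is_derive t 1 x (unpar (x t) (tproj (W t))) /\
      is_derive t 1 W (- gcurv (x t) (W t) *: gnormal G (x t))]].
Proof.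
move=> Up eta0.
have [d d0 dU] := open_ballP (@dom_open _ G) Up.
pose zz : 'rV[R]_2 -> 'rV[R]_5 := fun x =>
  \row_j [:: x 0 0; x 0 1; W0 0 0; W0 0 1; W0 0 2]`_j.
have zzx x : xof (zz x) = x by rewrite /xof /zz !mxE/= pt_eta.
have zzw x : wof (zz x) = W0 by rewrite /wof /zz; apply: rV3P; rewrite vec3E !mxE.
have Fc : {for zz p, continuous field} by apply: field_continuous; rewrite zzx.
have [e e0 Fb] : exists2 e, 0 < e &
    forall z, `|z - zz p| < e -> `|field z - field (zz p)| < 1.
  have /cvgrPdist_lt /(_ 1 ltr01) /nbhs_normP [e /= e0 H] := Fc.
  by exists e => // z zz'; rewrite distrC; apply: H; rewrite /ball_/= distrC.
pose M := `|field (zz p)| + 1.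
have M0 : 0 < M by rewrite ltr_wpDl.
(* Halved because the start is within [rho] of [p] and the solution within [rho] of its start. *)
pose rho := Num.min e (Num.min d eta) / 2.
have rho0 : 0 < rho by rewrite divr_gt0// !lt_min e0 d0 eta0.
have rhoe z : `|z| < 2 * rho -> [/\ `|z| < e, `|z| < d & `|z| < eta].
  by rewrite /rho mulrC divfK// !lt_min => /and3P.
have xofle (z1 z2 : 'rV[R]_5) (c : R) : `|z1 - z2| < c -> `|xof z1 - xof z2| < c.
  move=> zc; apply: norm_row_lt; first by rewrite (le_lt_trans _ zc).
  by move=> [[|[|//]] Hj]; rewrite !mxE/=; apply: le_lt_trans zc;
    [have := coord_le_norm (z1 - z2) 0|have := coord_le_norm (z1 - z2) 1];
    rewrite !mxE.
have wofle (z1 z2 : 'rV[R]_5) (c : R) : `|z1 - z2| < c -> `|wof z1 - wof z2| < c.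
  move=> zc; apply: norm_row_lt; first by rewrite (le_lt_trans _ zc).
  by apply: ord3P; rewrite !mxE/=; apply: le_lt_trans zc;
    [have := coord_le_norm (z1 - z2) 2|have := coord_le_norm (z1 - z2) 3|
     have := coord_le_norm (z1 - z2) 4]; rewrite !mxE.
exists rho, (rho / M); split=> [||x0 xp]; [by []|by rewrite divr_gt0|].
have zzp : `|zz x0 - zz p| < rho.
  apply: norm_row_lt => //; move: xp; rewrite norm_rV2_lt !mxE => /andP[x0p x1p].
  by apply: ord5P; rewrite !mxE/= ?subrr ?normr0.
have near_p z : `|z - zz x0| <= rho -> `|z - zz p| < 2 * rho.
  move=> zr; rewrite -(subrKA (zz x0)) (le_lt_trans (ler_normD _ _))//.
  by rewrite [2 * _]mulrDl mul1r ler_ltD.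
have Uz z : `|z - zz p| < 2 * rho -> U (xof z).
  move=> /rhoe[_ zd _]; apply: dU; rewrite -(zzx p); exact: xofle.
have [||y [y0 y1 _ yd]] := @peano _ _ field (zz x0) rho M rho0 M0.
- move=> z /near_p /rhoe[/Fb zf _ _]; rewrite /M.
  rewrite -[field z](subrK (field (zz p))) (le_trans (ler_normD _ _))//.
  by rewrite addrC lerD2l ltW.
- by move=> z /near_p /Uz; exact: field_continuous.
have yat t : 0 <= t < rho / M -> `|y t - zz x0| <= rho.
  move=> /andP[t0 tT]; apply: le_trans (y1 t _) _; first by rewrite t0 ltW.
  by rewrite -ler_pdivlMr// ltW.
have cy0 : {for 0, continuous y}.
  apply/cvgrPdist_lt => c c0; rewrite y0//.
  near=> t; have [t0|t0] := leP t 0; first by rewrite y0// subrr normr0.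
  have tr : `|t| < rho / M by near: t; apply: (@nbhs0_lt _ R); exact: divr_gt0.
  have tc : `|t| < c / M by near: t; apply: (@nbhs0_lt _ R); exact: divr_gt0.
  move: tr tc; rewrite !gtr0_norm// => tr tc.
  rewrite distrC; apply: le_lt_trans (y1 t _) _; first by rewrite !ltW.
  by rewrite -ltr_pdivlMr.
have cyj j : {for 0, continuous (fun t => y t 0 j)} := continuous_coord j cy0.
exists (fun t => xof (y t)), (fun t => wof (y t)); split.
- by rewrite y0// zzx zzw.
- exact: continuous_pt.
- exact: continuous_vec3.
- move=> t /yat yt; have [_ _ ye] := rhoe _ _ (near_p _ yt).
  split; last first.
  + by rewrite -(zzw p); exact: wofle.
  + exact/Uz/near_p.
  + by rewrite -[X in _ - X](zzx p); exact: xofle.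
- move=> t tT; have dy := yd t tT.
  have dj j := is_derive_coord j dy.
  split.
    apply: is_derive_eq (is_derive_pt (dj 0) (dj 1)) _.
    by apply: rV2P; rewrite ?pt0 ?pt1 !mxE.
  apply: is_derive_eq (is_derive_vec3 (dj 2) (dj 3) (dj 4)) _.
  by apply: rV3P; rewrite !mxE.
Unshelve. all: by end_near. Qed.

End parallel_flow.

(** * Lines of curvature *)

Section inner3.
Variable R : realType.
Implicit Types u v w : 'rV[R]_3.

Lemma innerC u v : inner u v = inner v u.
Proof. by rewrite !inner3E; ring. Qed.

Lemma innerZl (c : R) u v : inner (c *: u) v = c * inner u v.
Proof. by rewrite !inner3E !mxE; ring. Qed.

Lemma innerDr u v w : inner w (u + v) = inner w u + inner w v.
Proof. by rewrite !inner3E !mxE; ring. Qed.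

Lemma innerZr (c : R) u v : inner u (c *: v) = c * inner u v.
Proof. by rewrite !inner3E !mxE; ring. Qed.

Lemma innerBl u v w : inner (u - v) w = inner u w - inner v w.
Proof. by rewrite !inner3E !mxE; ring. Qed.

Lemma innerBr u v w : inner w (u - v) = inner w u - inner w v.
Proof. by rewrite !inner3E !mxE; ring. Qed.

Lemma inner_ge0 u : 0 <= inner u u.
Proof. by rewrite inner3E -!expr2 !addr_ge0 ?sqr_ge0. Qed.

Lemma inner_eq0 u : inner u u = 0 -> u = 0.
Proof.
rewrite inner3E -!expr2 => H.
have := sqr_ge0 (u 0 0); have := sqr_ge0 (u 0 1); have := sqr_ge0 (u 0 2) => a b c.
by apply: rV3P; rewrite mxE; apply/eqP; rewrite -sqrf_eq0 eq_le sqr_ge0 andbT; lra.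
Qed.

(** The equality case of Cauchy-Schwarz; the sign is carried by [inner u v] itself. *)
Lemma inner_unit_sqr1 u v : inner u u = 1 -> inner v v = 1 ->
  inner u v ^+ 2 = 1 -> u = inner u v *: v.
Proof.
move=> u1 v1 uv; apply/eqP; rewrite -subr_eq0; apply/eqP/inner_eq0.
rewrite innerBl !innerBr !innerZl !innerZr u1 v1 (innerC v u).
by move: uv; rewrite expr2 => uv; lra.
Qed.

End inner3.

(** The hypothesis on the projection, rewritten for a common parameter curve [x]. [W] is the unit
    tangent of the geodesic upstairs; [T] is that of its image, already composed with the
    reparametrization, whose derivative is [c]. *)
Definition transports_geodesics (R : realType) (G : concave_graph R) (r : R) :=
  forall (a : R) (x dx : R -> 'rV[R]_2) (W : R -> 'rV[R]_3) (kap : R -> R), 0 < a ->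
  (forall t, 0 < t < a ->
    [/\ dom G (x t), is_derive t 1 x (dx t) /\ {for t, continuous dx},
        gdiff G (x t) (dx t + r *: weingarten G (x t) (dx t)) = W t,
        is_derive t 1 W (- kap t *: gnormal G (x t)) /\ {for t, continuous kap}
      & inner (W t) (W t) = 1]) ->
  exists (T : R -> 'rV[R]_3) (c lam : R -> R), forall t, 0 < t < a ->
    [/\ is_derive t 1 T (lam t *: gnormal G (x t)), inner (T t) (T t) = 1,
        gdiff G (x t) (dx t) = c t *: T t & c t != 0].

Section curvature_lines.
Variables (R : realType) (G : concave_graph R) (r : R).
Hypothesis r0 : 0 < r.
Hypothesis transport : transports_geodesics G r.
Local Notation U := (dom G).
Local Notation N := (gnormal G).

Definition tangent_unit x (w : 'rV[R]_3) := inner (N x) w = 0 /\ inner w w = 1.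

Definition principal x (w : 'rV[R]_3) (k : R) :=
  weingarten G x (tproj w) = k *: tproj w.

Lemma gdiffZ x c v : gdiff G x (c *: v) = c *: gdiff G x v.
Proof. by apply: rV3P; rewrite !(vec3E, mxE)/=; ring. Qed.

Lemma gdiffD x v w : gdiff G x (v + w) = gdiff G x v + gdiff G x w.
Proof. by apply: rV3P; rewrite !(vec3E, mxE)/=; ring. Qed.

Lemma tproj_gdiff x v : tproj (gdiff G x v) = v.
Proof. by rewrite /tproj !vec3E pt_eta. Qed.

Lemma gdiff_tproj x w : inner (N x) w = 0 -> gdiff G x (tproj w) = w.
Proof. exact: gdiff_proj. Qed.

Lemma tprojZ c (w : 'rV[R]_3) : tproj (c *: w) = c *: tproj w.
Proof. by apply: rV2P; rewrite !mxE. Qed.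

Lemma principal_gdiff x w k : inner (N x) w = 0 -> principal x w k ->
  gdiff G x (weingarten G x (tproj w)) = k *: w.
Proof. by move=> Nw ->; rewrite gdiffZ gdiff_tproj. Qed.

Lemma principal_ge0 x w k : U x -> tangent_unit x w -> principal x w k -> 0 <= k.
Proof.
move=> Ux [Nw w1] Pw; have := shape_nneg (tproj w) Ux.
by rewrite (principal_gdiff Nw Pw) gdiff_tproj// innerZl w1 mulr1.
Qed.

(* Both the tangent T of the projected curve and the tangent W of the geodesic
   of the parallel surface have derivatives normal to the surface, so the angle
   between them is constant. *)
Lemma principal_along (a : R) (x : R -> 'rV[R]_2) (W : R -> 'rV[R]_3) (k0 : R) :
  (forall t, 0 <= t < a -> U (x t)) ->
  {for 0, continuous x} -> {for 0, continuous W} ->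
  (forall t, 0 < t < a -> is_derive t 1 x (unpar G r (x t) (tproj (W t))) /\
      is_derive t 1 W (- gcurv G r (x t) (W t) *: N (x t))) ->
  tangent_unit (x 0) (W 0) -> principal (x 0) (W 0) k0 ->
  forall t, 0 < t < a -> tangent_unit (x t) (W t) /\ exists k, [/\ 0 <= k,
    principal (x t) (W t) k,
    is_derive t 1 (fun s => gsurf G (x s)) ((1 + r * k)^-1 *: W t),
    is_derive t 1 W (- (k / (1 + r * k)) *: N (x t)) &
    is_derive t 1 (fun s => N (x s)) (k / (1 + r * k) *: W t)].
Proof.
move=> Ux cx cW dxW [NW0 WW0] P0 t tin.
have a0 : 0 < a by case/andP: tin => t0; exact: lt_trans.
have in0 s : 0 < s < a -> 0 <= s < a by move=> /andP[s0 ->]; rewrite ltW.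
have Ux' s : 0 < s < a -> U (x s) by move=> /in0 /Ux.
have U0 : U (x 0) by apply: Ux; rewrite lexx.
pose dx s := unpar G r (x s) (tproj (W s)).
have dN s : 0 < s < a -> is_derive s 1 (fun s => N (x s))
    (gdiff G (x s) (weingarten G (x s) (dx s))).
  by move=> sin; apply: is_derive_gnormal; [exact: Ux'|case: (dxW s sin)].
(* Tangency persists because [gcurv] is exactly the coefficient that makes the derivative of
   [inner N W] vanish. *)
have NW s : 0 <= s < a -> inner (N (x s)) (W s) = 0.
  move=> sin; rewrite -NW0; apply: (const_on0 (a := a) (g := fun s => inner (N (x s)) (W s))) => //.
    move=> y yin; have [_ dW] := dxW y yin.
    apply: is_derive_eq (is_derive_inner (dN y yin) dW) _.
    by rewrite innerZr gnormal_unit mulr1 /gcurv innerC subrr.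
  by apply: continuous_inner => //; exact: continuous_gnormal_curve.
have WW s : 0 <= s < a -> inner (W s) (W s) = 1.
  move=> sin; rewrite -WW0; apply: (const_on0 (a := a) (g := fun s => inner (W s) (W s))) => //.
    move=> y yin; have [_ dW] := dxW y yin.
    apply: is_derive_eq (is_derive_inner dW dW) _.
    by rewrite innerZl innerZr (innerC (W y)) NW ?in0// !mulr0 addr0.
  exact: continuous_inner.
have cdx s : 0 <= s < a -> {for s, continuous x} -> {for s, continuous W} ->
    {for s, continuous dx}.
  move=> sin cxs cWs; apply: continuous_unpar_curve => //; first exact: Ux.
  by apply: continuous_pt; exact: continuous_coord.
have cxs s : 0 < s < a -> {for s, continuous x}.
  by move=> /dxW[[? _] _]; apply/differentiable_continuous/derivable1_diffP.
have cWs s : 0 < s < a -> {for s, continuous W}.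
  by move=> /dxW[_ [? _]]; apply/differentiable_continuous/derivable1_diffP.
have dxE s : 0 <= s < a -> dx s + r *: weingarten G (x s) (dx s) = tproj (W s).
  by move=> /Ux Us; rewrite unparK.
have [||T [c [lam HT]]] := transport (a := a) (x := x) (dx := dx) (W := W)
    (kap := fun s => gcurv G r (x s) (W s)) => //.
  move=> s sin; have [dxs dWs] := dxW s sin; have sin0 := in0 s sin.
  split; [exact: Ux'| | | |exact: WW].
  - by split; [exact: dxs|exact: (cdx _ sin0 (cxs s sin) (cWs s sin))].
  - by rewrite dxE// gdiff_tproj// NW.
  - by split; [exact: dWs|exact: (continuous_gcurv_curve r0 (Ux' s sin) (cxs s sin) (cWs s sin))].
have NT s : 0 < s < a -> inner (N (x s)) (T s) = 0.
  move=> /HT[_ _ E c0]; apply: (mulfI c0).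
  by rewrite -innerZr -E gnormal_gdiff mulr0.
set tau := inner (T t) (W t).
have tauE s : 0 < s < a -> inner (T s) (W s) = tau.
  move=> sin; apply: (const_on (g := fun s => inner (T s) (W s))) sin tin.
  move=> y yin; have [_ dW] := dxW y yin; have [dT _ _ _] := HT y yin.
  apply: is_derive_eq (is_derive_inner dT dW) _.
  by rewrite innerZl innerZr NW ?in0// (innerC (T y)) NT// !mulr0 addr0.
pose V s := gdiff G (x s) (dx s).
have cV0 : {for 0, continuous V}.
  have in00 : 0 <= (0:R) < a by rewrite lexx.
  by apply: continuous_gdiff_curve => //; exact: cdx.
(* [T] is available only for positive times. This relation between [V = c T] and [W] expresses the
   constant angle without [T] or [c], so it passes to the limit at 0, where the direction is known
   to be principal. *)
have VV : inner (V 0) (W 0) ^+ 2 - tau ^+ 2 * inner (V 0) (V 0) = 0.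
  pose g s := inner (V s) (W s) * inner (V s) (W s) + - (tau ^+ 2 * inner (V s) (V s)).
  have gz s : 0 < s < a -> g s = 0.
    move=> sin; have [_ T1 E _] := HT s sin; rewrite /g /V E.
    by rewrite !innerZl !innerZr tauE// T1; ring.
  have cg : {for 0, continuous g}.
    apply: continuous_addf; first by apply: continuous_mulf; exact: continuous_inner.
    apply: continuous_oppf; apply: continuous_mulf; first exact: cst_continuous.
    exact: continuous_inner.
  transitivity (g 0); first by rewrite /g; ring.
  have cr : g s @[s --> 0^'+] --> g 0 by apply: cvg_at_right_filter; exact: cg.
  have c0 : g s @[s --> 0^'+] --> (0 : R).
    apply: cvg_near_cst; near=> s; apply: gz; apply/andP; split; near: s.
      exact: nbhs_right_gt.
    exact: nbhs_right_lt.
  exact: (cvg_unique _ cr c0).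
have k0p : 0 <= k0 by apply: principal_ge0 P0.
have rk0 : 1 + r * k0 != 0 by rewrite gt_eqF// ltr_wpDr// mulr_ge0// ltW.
have V0 : V 0 = (1 + r * k0)^-1 *: W 0.
  rewrite /V (_ : dx 0 = (1 + r * k0)^-1 *: tproj (W 0)) ?gdiffZ ?gdiff_tproj//.
  apply: (par_inj r0 U0); rewrite dxE ?lexx// weingartenZ P0 scalerA scalerA.
  by rewrite -scalerDl -[LHS]scale1r; congr (_ *: _); field.
have tau1 : tau ^+ 2 = 1.
  move: VV; rewrite V0 !innerZl !innerZr WW0 => /eqP.
  rewrite !mulr1 subr_eq0 => /eqP; rewrite -expr2 -[LHS]mul1r => /mulIf -> //.
  by rewrite expf_neq0// invr_neq0.
have tin0 := in0 t tin.
have [_ T1 E c0] := HT t tin.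
have TW : T t = tau *: W t by apply: inner_unit_sqr1 => //; exact: WW.
have tau0 : tau != 0 by rewrite -sqrf_eq0 tau1 oner_eq0.
pose m := c t * tau; have m0 : m != 0 by rewrite mulf_neq0.
have dxm : dx t = m *: tproj (W t).
  by rewrite -(tproj_gdiff (x t) (dx t)) E TW scalerA tprojZ.
have TU : tangent_unit (x t) (W t) by split; [exact: NW|exact: WW].
have r00 : r != 0 by rewrite gt_eqF.
(* Since [T] is [W] up to sign, the velocity is [m] times [W]; then [m (1 + r S) W = W] makes [W] an
   eigenvector, with [1 + r k = 1 / m]. *)
pose k := (m^-1 - 1) / r.
have Pk : principal (x t) (W t) k.
  have := dxE t tin0; rewrite dxm weingartenZ => H.
  have {}H : (m * r) *: weingarten G (x t) (tproj (W t)) = (1 - m) *: tproj (W t).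
    by rewrite scalerBl scale1r -[X in _ = X - _]H scalerA addrC addKr mulrC.
  have mr : m * r != 0 by rewrite mulf_neq0.
  apply: (scalerI mr); rewrite H scalerA; congr (_ *: _); rewrite /k.
  by field; rewrite m0 r00.
have k_ge0 : 0 <= k by apply: principal_ge0 Pk; [exact: Ux'|].
have rkm : (1 + r * k)^-1 = m by rewrite /k mulrC divfK// addrC subrK invrK.
have kE : gdiff G (x t) (weingarten G (x t) (dx t)) = (k / (1 + r * k)) *: W t.
  by rewrite dxm weingartenZ gdiffZ (principal_gdiff (NW t tin0) Pk) rkm scalerA mulrC.
split=> //; exists k; split=> //.
- apply: is_derive_eq (is_derive_gsurf (Ux' t tin) (proj1 (dxW t tin))) _.
  by rewrite -/(dx t) dxm gdiffZ gdiff_tproj ?NW// rkm.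
- apply: is_derive_eq (proj2 (dxW t tin)) _; congr (- _ *: _).
  by rewrite /gcurv -/(dx t) kE innerZr WW// mulr1.
- by rewrite -kE; exact: dN.
Unshelve. all: by end_near. Qed.

End curvature_lines.

(** * Principal directions at a single point *)

Lemma parseval3 (R : realType) (a b n u v : 'rV[R]_3) :
  inner a a = 1 -> inner b b = 1 -> inner n n = 1 ->
  inner a b = 0 -> inner a n = 0 -> inner b n = 0 ->
  inner u v = inner u a * inner v a + inner u b * inner v b + inner u n * inner v n.
Proof.
move=> aa bb nn ab an bn.
pose M : 'M[R]_3 := \matrix_(i, j) [:: a 0 j; b 0 j; n 0 j]`_i.
have innerM (w z : 'rV[R]_3) : inner w z = (w *m z^T) 0 0.
  by rewrite /inner mxE; apply: eq_bigr => i _; rewrite mxE.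
have E0 w : (w *m M^T) 0 0 = inner w a.
  by rewrite mxE /inner; apply: eq_bigr => i _; rewrite !mxE.
have E1 w : (w *m M^T) 0 1 = inner w b.
  by rewrite mxE /inner; apply: eq_bigr => i _; rewrite !mxE.
have E2 w : (w *m M^T) 0 2 = inner w n.
  by rewrite mxE /inner; apply: eq_bigr => i _; rewrite !mxE.
have MMT : M *m M^T = 1%:M.
  have R0 : row 0 M = a by apply/rowP => j; rewrite !mxE.
  have R1 : row 1 M = b by apply/rowP => j; rewrite !mxE.
  have R2 : row 2 M = n by apply/rowP => j; rewrite !mxE.
  have rowE i j : (M *m M^T) i j = (row i M *m M^T) 0 j.
    by rewrite -row_mul [RHS]mxE.
  apply/matrixP => i j; rewrite rowE [RHS]mxE.
  have ba : inner b a = 0 by rewrite innerC.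
  have na : inner n a = 0 by rewrite innerC.
  have nb : inner n b = 0 by rewrite innerC.
  move: i j; apply: ord3P; apply: ord3P; rewrite ?R0 ?R1 ?R2 ?E0 ?E1 ?E2;
    by rewrite ?aa ?bb ?nn ?ab ?an ?bn ?ba ?na ?nb.
(* Orthonormal rows give orthonormal columns; this is the completeness of the frame. *)
have MTM : M^T *m M = 1%:M by apply: mulmx1C.
have MvT : M *m v^T = (v *m M^T)^T by rewrite trmx_mul trmxK.
have -> : inner u v = inner (u *m M^T) (v *m M^T).
  by rewrite (innerM u) (innerM (u *m _)) -MvT mulmxA -(mulmxA u) MTM mulmx1.
by rewrite inner3E !E0 !E1 !E2.
Qed.

Section pointwise.
Variables (R : realType) (G : concave_graph R) (x : 'rV[R]_2).
Hypothesis Ux : dom G x.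
Local Notation N := (gnormal G x).
Local Notation p0 := (slope0 G x).
Local Notation p1 := (slope1 G x).
Local Notation a00 := (a00 G x).
Local Notation a01 := (a01 G x).
Local Notation a10 := (a10 G x).
Local Notation a11 := (a11 G x).

Definition disc (x : 'rV[R]_2) := trA G x ^+ 2 - 4 * detA G x.

(** Self-adjointness tested on the coordinate basis. That basis is not orthonormal in general, so
    the matrix of the shape operator need not be symmetric. *)
Lemma weingarten_sym :
  a10 * (1 + p0 ^+ 2) = a01 * (1 + p1 ^+ 2) + (a00 - a11) * (p0 * p1).
Proof.
have := shape_self_adjoint (pt 1 0) (pt 0 1) Ux.
by rewrite !inner3E !vec3E /weingarten !pt0 !pt1 => H; lra.
Qed.

(** Eliminating [a10] by [weingarten_sym] displays the discriminant as a sum of squares: the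
    principal curvatures are real, and they coincide only when the matrix is scalar. *)
Lemma discE : (1 + p0 ^+ 2) * disc x =
  (a00 - a11) ^+ 2 + 4 * a01 ^+ 2 + (p0 * (a00 - a11) + 2 * p1 * a01) ^+ 2.
Proof.
transitivity ((1 + p0 ^+ 2) * (a00 - a11) ^+ 2 + 4 * a01 * (a10 * (1 + p0 ^+ 2))).
  by rewrite /disc /trA /detA; ring.
by rewrite weingarten_sym; ring.
Qed.

Lemma slope_pos : 0 < 1 + p0 ^+ 2.
Proof. by have := sqr_ge0 p0; lra. Qed.

Lemma disc_ge0 : 0 <= disc x.
Proof.
rewrite -(pmulr_rge0 _ slope_pos) discE.
have := sqr_ge0 (a00 - a11); have := sqr_ge0 a01.
have := sqr_ge0 (p0 * (a00 - a11) + 2 * p1 * a01); lra.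
Qed.

Lemma disc0_scalar : disc x = 0 -> [/\ a01 = 0, a10 = 0 & a00 = a11].
Proof.
move=> d0; have := discE; rewrite d0 mulr0 => H.
have := sqr_ge0 (a00 - a11); have := sqr_ge0 a01.
have := sqr_ge0 (p0 * (a00 - a11) + 2 * p1 * a01) => s0 s1 s2.
have e01 : a01 = 0 by apply/eqP; rewrite -sqrf_eq0 eq_le sqr_ge0 andbT; lra.
have ed : a00 - a11 = 0 by apply/eqP; rewrite -sqrf_eq0 eq_le sqr_ge0 andbT; lra.
split=> //; last exact: subr0_eq.
apply: (mulIf (lt0r_neq0 slope_pos)).
by rewrite weingarten_sym e01 ed !mul0r addr0.
Qed.

Lemma eigenvector : disc x != 0 -> exists (v : 'rV[R]_2) k, v != 0 /\
  weingarten G x v = k *: v.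
Proof.
move=> dn0; pose s := Num.sqrt (disc x); pose k := (trA G x + s) / 2.
have ss : s ^+ 2 = disc x by rewrite sqr_sqrtr// disc_ge0.
have kchar : k ^+ 2 - trA G x * k + detA G x = 0.
  rewrite (_ : _ + _ = (s ^+ 2 - disc x) / 4); first by rewrite ss subrr mul0r.
  by rewrite /k /disc; field.
(* Each of [(a10, k - a00)] and [(k - a11, a01)] satisfies the eigenvector equation; both vanish
   only if the matrix is [k] times the identity, where [disc] is 0. *)
have [z|nz] := eqVneq (pt a10 (k - a00)) 0; last first.
  exists (pt a10 (k - a00)), k; split=> //.
  apply: rV2P; rewrite !mxE/=; first by ring.
  by apply/subr0_eq; rewrite -[RHS]oppr0 -kchar /trA /detA; ring.
exists (pt (k - a11) a01), k; split; last first.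
  apply: rV2P; rewrite !mxE/=; last by ring.
  by apply/subr0_eq; rewrite -[RHS]oppr0 -kchar /trA /detA; ring.
apply/eqP => z'; move/negP: dn0; apply; apply/eqP.
have := congr1 (fun v : 'rV[R]_2 => v 0 0) z; have := congr1 (fun v : 'rV[R]_2 => v 0 1) z.
have := congr1 (fun v : 'rV[R]_2 => v 0 0) z'; have := congr1 (fun v : 'rV[R]_2 => v 0 1) z'.
rewrite !mxE/= => e1 e2 e3 e4; rewrite /disc /trA /detA e1 e4.
have -> : a00 = k by lra. have -> : a11 = k by lra. by ring.
Qed.

Lemma gram_gdiff v w : inner (gdiff G x v) (gdiff G x v) * inner (gdiff G x w) (gdiff G x w) -
  inner (gdiff G x v) (gdiff G x w) ^+ 2 =
  (v 0 0 * w 0 1 - v 0 1 * w 0 0) ^+ 2 * (1 + p0 ^+ 2 + p1 ^+ 2).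
Proof. by rewrite !inner3E !vec3E; ring. Qed.

(** Self-adjointness makes [S u] orthogonal to [w]; in the frame [w], [u], [N] only its component
    along [u] remains. *)
Lemma principal_orth (w u : 'rV[R]_3) k : tangent_unit G x w -> principal G x w k ->
  tangent_unit G x u -> inner u w = 0 -> exists k', principal G x u k'.
Proof.
move=> [Nw ww] Pw [Nu uu] uw.
pose L := gdiff G x (weingarten G x (tproj u)).
have Lw : inner L w = 0.
  have := shape_self_adjoint (tproj u) (tproj w) Ux.
  by rewrite !gdiff_tproj// (principal_gdiff Nw Pw) innerZr uw mulr0.
have NL : inner N L = 0 by exact: gnormal_gdiff.
exists (inner L u); rewrite /principal -[LHS](tproj_gdiff G x) -tprojZ; congr tproj.
rewrite -/L; apply/eqP; rewrite -subr_eq0; apply/eqP/inner_eq0.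
set y := L - _; have yw : inner y w = 0 by rewrite innerBl innerZl Lw uw mulr0 subrr.
have yN : inner y N = 0.
  by rewrite innerBl innerZl (innerC L) (innerC u) NL Nu mulr0 subrr.
have yu : inner y u = 0 by rewrite innerBl innerZl uu mulr1 subrr.
have wu : inner w u = 0 by rewrite innerC.
have wN : inner w N = 0 by rewrite innerC.
have uN : inner u N = 0 by rewrite innerC.
rewrite (parseval3 y y ww uu (gnormal_unit G x) wu wN uN) yw yu yN.
by rewrite !mulr0 !addr0.
Qed.

(** Distinct eigenvalues give orthogonality. Equal ones, on two independent eigenvectors, would make
    the operator scalar, against [disc x != 0]; [D] below is the determinant that measures
    independence. *)
Lemma principal_pair (u w : 'rV[R]_3) k k' : disc x != 0 ->
  tangent_unit G x u -> principal G x u k -> tangent_unit G x w -> principal G x w k' ->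
  inner u w ^+ 2 != 1 -> inner u w = 0.
Proof.
move=> dn0 [Nu uu] Pu [Nw ww] Pw uw1.
have := shape_self_adjoint (tproj u) (tproj w) Ux.
rewrite !gdiff_tproj// (principal_gdiff Nw Pw) (principal_gdiff Nu Pu).
rewrite innerZl innerZr => /eqP; rewrite -subr_eq0 -mulrBl mulf_eq0.
case/orP => [/eqP kk|/eqP//]; exfalso.
have {}kk : k = k' by exact: subr0_eq.
have := gram_gdiff (tproj u) (tproj w); rewrite !gdiff_tproj// uu ww mulr1.
rewrite !pt0 !pt1; set D := u 0 0 * _ - _ => HD.
have D0 : D != 0.
  apply/eqP => D0; move/negP: uw1; apply; rewrite eq_sym -subr_eq0 HD D0.
  by rewrite expr0n mul0r.
have := congr1 (fun v : 'rV[R]_2 => v 0 0) Pu; have := congr1 (fun v : 'rV[R]_2 => v 0 1) Pu.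
have := congr1 (fun v : 'rV[R]_2 => v 0 0) Pw; have := congr1 (fun v : 'rV[R]_2 => v 0 1) Pw.
rewrite !mxE/= -kk => w1 w0 u1 u0.
have e00 : a00 = k.
  apply: (mulfI D0); apply/subr0_eq;
    transitivity (w 0 1 * (u 0 0 * a00 + u 0 1 * a10 - k * u 0 0) -
      u 0 1 * (w 0 0 * a00 + w 0 1 * a10 - k * w 0 0)); first by rewrite /D; ring.
  by rewrite u0 w0 !subrr !mulr0 subrr.
have e11 : a11 = k.
  apply: (mulfI D0); apply/subr0_eq;
    transitivity (u 0 0 * (w 0 0 * a01 + w 0 1 * a11 - k * w 0 1) -
      w 0 0 * (u 0 0 * a01 + u 0 1 * a11 - k * u 0 1)); first by rewrite /D; ring.
  by rewrite u1 w1 !subrr !mulr0 subrr.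
have e10 : a10 = 0.
  apply: (mulfI D0); apply/subr0_eq;
    transitivity (u 0 0 * (w 0 0 * a00 + w 0 1 * a10 - k * w 0 0) -
      w 0 0 * (u 0 0 * a00 + u 0 1 * a10 - k * u 0 0)); first by rewrite /D; ring.
  by rewrite u0 w0 !subrr !mulr0 subrr.
by move/eqP: dn0; apply; rewrite /disc /trA /detA e00 e11 e10; ring.
Qed.

Lemma principal_char (w : 'rV[R]_3) k : tangent_unit G x w -> principal G x w k ->
  k ^+ 2 - trA G x * k + detA G x = 0.
Proof.
move=> [Nw ww] Pw.
have := congr1 (fun v : 'rV[R]_2 => v 0 0) Pw; have := congr1 (fun v : 'rV[R]_2 => v 0 1) Pw.
rewrite !mxE/= => w1 w0.
have z0 : w 0 0 * (k ^+ 2 - trA G x * k + detA G x) = 0.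
  transitivity ((a11 - k) * (w 0 0 * a00 + w 0 1 * a10 - k * w 0 0) -
    a10 * (w 0 0 * a01 + w 0 1 * a11 - k * w 0 1)); first by rewrite /trA /detA; ring.
  by rewrite w0 w1 !subrr !mulr0 subrr.
have z1 : w 0 1 * (k ^+ 2 - trA G x * k + detA G x) = 0.
  transitivity ((a00 - k) * (w 0 0 * a01 + w 0 1 * a11 - k * w 0 1) -
    a01 * (w 0 0 * a00 + w 0 1 * a10 - k * w 0 0)); first by rewrite /trA /detA; ring.
  by rewrite w0 w1 !subrr !mulr0 subrr.
apply/eqP; move: (introT eqP z0) (introT eqP z1); rewrite !mulf_eq0.
case/orP => [/eqP e0|//]; case/orP => [/eqP e1|//].
move: ww; rewrite -(gdiff_tproj Nw) inner3E !vec3E !pt0 !pt1 e0 e1 => one.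
by exfalso; move/eqP: (oner_neq0 R); apply; rewrite -one; ring.
Qed.

(** The characteristic equation reads [k * (tr - k) = det]. The bounds control the speed of lines of
    curvature and the sense in which they turn. *)
Lemma principal_gt0_le (w : 'rV[R]_3) k : detA G x != 0 ->
  tangent_unit G x w -> principal G x w k -> 0 < k <= trA G x.
Proof.
move=> dn0 Tw Pw; have k0 := principal_ge0 Ux Tw Pw.
have := principal_char Tw Pw => E.
have kn : k != 0.
  by apply: contra dn0 => /eqP k00; move: E; rewrite k00 expr0n mulr0 subr0 add0r => ->.
have kp : 0 < k by rewrite lt_neqAle eq_sym kn.
rewrite kp /= -(ler_pM2r kp); have := detA_ge0 Ux; nra.
Qed.

Lemma principal_frame : disc x != 0 -> exists a b k k',
  [/\ tangent_unit G x a, tangent_unit G x b, inner a b = 0,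
      principal G x a k & principal G x b k'].
Proof.
move=> dn0; have [v [k [v0 Pv]]] := eigenvector dn0.
pose l := Num.sqrt (inner (gdiff G x v) (gdiff G x v)).
have l0 : 0 < l.
  rewrite sqrtr_gt0 lt_neqAle inner_ge0 andbT eq_sym; apply/eqP => /inner_eq0 g0.
  by move/eqP: v0; apply; rewrite -(tproj_gdiff G x v) g0; apply: rV2P; rewrite !mxE.
pose a := l^-1 *: gdiff G x v.
have Ta : tangent_unit G x a.
  split; first by rewrite innerZr gnormal_gdiff mulr0.
  rewrite innerZl innerZr mulrA -invfM -expr2 sqr_sqrtr ?inner_ge0// mulVf//.
  by rewrite -[X in X != 0]sqr_sqrtr ?inner_ge0// expf_neq0// gt_eqF.
have Pa : principal G x a k.
  by rewrite /principal tprojZ tproj_gdiff weingartenZ Pv scalerA mulrC -scalerA.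
(* The cross product of [N] and [a]; its length comes from Lagrange's identity. *)
pose b : 'rV[R]_3 := vec3 (N 0 1 * a 0 2 - N 0 2 * a 0 1) (N 0 2 * a 0 0 - N 0 0 * a 0 2)
   (N 0 0 * a 0 1 - N 0 1 * a 0 0).
have Tb : tangent_unit G x b.
  split; first by rewrite inner3E !vec3E; ring.
  have [Na aa] := Ta.
  transitivity (inner N N * inner a a - inner N a ^+ 2).
    by rewrite !inner3E ![b _ _]vec3E; ring.
  by rewrite gnormal_unit aa Na; ring.
have ab : inner a b = 0 by rewrite inner3E ![b _ _]vec3E; ring.
have [k' Pb] := principal_orth Ta Pa Tb (etrans (innerC _ _) ab).
by exists a, b, k, k'.
Qed.

End pointwise.

(** * Arcs of lines of curvature and their planarity *)

Section curvature_net.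
Variables (R : realType) (G : concave_graph R) (r : R).
Hypothesis r0 : 0 < r.
Hypothesis transport : transports_geodesics G r.
Local Notation U := (dom G).
Local Notation N := (gnormal G).
Local Notation X := (gsurf G).

(** The Rayleigh quotient: it gives the principal curvature along an arc as a function, free of the
    choice of an eigenvalue at each time. *)
Definition kof x (w : 'rV[R]_3) : R := inner (gdiff G x (weingarten G x (tproj w))) w.

Lemma kofE x w k : tangent_unit G x w -> principal G x w k -> kof x w = k.
Proof.
by move=> [Nw ww] Pw; rewrite /kof (principal_gdiff Nw Pw) innerZl ww mulr1.
Qed.

(** Time is arclength on the parallel surface, whence the factor [1 / (1 + r k)] in the speed on the
    original one. Derivatives are asserted for positive times only, and continuity covers the
    initial time. *)
Record curvature_arc (p : 'rV[R]_2) (eta a : R) (x : R -> 'rV[R]_2)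
    (W : R -> 'rV[R]_3) : Prop := CurvatureArc {
  arc_contx : {for 0, continuous x};
  arc_contW : {for 0, continuous W};
  arc_dom : forall t, 0 <= t < a -> U (x t);
  arc_nearx : forall t, 0 <= t < a -> `|x t - p| < eta;
  arc_nearW : forall t, 0 <= t < a -> `|W t - W 0| < eta;
  arc_tangent : forall t, 0 <= t < a -> tangent_unit G (x t) (W t);
  arc_principal : forall t, 0 <= t < a -> principal G (x t) (W t) (kof (x t) (W t));
  arc_dX : forall t, 0 < t < a -> is_derive t 1 (fun s => X (x s))
    ((1 + r * kof (x t) (W t))^-1 *: W t);
  arc_dW : forall t, 0 < t < a -> is_derive t 1 W
    (- (kof (x t) (W t) / (1 + r * kof (x t) (W t))) *: N (x t));
  arc_dN : forall t, 0 < t < a -> is_derive t 1 (fun s => N (x s))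
    (kof (x t) (W t) / (1 + r * kof (x t) (W t)) *: W t)
}.

Lemma curvature_arc_exists p W0 eta : U p -> 0 < eta ->
  exists rho a, [/\ 0 < rho, 0 < a & forall x0 k0, `|x0 - p| < rho ->
    tangent_unit G x0 W0 -> principal G x0 W0 k0 ->
    exists x W, [/\ x 0 = x0, W 0 = W0 & curvature_arc p eta a x W]].
Proof.
move=> Up eta0; have [rho [a [rho0 a0 H]]] := parallel_flow r0 W0 Up eta0.
exists rho, a; split=> // x0 k0 x0p T0 P0.
have [x [W [[xE WE] cx cW near dxW]]] := H x0 x0p; exists x, W; split=> //.
have Ux t : 0 <= t < a -> U (x t) by move=> /near[].
have in00 : 0 <= (0:R) < a by rewrite lexx.
have T0' : tangent_unit G (x 0) (W 0) by rewrite xE WE.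
have P0' : principal G (x 0) (W 0) k0 by rewrite xE WE.
have A := principal_along r0 transport Ux cx cW dxW T0' P0'.
have tan t : 0 <= t < a -> tangent_unit G (x t) (W t).
  move=> /andP[]; rewrite le_eqVlt => /predU1P[<-//|t0 ta].
  by have [] := A t (introT andP (conj t0 ta)).
have A' t : 0 < t < a -> [/\ principal G (x t) (W t) (kof (x t) (W t)),
    is_derive t 1 (fun s => X (x s)) ((1 + r * kof (x t) (W t))^-1 *: W t),
    is_derive t 1 W (- (kof (x t) (W t) / (1 + r * kof (x t) (W t))) *: N (x t)) &
    is_derive t 1 (fun s => N (x s)) (kof (x t) (W t) / (1 + r * kof (x t) (W t)) *: W t)].
  move=> /A[Tt [k [k0' Pk dX dW dN]]].
  by rewrite !(kofE Tt Pk).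
split=> //.
- by move=> t /near[].
- by move=> t /near[_ _]; rewrite WE.
- move=> t /andP[]; rewrite le_eqVlt => /predU1P[<- _|t0 ta].
    by rewrite (kofE T0' P0').
  by have [] := A' t (introT andP (conj t0 ta)).
- by move=> t /A'[].
- by move=> t /A'[].
- by move=> t /A'[].
Qed.

Section arc_facts.
Variables (p : 'rV[R]_2) (eta a : R) (x : R -> 'rV[R]_2) (W : R -> 'rV[R]_3).
Hypothesis (arc : curvature_arc p eta a x W).

Lemma arc_U0 : 0 < a -> U (x 0).
Proof. by move=> a0; apply: (arc_dom arc); rewrite lexx. Qed.

(** The mean value theorem holds for scalar functions, so displacements in R^3 are measured against
    a fixed vector [c]. *)
Lemma arc_MVT c t : 0 < t < a -> exists2 s, 0 < s < t &
  inner c (X (x t)) - inner c (X (x 0)) =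
  (1 + r * kof (x s) (W s))^-1 * inner c (W s) * t.
Proof.
move=> tin; have a0 : 0 < a by case/andP: tin => t0; exact: lt_trans.
have [||s ss E] := @is_derive_MVT0 _ (fun s => inner c (X (x s)))
   (fun s => (1 + r * kof (x s) (W s))^-1 * inner c (W s)) a t _ _ tin; last by exists s.
- move=> s sin; have hc : is_derive s 1 (fun _ : R => c) 0 by exact: is_derive_cst.
  apply: is_derive_eq (is_derive_inner hc (arc_dX arc sin)) _.
  by rewrite innerZr !inner3E !mxE; ring.
- apply: continuous_inner; first exact: cst_continuous.
  by apply: continuous_gsurf_curve; [exact: arc_U0|exact: arc_contx arc].
Qed.

Lemma arc_MVT_W c t : 0 < t < a -> exists2 s, 0 < s < t &
  inner c (W t) - inner c (W 0) =
  - (kof (x s) (W s) / (1 + r * kof (x s) (W s))) * inner c (N (x s)) * t.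
Proof.
move=> tin.
have [||s ss E] := @is_derive_MVT0 _ (fun s => inner c (W s))
   (fun s => - (kof (x s) (W s) / (1 + r * kof (x s) (W s))) * inner c (N (x s)))
   a t _ _ tin; last by exists s.
- move=> s sin; have hc : is_derive s 1 (fun _ : R => c) 0 by exact: is_derive_cst.
  apply: is_derive_eq (is_derive_inner hc (arc_dW arc sin)) _.
  by rewrite innerZr !inner3E !mxE; ring.
- by apply: continuous_inner; [exact: cst_continuous|exact: arc_contW arc].
Qed.

(* A curvature line that is a geodesic lies in a plane: a vector orthogonal to
   its tangent and to the surface normal at the start remains so. *)
Lemma arc_plane B : inner B (N (x 0)) = 0 -> inner B (W 0) = 0 ->
  forall t, 0 <= t < a -> [/\ inner B (N (x t)) = 0, inner B (W t) = 0
    & inner B (X (x t)) = inner B (X (x 0))].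
Proof.
move=> BN BW t tin.
have a0 : 0 < a by case/andP: tin => t0; exact: le_lt_trans.
have hc (s : R) : is_derive s 1 (fun _ : R => B) 0 by exact: is_derive_cst.
have i0 (u : 'rV[R]_3) : inner 0 u = 0 by rewrite inner3E !mxE; ring.
have cN : {for 0, continuous (fun s => inner B (N (x s)))}.
  apply: continuous_inner; first exact: cst_continuous.
  by apply: continuous_gnormal_curve; [exact: arc_U0|exact: arc_contx arc].
have cW : {for 0, continuous (fun s => inner B (W s))}.
  by apply: continuous_inner; [exact: cst_continuous|exact: arc_contW arc].
(* [N] and [W] rotate into each other with the same rate and opposite signs, so this sum of squares
   is conserved; it replaces a uniqueness theorem for the linear system. *)
have Q s : 0 <= s < a -> inner B (N (x s)) ^+ 2 + inner B (W s) ^+ 2 = 0.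
  move=> sin; pose g s := inner B (N (x s)) * inner B (N (x s)) +
    inner B (W s) * inner B (W s).
  transitivity (g s); first by rewrite /g; ring.
  transitivity (g 0); last by rewrite /g BN BW mulr0 addr0.
  apply: const_on0 sin => [y yin|].
    have dN := is_derive_inner (hc y) (arc_dN arc yin).
    have dW := is_derive_inner (hc y) (arc_dW arc yin).
    have dNN := is_deriveM dN dN; have dWW := is_deriveM dW dW.
    apply: is_derive_eq (is_deriveD dNN dWW) _.
    by rewrite /= !i0 !innerZr /GRing.scale/=; ring.
  by apply: continuous_addf; apply: continuous_mulf.
have Q0 s : 0 <= s < a -> inner B (N (x s)) = 0 /\ inner B (W s) = 0.
  move=> /Q H; have := sqr_ge0 (inner B (N (x s))); have := sqr_ge0 (inner B (W s)).
  by move=> s1 s2; split; apply/eqP; rewrite -sqrf_eq0 eq_le sqr_ge0 andbT; lra.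
have [? ?] := Q0 t tin; split=> //.
apply: (const_on0 (a := a) (g := fun s => inner B (X (x s)))) => // [y yin|].
  apply: is_derive_eq (is_derive_inner (hc y) (arc_dX arc yin)) _.
  have yin0 : 0 <= y < a by case/andP: yin => y0 ->; rewrite ltW.
  by rewrite i0 innerZr (proj2 (Q0 y yin0)) mulr0 addr0.
apply: continuous_inner; first exact: cst_continuous.
by apply: continuous_gsurf_curve; [exact: arc_U0|exact: arc_contx arc].
Qed.

Lemma arc_continuous t : 0 <= t < a -> {for t, continuous (fun s => X (x s))}.
Proof.
move=> tin; have := tin => /andP[]; rewrite le_eqVlt => /predU1P[t0|t0] ta.
  rewrite -t0 in tin *; apply: continuous_gsurf_curve; last exact: arc_contx arc.
  by apply: arc_U0; rewrite t0.
have [? _] := arc_dX arc (introT andP (conj t0 ta)).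
exact/differentiable_continuous/derivable1_diffP.
Qed.

End arc_facts.

End curvature_net.

(** The distance is in the sup norm, and a Euclidean unit vector has coordinates of size at most 1;
    the factor 3 counts coordinates. *)
Lemma inner_dist_le (R : realType) (c u v : 'rV[R]_3) (eta : R) : inner c c = 1 ->
  `|u - v| <= eta -> `|inner c u - inner c v| <= 3 * eta.
Proof.
move=> cc uv.
have c1 j : `|c 0 j| <= 1.
  rewrite -(@ler_pXn2r _ 2) ?nnegrE// expr1n -normrX ger0_norm ?sqr_ge0//.
  move: j cc; rewrite inner3E -!expr2; apply: ord3P => cc;
  have := sqr_ge0 (c 0 0); have := sqr_ge0 (c 0 1); have := sqr_ge0 (c 0 2); lra.
have d1 j : `|u 0 j - v 0 j| <= eta.
  by apply: le_trans uv; have := coord_le_norm (u - v) j; rewrite !mxE.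
have cd j : `|c 0 j * (u 0 j - v 0 j)| <= eta.
  by rewrite normrM -[leRHS]mul1r; apply: ler_pM.
rewrite !inner3E (_ : _ - _ = c 0 0 * (u 0 0 - v 0 0) + c 0 1 * (u 0 1 - v 0 1) +
  c 0 2 * (u 0 2 - v 0 2)); last by ring.
have := cd 0; have := cd 1; have := cd 2 => e2 e1 e0.
rewrite (le_trans (ler_normD _ _))// (_ : 3 * eta = eta + eta + eta); last by ring.
by rewrite lerD// (le_trans (ler_normD _ _))// lerD.
Qed.

(** * Closing the quadrilateral of lines of curvature *)

Section net.
Variables (R : realType) (G : concave_graph R) (r : R).
Hypothesis r0 : 0 < r.
Hypothesis transport : transports_geodesics G r.
Local Notation U := (dom G).
Local Notation N := (gnormal G).
Local Notation X := (gsurf G).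
Variable p : 'rV[R]_2.
Hypotheses (Up : U p) (detp : detA G p != 0) (discp : disc G p != 0).

(** Non-degeneracy makes principal directions well determined, the trace bounds speeds from below,
    the condition on normals fixes the sense of turning ([arc_turns]), and the slope bounds feed
    [planes_inj]. *)
Definition good_ball (e : R) := forall x, `|x - p| < e ->
  [/\ U x, detA G x != 0 /\ disc G x != 0, trA G x < trA G p + 1,
      0 < inner (N p) (N x) &
      `|slope0 G x - slope0 G p| < 4^-1 /\ `|slope1 G x - slope1 G p| < 4^-1].

Lemma good_ball_exists : exists2 e, 0 < e & good_ball e.
Proof.
suff : \forall x \near p, [/\ U x, detA G x != 0 /\ disc G x != 0,
      trA G x < trA G p + 1, 0 < inner (N p) (N x) &
      `|slope0 G x - slope0 G p| < 4^-1 /\ `|slope1 G x - slope1 G p| < 4^-1].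
  move=> /nbhs_normP[e /= e0 H]; exists e => // x xp; apply: H.
  by rewrite /ball_/= distrC.
have q4 : 0 < 4^-1 :> R by rewrite invr_gt0.
have ct := continuous_trA Up; have cd := continuous_detA Up.
have cdisc : {for p, continuous (disc G)}.
  apply: continuous_addf; first exact: continuous_mulf.
  by apply: continuous_oppf; apply: continuous_mulf => //; exact: cst_continuous.
have cN : {for p, continuous (fun x => inner (N p) (N x))}.
  apply: continuous_inner; first exact: cst_continuous.
  exact: (@continuous_gnormal_curve _ _ _ _ id).
near=> x; split.
- by near: x; apply: open_nbhs_nbhs; split; [exact: dom_open|].
- split.
    by near: x; have := cvgr_neq0 _ cd detp; apply.
  by near: x; have := cvgr_neq0 _ cdisc discp; apply.
- by near: x; apply: (cvgr_lt _ ct); rewrite ltrDl.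
- near: x; apply: (cvgr_gt _ cN); rewrite gnormal_unit; exact: ltr01.
- split; near: x.
    by move/cvgrPdistC_lt: (continuous_p0 Up) => /(_ _ q4).
  by move/cvgrPdistC_lt: (continuous_p1 Up) => /(_ _ q4).
Unshelve. all: by end_near. Qed.

Section planes.
Variables (a0 b0 : 'rV[R]_3).
Hypotheses (Ta : tangent_unit G p a0) (Tb : tangent_unit G p b0) (ab : inner a0 b0 = 0).

Let frame u v : inner u v = inner u a0 * inner v a0 + inner u b0 * inner v b0 +
  inner u (N p) * inner v (N p).
Proof.
have [Na aa] := Ta; have [Nb bb] := Tb.
by apply: parseval3; rewrite ?gnormal_unit// innerC.
Qed.

(** Two planes with normals [a] and [b] meet the surface near [p] at most once. The displacement is
    a vector [tau] of the tangent plane at [p] plus a small vertical error [er]; the assumptions on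
    [a] and [b] let each of them see a single component of [tau]. *)
Lemma planes_inj e y z a b : good_ball e -> `|y - p| < e -> `|z - p| < e ->
  inner a a = 1 -> inner b b = 1 -> inner a b0 = 0 -> inner b a0 = 0 ->
  3 / 4 <= inner a a0 -> 3 / 4 <= inner b b0 ->
  inner a (X y) = inner a (X z) -> inner b (X y) = inner b (X z) -> y = z.
Proof.
move=> He yp zp aa bb ab0 ba0 a34 b34 Ea Eb.
have HU w : `|w - p| < e -> U w by move=> /He[].
have [u [u' [up up' E]]] := grad_MVT (@grad_height _ G) HU zp yp.
have [_ _ _ _ [s0 _]] := He u up; have [_ _ _ _ [_ s1]] := He u' up'.
pose v := y - z; pose tau := gdiff G p v.
pose er := height G y - height G z - (v 0 0 * slope0 G p + v 0 1 * slope1 G p).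
have erE : er = (slope0 G u - slope0 G p) * v 0 0 + (slope1 G u' - slope1 G p) * v 0 1.
  by rewrite /er E /v !mxE; ring.
have er_le : er ^+ 2 <= (v 0 0 ^+ 2 + v 0 1 ^+ 2) / 8.
  have le1 (d w : R) : `|d| < 4^-1 -> (d * w) ^+ 2 <= w ^+ 2 / 16.
    move=> d4; rewrite exprMn mulrC ler_wpM2l ?sqr_ge0//.
    have : `|d| ^+ 2 <= 4^-1 ^+ 2 by rewrite ler_pXn2r ?nnegrE// ltW.
    by rewrite -normrX ger0_norm ?sqr_ge0// => /le_trans; apply; lra.
  have := le1 _ (v 0 0) s0; have := le1 _ (v 0 1) s1; rewrite erE.
  set A := _ * v 0 0; set B := _ * v 0 1 => hB hA.
  have := sqr_ge0 (A - B); nra.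
have [Na aN] := Ta; have [Nb bN] := Tb.
have tauN : inner tau (N p) = 0 by rewrite innerC gnormal_gdiff.
have XE c : inner c (X y) - inner c (X z) = inner c tau + c 0 2 * er.
  by rewrite !inner3E !vec3E /er /v !mxE; ring.
have c2 (c : 'rV[R]_3) : inner c c = 1 -> c 0 2 ^+ 2 <= 1.
  rewrite inner3E -!expr2.
  by have := sqr_ge0 (c 0 0); have := sqr_ge0 (c 0 1); have := sqr_ge0 (c 0 2); lra.
have bnd c d t : inner c c = 1 -> 3 / 4 <= d -> inner c (X y) = inner c (X z) ->
    inner c tau = d * t -> t ^+ 2 <= 16 / 9 * er ^+ 2.
  move=> cc d34 Ec Ed.
  have E0 : d * t = - (c 0 2 * er) by have := XE c; rewrite Ec subrr Ed; lra.
  have h1 : (d * t) ^+ 2 <= er ^+ 2.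
    rewrite E0 sqrrN exprMn -[leRHS]mul1r; apply: ler_wpM2r; rewrite ?sqr_ge0//.
    exact: c2.
  have d2 : 9 / 16 <= d ^+ 2 by nra.
  have : 9 / 16 * t ^+ 2 <= er ^+ 2.
    by apply: le_trans h1; rewrite exprMn ler_wpM2r ?sqr_ge0.
  lra.
have ta : inner tau a0 ^+ 2 <= 16 / 9 * er ^+ 2.
  apply: (bnd a (inner a a0)) => //.
  by rewrite (frame a tau) ab0 tauN mul0r mulr0 !addr0.
have tb : inner tau b0 ^+ 2 <= 16 / 9 * er ^+ 2.
  apply: (bnd b (inner b b0)) => //.
  by rewrite (frame b tau) ba0 tauN mul0r mulr0 addr0 add0r.
have tt : v 0 0 ^+ 2 + v 0 1 ^+ 2 <= inner tau tau.
  by rewrite inner3E !vec3E -!expr2 lerDl sqr_ge0.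
(* The two components give [|tau|^2 <= 32/9 er^2], and [er^2 <= |v|^2 / 8]; so
   [|v|^2 <= 4/9 |v|^2]. *)
have v2 : v 0 0 ^+ 2 + v 0 1 ^+ 2 <= 0.
  by move: tt; rewrite (frame tau tau) tauN -!expr2 => tt; lra.
have := sqr_ge0 (v 0 0); have := sqr_ge0 (v 0 1) => s1' s0'.
apply/eqP; rewrite -subr_eq0 -/v; apply/eqP/rV2P; rewrite [RHS]mxE; apply/eqP;
  rewrite -sqrf_eq0 eq_le sqr_ge0 andbT; lra.
Qed.

End planes.

Section rates.
Variables (e eta a m : R) (x : R -> 'rV[R]_2) (W : R -> 'rV[R]_3).
Hypotheses (He : good_ball e) (etae : eta <= e).
Hypothesis (arc : curvature_arc G r p eta a x W).
Hypothesis mE : m = (1 + r * (trA G p + 1))^-1.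

Let good t : 0 <= t < a -> `|x t - p| < e.
Proof. by move=> tin; apply: lt_le_trans etae; exact: arc_nearx arc _ tin. Qed.

Let kof_gt0_le t : 0 <= t < a -> 0 < kof G (x t) (W t) <= trA G p + 1.
Proof.
move=> tin; have [Ux [dn _] tr _ _] := He (good tin).
have /andP[-> k1] := principal_gt0_le Ux dn (arc_tangent arc tin) (arc_principal arc tin).
by rewrite (le_trans k1)// ltW.
Qed.

Let speed_bounds t : 0 <= t < a -> m <= (1 + r * kof G (x t) (W t))^-1 <= 1.
Proof.
move=> /kof_gt0_le/andP[k0 k1]; have rk : 0 < r * kof G (x t) (W t) by rewrite mulr_gt0.
have rk1 : r * kof G (x t) (W t) <= r * (trA G p + 1) by rewrite ler_pM2l.
apply/andP; split; last by rewrite invf_le1; lra.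
by rewrite mE lef_pV2 ?posrE; lra.
Qed.

Let m0 : 0 < a -> 0 < m.
Proof.
move=> a0'; have /kof_gt0_le/andP[k0 k1] : 0 <= (0:R) < a by rewrite lexx.
by rewrite mE invr_gt0 ltr_wpDr// mulr_ge0 ?ltW//; lra.
Qed.

Lemma arc_rate_ge c l t : 0 < t < a -> 0 <= l ->
  (forall s, 0 <= s < a -> l <= inner c (W s)) ->
  m * l * t <= inner c (X (x t)) - inner c (X (x 0)).
Proof.
move=> tin l0 H; have /andP[t0 ta] := tin.
have [s /andP[s0 st] ->] := arc_MVT arc c tin.
have sin : 0 <= s < a by rewrite ltW//= (lt_trans st).
have /andP[m1 _] := speed_bounds sin.
rewrite ler_pM2r//; apply: ler_pM => //; [|exact: H].
by rewrite ltW// m0// (lt_trans t0).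
Qed.

Lemma arc_rate_le c u t : 0 < t < a ->
  (forall s, 0 <= s < a -> `|inner c (W s)| <= u) ->
  `|inner c (X (x t)) - inner c (X (x 0))| <= u * t.
Proof.
move=> tin H; have /andP[t0 ta] := tin.
have [s /andP[s0 st] ->] := arc_MVT arc c tin.
have sin : 0 <= s < a by rewrite ltW//= (lt_trans st).
have /andP[m1 m2] := speed_bounds sin.
have mm : 0 < m by rewrite m0// (lt_trans t0).
rewrite !normrM (gtr0_norm t0) ler_pM2r// -[u]mul1r; apply: ler_pM => //; last exact: H.
by rewrite ger0_norm//; lra.
Qed.

(** The derivative of [W] is a strictly negative multiple of a normal that stays on the same side as
    [N p]. This strictness gives the final contradiction. *)
Lemma arc_turns t : 0 < t < a -> inner (N p) (W 0) = 0 -> inner (N p) (W t) < 0.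
Proof.
move=> tin NW; have /andP[t0 ta] := tin.
have [s /andP[s0 st]] := arc_MVT_W arc (N p) tin; rewrite NW subr0 => ->.
have sin : 0 <= s < a by rewrite ltW//= (lt_trans st).
have /andP[k0 _] := kof_gt0_le sin; have [_ _ _ NN _] := He (good sin).
rewrite !mulNr oppr_lt0 !mulr_gt0// ?invr_gt0.
by rewrite ltr_wpDr// ltW// mulr_gt0.
Qed.

End rates.

(** The arc [x3] is a late side, starting at the end of [x2]. The target plane passes through the
    end of [x1] with normal [W1 eps]; by [arc_plane] the remaining side lies in it. Interchanging
    [a] and [b] gives the other late side. *)
Lemma crossing e eta A m a b x1 W1 x2 W2 x3 W3 eps :
  good_ball e -> eta <= e -> m = (1 + r * (trA G p + 1))^-1 -> m <= 1 -> 0 < m ->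
  eta <= m / 24 -> inner a a = 1 -> inner b b = 1 -> inner a b = 0 ->
  curvature_arc G r p eta A x1 W1 -> x1 0 = p -> W1 0 = a ->
  curvature_arc G r p eta A x2 W2 -> x2 0 = p -> W2 0 = b ->
  curvature_arc G r p eta A x3 W3 -> x3 0 = x2 eps -> W3 0 = a ->
  0 < eps < A -> 4 * eps / m < A ->
  exists2 s, 0 <= s < A & inner (W1 eps) (X (x3 s)) = inner (W1 eps) (X (x1 eps)).
Proof.
move=> He ee mE m1 m0 em aa bb ab c1 x1p W1a c2 x2p W2b c3 x3p W3a epsA SA.
have /andP[eps0 eA] := epsA.
have in0 : 0 <= eps < A by rewrite ltW.
(* The bound [eta <= m / 24] turns [inner_dist_le] into an error [d] in inner products. *)
pose d := m / 8; have d3 : 3 * eta <= d by rewrite /d; lra.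
set a' := W1 eps.
have [_ a'1] : tangent_unit G (x1 eps) a' by apply: arc_tangent c1 _ in0.
have a'a : `|a' - a| <= eta by rewrite -W1a ltW//; exact: arc_nearW c1 _ in0.
have a'a_ge : 1 - d <= inner a' a <= 1 + d.
  have /ler_normlP[] := inner_dist_le aa a'a; rewrite aa (innerC a a').
  by move=> ? ?; apply/andP; split; lra.
have near_a (w : 'rV[R]_3) : `|w - a| <= eta -> 1 - 2 * d <= inner a' w <= 1 + 2 * d.
  move=> /(inner_dist_le a'1)/ler_normlP[? ?]; case/andP: a'a_ge => ? ?.
  by apply/andP; split; lra.
have near_b (w : 'rV[R]_3) : `|w - b| <= eta -> `|inner a' w| <= 2 * d.
  move=> /(inner_dist_le a'1)/ler_normlP[w1 w2].
  have /ler_normlP[v1 v2] := inner_dist_le bb a'a.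
  rewrite (innerC b a) ab (innerC b a') in v1 v2.
  by apply/ler_normlP; split; lra.
have W1n s : 0 <= s < A -> `|W1 s - a| <= eta.
  by move=> sA; rewrite -W1a ltW//; exact: arc_nearW c1 _ sA.
have W2n s : 0 <= s < A -> `|W2 s - b| <= eta.
  by move=> sA; rewrite -W2b ltW//; exact: arc_nearW c2 _ sA.
have W3n s : 0 <= s < A -> `|W3 s - a| <= eta.
  by move=> sA; rewrite -W3a ltW//; exact: arc_nearW c3 _ sA.
have d0 : 0 <= 1 - 2 * d by rewrite /d; lra.
have h1 : m * (1 - 2 * d) * eps <= inner a' (X (x1 eps)) - inner a' (X (x1 0)).
  by apply: (arc_rate_ge He ee c1 mE) => // s /W1n/near_a/andP[].
have h1' : `|inner a' (X (x1 eps)) - inner a' (X (x1 0))| <= (1 + 2 * d) * eps.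
  apply: (arc_rate_le He ee c1 mE) => // s /W1n/near_a/andP[? ?].
  by apply/ler_normlP; split; lra.
have h2 : `|inner a' (X (x2 eps)) - inner a' (X (x2 0))| <= 2 * d * eps.
  by apply: (arc_rate_le He ee c2 mE) => // s /W2n/near_b.
(* At speed at least [m], this time raises [inner a'] by at least [4 eps (1 - 2 d)]. The target is
   at most [(1 + 2 d) eps] above the value at [p], and the start is at most [2 d eps] away from that
   value, so the target is passed. *)
pose S := 4 * eps / m; have S0 : 0 < S by rewrite divr_gt0// mulr_gt0.
have SinA : 0 < S < A by rewrite S0.
have h3 : m * (1 - 2 * d) * S <= inner a' (X (x3 S)) - inner a' (X (x3 0)).
  by apply: (arc_rate_ge He ee c3 mE) => // s /W3n/near_a/andP[].
have mS : m * (1 - 2 * d) * S = 4 * eps * (1 - 2 * d).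
  by rewrite /S; field; rewrite gt_eqF.
rewrite mS x3p in h3; rewrite x1p in h1 h1'; rewrite x2p in h2.
have /ler_normlP[h1a h1b] := h1'; have /ler_normlP[h2a h2b] := h2.
have me : 0 < m * eps by rewrite mulr_gt0.
have mme : m * (m * eps) <= m * eps by rewrite ler_piMl// ltW.
have m1e : m * eps <= eps by rewrite ler_piMl// ltW.
have [||s sS E] := @IVT _ (fun s => inner a' (X (x3 s))) 0 S (inner a' (X (x1 eps)))
    (ltW S0).
- apply: continuous_in_subspaceT => s; rewrite inE/= in_itv/= => /andP[s0 sS].
  suff : {for s, continuous (fun s => inner a' (X (x3 s)))} by [].
  apply: continuous_inner; first exact: cst_continuous.
  by apply: (arc_continuous c3); rewrite s0 (le_lt_trans sS).
- rewrite x3p ge_min le_max; apply/andP; split; apply/orP; [left|right].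
    by rewrite /d in h1 h1a h1b h2a h2b h3; lra.
  by rewrite /d in h1 h1a h1b h2a h2b h3; lra.
exists s; last exact: E.
by move: sS; rewrite in_itv/= => /andP[-> sS]; rewrite (le_lt_trans sS).
Qed.

End net.

Lemma curvature_arc_sub (R : realType) (G : concave_graph R) (r : R) p eta a a' x W :
  a' <= a -> curvature_arc G r p eta a x W -> curvature_arc G r p eta a' x W.
Proof.
move=> aa [cx cW dm nx nW tg pr dX dW dN].
have i t : 0 <= t < a' -> 0 <= t < a.
  by move=> /andP[-> /= ta]; exact: lt_le_trans aa.
have j t : 0 < t < a' -> 0 < t < a.
  by move=> /andP[-> /= ta]; exact: lt_le_trans aa.
split=> // t.
- by move=> /i/dm.
- by move=> /i/nx.
- by move=> /i/nW.
- by move=> /i/tg.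
- by move=> /i/pr.
- by move=> /j/dX.
- by move=> /j/dW.
- by move=> /j/dN.
Qed.

(* The two pairs of opposite sides of the curvature net close up at a point
   where a' and b' are both principal, hence orthogonal; but a' and b' both turn
   away from the tangent plane at [p], a' in the plane orthogonal to b0 and b' in
   the plane orthogonal to a0, so they cannot be orthogonal. *)
Lemma no_generic_point (R : realType) (G : concave_graph R) (r : R) p : 0 < r ->
  transports_geodesics G r -> dom G p -> detA G p != 0 -> disc G p != 0 -> False.
Proof.
move=> r0 transport Up detp discp.
have [a0 [b0 [k [k' [Ta Tb ab Pa Pb]]]]] := principal_frame Up discp.
have [[Na aa] [Nb bb]] := (Ta, Tb).
have [e e0 He] := good_ball_exists Up detp discp.
have tr0 := trA_ge0 Up.
have rt : 0 < r * (trA G p + 1) by rewrite mulr_gt0//; lra.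
pose m := (1 + r * (trA G p + 1))^-1.
have m0 : 0 < m by rewrite invr_gt0; lra.
have m1 : m <= 1 by rewrite invf_le1; lra.
pose eta := Num.min e (m / 24).
have eta0 : 0 < eta by rewrite lt_min e0 divr_gt0.
have ee : eta <= e by rewrite ge_min lexx.
have em : eta <= m / 24 by rewrite ge_min lexx orbT.
have [rho1 [A1 [rho10 A10 HA]]] := curvature_arc_exists r0 transport a0 Up eta0.
have [rho2 [A2 [rho20 A20 HB]]] := curvature_arc_exists r0 transport b0 Up eta0.
pose A := Num.min A1 A2; have A0 : 0 < A by rewrite lt_min A10.
have AA1 : A <= A1 by rewrite ge_min lexx.
have AA2 : A <= A2 by rewrite ge_min lexx orbT.
have [x1 [W1 [x1p W1a /(curvature_arc_sub AA1) c1]]] : exists x W,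
    [/\ x 0 = p, W 0 = a0 & curvature_arc G r p eta A1 x W].
  by apply: HA Pa => //; rewrite subrr normr0.
have [x2 [W2 [x2p W2b /(curvature_arc_sub AA2) c2]]] : exists x W,
    [/\ x 0 = p, W 0 = b0 & curvature_arc G r p eta A2 x W].
  by apply: HB Pb => //; rewrite subrr normr0.
(* The first two sides last for [eps]: small enough that their ends lie where arcs of lifetime [A]
   start, and that the time [4 eps / m] of [crossing] fits into [A]. *)
have [eps [eps0 epsA SA n1 n2]] : exists eps, [/\ 0 < eps, eps < A, 4 * eps / m < A,
    `|x1 eps - p| < rho2 & `|x2 eps - p| < rho1].
  have cr1 : x1 s @[s --> 0^'+] --> x1 0.
    by apply: cvg_at_right_filter; exact: (arc_contx c1).
  have cr2 : x2 s @[s --> 0^'+] --> x2 0.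
    by apply: cvg_at_right_filter; exact: (arc_contx c2).
  have Am : 0 < A * m / 4 by rewrite divr_gt0// mulr_gt0.
  have [eps /= [H1 [H2 [H3 [H4 H5]]]]] : exists eps : R,
      [set eps | 0 < eps /\ eps < A /\ eps < A * m / 4 /\
         `|x1 eps - p| < rho2 /\ `|x2 eps - p| < rho1] eps.
    apply: (@filter_ex _ (0:R)^'+); near=> eps; do ![split].
    - by near: eps; exact: nbhs_right_gt.
    - by near: eps; exact: nbhs_right_lt.
    - by near: eps; exact: nbhs_right_lt.
    - by near: eps; move/cvgrPdistC_lt: cr1 => /(_ _ rho20); rewrite x1p.
    - by near: eps; move/cvgrPdistC_lt: cr2 => /(_ _ rho10); rewrite x2p.
  exists eps; split=> //; rewrite ltr_pdivrMr//; lra.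
have in0 : 0 <= eps < A by rewrite ltW.
have in1 : 0 < eps < A by rewrite eps0.
have ba : inner b0 a0 = 0 by rewrite innerC.
set a' := W1 eps; set b' := W2 eps.
have Ta' : tangent_unit G (x1 eps) a' := arc_tangent c1 in0.
have Tb' : tangent_unit G (x2 eps) b' := arc_tangent c2 in0.
(* Planarity carries [b0] unchanged to the end of the first side, as the principal direction
   orthogonal to [a']; likewise [a0] along the second side. *)
have [b0N b0a' _] : [/\ inner b0 (gnormal G (x1 eps)) = 0, inner b0 a' = 0
    & inner b0 (gsurf G (x1 eps)) = inner b0 (gsurf G (x1 0))].
  by apply: (arc_plane c1) => //; rewrite ?x1p ?W1a// innerC.
have [a0N a0b' _] : [/\ inner a0 (gnormal G (x2 eps)) = 0, inner a0 b' = 0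
    & inner a0 (gsurf G (x2 eps)) = inner a0 (gsurf G (x2 0))].
  by apply: (arc_plane c2) => //; rewrite ?x2p ?W2b// innerC.
have Tb1 : tangent_unit G (x1 eps) b0 by split=> //; rewrite innerC.
have Ta2 : tangent_unit G (x2 eps) a0 by split=> //; rewrite innerC.
have [k1 Pb1] := principal_orth (arc_dom c1 in0) Ta' (arc_principal c1 in0) Tb1 b0a'.
have [k2 Pa2] := principal_orth (arc_dom c2 in0) Tb' (arc_principal c2 in0) Ta2 a0b'.
have [x3 [W3 [x3p W3a /(curvature_arc_sub AA1) c3]]] := HA _ _ n2 Ta2 Pa2.
have [x4 [W4 [x4p W4b /(curvature_arc_sub AA2) c4]]] := HB _ _ n1 Tb1 Pb1.
have [s sA Es] := crossing r0 He ee erefl m1 m0 em aa bb ab c1 x1p W1a c2 x2p W2b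
  c3 x3p W3a in1 SA.
have [t tA Et] := crossing r0 He ee erefl m1 m0 em bb aa ba c2 x2p W2b c1 x1p W1a
  c4 x4p W4b in1 SA.
(* The same argument carries [b'] along the third side and, next, [a'] along the fourth. *)
have [b'N b'W b'X] := arc_plane c3 (B := b')
  (etrans (innerC _ _) (etrans (congr1 (fun x => inner (gnormal G x) b') x3p) (proj1 Tb')))
  (etrans (congr1 (inner b') W3a) (etrans (innerC _ _) a0b')) sA.
have [a'N a'W a'X] := arc_plane c4 (B := a')
  (etrans (innerC _ _) (etrans (congr1 (fun x => inner (gnormal G x) a') x4p) (proj1 Ta')))
  (etrans (congr1 (inner a') W4b) (etrans (innerC _ _) b0a')) tA.
have a'a : `|a' - a0| <= eta by rewrite -W1a ltW//; exact: (arc_nearW c1 in0).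
have b'b : `|b' - b0| <= eta by rewrite -W2b ltW//; exact: (arc_nearW c2 in0).
have [_ a'1] := Ta'; have [_ b'1] := Tb'.
have a'a34 : 3 / 4 <= inner a' a0.
  by have /ler_normlP[] := inner_dist_le aa a'a; rewrite aa (innerC a0 a') => *; lra.
have b'b34 : 3 / 4 <= inner b' b0.
  by have /ler_normlP[] := inner_dist_le bb b'b; rewrite bb (innerC b0 b') => *; lra.
have meet : x3 s = x4 t.
  apply: (planes_inj Ta Tb ab He _ _ a'1 b'1 _ _ a'a34 b'b34).
  - exact: lt_le_trans (arc_nearx c3 sA) ee.
  - exact: lt_le_trans (arc_nearx c4 tA) ee.
  - by rewrite innerC.
  - by rewrite innerC.
  - by rewrite Es a'X x4p.
  - by rewrite Et b'X x3p.
have Us := arc_dom c3 sA.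
have [_ [_ discs] _ _ _] := He _ (lt_le_trans (arc_nearx c3 sA) ee).
have Tb's : tangent_unit G (x3 s) b' by split=> //; rewrite innerC.
have Ta's : tangent_unit G (x3 s) a' by split=> //; rewrite meet innerC.
have [l Pb's] := principal_orth Us (arc_tangent c3 sA) (arc_principal c3 sA) Tb's b'W.
have T4 : tangent_unit G (x3 s) (W4 t) by rewrite meet; exact: (arc_tangent c4 tA).
have P4 : principal G (x3 s) (W4 t) (kof G (x4 t) (W4 t)).
  by rewrite meet; exact: (arc_principal c4 tA).
have [l' Pa's] := principal_orth Us T4 P4 Ta's a'W.
have a'b'_small : `|inner a' b'| <= 1 / 4.
  have /ler_normlP[u1 u2] := inner_dist_le a'1 b'b.
  have /ler_normlP[v1 v2] := inner_dist_le bb a'a.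
  rewrite ba (innerC b0 a') in v1 v2.
  by apply/ler_normlP; split; lra.
have a'b' : inner a' b' = 0.
  apply: (principal_pair Us discs Ta's Pa's Tb's Pb's).
  have /ler_normlP[u1 u2] := a'b'_small; rewrite lt_eqF//; nra.
have NN := gnormal_unit G p.
have aN : inner a0 (gnormal G p) = 0 by rewrite innerC.
have bN : inner b0 (gnormal G p) = 0 by rewrite innerC.
(* In the frame at [p] the first two terms vanish, leaving [inner a' N * inner b' N = 0], whereas
   [arc_turns] makes both factors negative. *)
have := parseval3 a' b' aa bb NN ab aN bN.
rewrite a'b' (innerC b' a0) a0b' (innerC a' b0) b0a' mulr0 mul0r !add0r.
move=> /esym/eqP; rewrite mulf_eq0 => /orP[]; apply/negP; rewrite lt_eqF// innerC.
- by apply: (arc_turns r0 He ee c1 in1); rewrite W1a.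
- by apply: (arc_turns r0 He ee c2 in1); rewrite W2b.
Unshelve. all: by end_near. Qed.

(** * Locally constant curvature *)

(** The second difference over a small square, evaluated by the mean value theorem in both orders,
    gives [h10] at one point and [h01] at another; continuity brings both points to [x]. *)
Lemma grad_schwarz (R : realType) (U : set 'rV[R]_2) (F p0 p1 h00 h10 h01 h11 : 'rV[R]_2 -> R) x :
  open U -> has_grad U F p0 p1 -> has_grad U p0 h00 h10 -> has_grad U p1 h01 h11 ->
  U x -> h01 x = h10 x.
Proof.
move=> oU gF g0 g1 Ux.
have [rho rho0 HU] := open_ballP oU Ux.
have same d : 0 < d -> d <= rho -> exists u v,
    [/\ `|u - x| < d, `|v - x| < d & h10 u = h01 v].
  move=> d0 dr; pose s := d / 2; have s0 : 0 < s by rewrite divr_gt0.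
  have sd : `|s| < d by rewrite gtr0_norm// /s; lra.
  have inU a b : `|a - x 0 0| < d -> `|b - x 0 1| < d -> `|pt a b - x| < d.
    by move=> ha hb; rewrite norm_rV2_lt !mxE/= ha.
  have inU' a b : `|a - x 0 0| < d -> `|b - x 0 1| < d -> U (pt a b).
    by move=> ha hb; apply: HU; apply: lt_le_trans dr; exact: inU.
  have z0 (c : R) : `|c - c| < d by rewrite subrr normr0.
  have z1 c : `|c + s - c| < d by rewrite addrAC subrr add0r.
  have [t ht|a ha Ea] := @MVT_ball _
      (fun t => F (pt t (x 0 1 + s)) - F (pt t (x 0 1)))
      (fun t => p0 (pt t (x 0 1 + s)) - p0 (pt t (x 0 1))) (x 0 0) d
      (x 0 0) (x 0 0 + s) _ (z0 _) (z1 _).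
    have [d1 _ _ _] := gF _ (inU' _ _ ht (z1 _)).
    have [d2 _ _ _] := gF _ (inU' _ _ ht (z0 _)).
    by have := is_deriveB (is_derive_hline d1) (is_derive_hline d2).
  have [t ht|b hb Eb] := @MVT_ball _ (fun t => p0 (pt a t)) (fun t => h10 (pt a t))
      (x 0 1) d (x 0 1) (x 0 1 + s) _ (z0 _) (z1 _).
    by have [_ d1 _ _] := g0 _ (inU' _ _ ha ht); exact: is_derive_vline.
  have [t ht|a' ha' Ea'] := @MVT_ball _
      (fun t => F (pt (x 0 0 + s) t) - F (pt (x 0 0) t))
      (fun t => p1 (pt (x 0 0 + s) t) - p1 (pt (x 0 0) t)) (x 0 1) d
      (x 0 1) (x 0 1 + s) _ (z0 _) (z1 _).
    have [_ d1 _ _] := gF _ (inU' _ _ (z1 _) ht).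
    have [_ d2 _ _] := gF _ (inU' _ _ (z0 _) ht).
    by have := is_deriveB (is_derive_vline d1) (is_derive_vline d2).
  have [t ht|b' hb' Eb'] := @MVT_ball _ (fun t => p1 (pt t a')) (fun t => h01 (pt t a'))
      (x 0 0) d (x 0 0) (x 0 0 + s) _ (z0 _) (z1 _).
    by have [d1 _ _ _] := g1 _ (inU' _ _ ht ha'); exact: is_derive_hline.
  exists (pt a b), (pt b' a'); split; [exact: inU|exact: inU|].
  have ss : s * s != 0 by rewrite mulf_neq0// gt_eqF.
  apply: (mulIf ss).
  have k c : c + s - c = s by ring.
  rewrite Eb k in Ea; rewrite Eb' k in Ea'; rewrite k in Ea Ea'.
  by move: Ea Ea' => /= Ea Ea'; lra.
have [_ _ _ c10] := g0 _ Ux; have [_ _ c01 _] := g1 _ Ux.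
apply/eqP; rewrite -subr_eq0 -normr_eq0; apply/eqP/le_anti; rewrite normr_ge0 andbT.
apply/ler_addgt0Pr => e e0; rewrite add0r.
have e2 : 0 < e / 2 by rewrite divr_gt0.
have /cvgrPdist_le/(_ _ e2)/nbhs_normP[d1 /= d10 H10] := c10.
have /cvgrPdist_le/(_ _ e2)/nbhs_normP[d2 /= d20 H01] := c01.
have [||u [v [ux vx E]]] := same (Num.min rho (Num.min d1 d2)).
- by rewrite !lt_min rho0 d10.
- by rewrite ge_min lexx.
move: ux vx; rewrite !lt_min => /and3P[_ u1 _] /and3P[_ _ v2].
have h1 : `|h10 x - h10 u| <= e / 2 by apply: H10; rewrite /ball_/= distrC.
have h2 : `|h01 x - h01 v| <= e / 2 by apply: H01; rewrite /ball_/= distrC.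
rewrite (_ : h01 x - h10 x = (h01 x - h01 v) - (h10 x - h10 u)); last by rewrite E; ring.
by rewrite (le_trans (ler_normB _ _))// (splitr e) lerD.
Qed.

Lemma near_dist (R : realType) (c rho t : R) : `|t - c| < rho ->
  \forall s \near t, `|s - c| < rho.
Proof.
move=> tc; apply/nbhs_normP; exists (rho - `|t - c|) => /=; first by rewrite subr_gt0.
move=> s; rewrite /ball_/= distrC => st.
by rewrite -(subrKA t) (le_lt_trans (ler_normD _ _))// -ltrBrDr.
Qed.

Section dichotomy.
Variables (R : realType) (G : concave_graph R).
Local Notation U := (dom G).

(* If the shape operator is k times the identity near x, then the first two
   components of the normal depend on one coordinate each, and so does k: it is
   constant, without any third derivative. *)
Lemma umbilic_detA_const x : U x -> detA G x != 0 ->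
  (forall y, U y -> detA G y != 0 -> disc G y = 0) ->
  \forall y \near x, detA G y = detA G x.
Proof.
move=> Ux dx H.
have [rho rho0 Hr] : exists2 rho, 0 < rho & forall y, `|y - x| < rho ->
    U y /\ detA G y != 0.
  have : \forall y \near x, U y /\ detA G y != 0.
    near=> y; split.
      by near: y; apply: open_nbhs_nbhs; split=> //; exact: dom_open.
    by near: y; have := cvgr_neq0 _ (continuous_detA Ux) dx; apply.
  move=> /nbhs_normP[rho /= rho0 Hr]; exists rho => // y yx; apply: Hr.
  by rewrite /ball_/= distrC.
have sc y : `|y - x| < rho -> [/\ a01 G y = 0, a10 G y = 0 & a00 G y = a11 G y].
  by move=> /Hr[Uy dy]; apply: disc0_scalar => //; exact: H.
have inb s u : `|s - x 0 0| < rho -> `|u - x 0 1| < rho -> `|pt s u - x| < rho.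
  by move=> hs hu; rewrite norm_rV2_lt !mxE/= hs.
have c00 s u u' : `|s - x 0 0| < rho -> `|u - x 0 1| < rho -> `|u' - x 0 1| < rho ->
    a00 G (pt s u) = a00 G (pt s u').
  move=> hs hu hu'.
  have E t : `|t - x 0 0| < rho -> gn0 G (pt t u) = gn0 G (pt t u').
    move=> ht; have [y hy|y hy] := @MVT_ball _ (fun y => gn0 G (pt t y))
        (fun y => a10 G (pt t y)) (x 0 1) rho u' u _ hu' hu.
      have [Uy _] := Hr _ (inb _ _ ht hy).
      by have [_ dd _ _] := grad_gn0 Uy; exact: is_derive_vline.
    have [_ -> _] := sc _ (inb _ _ ht hy).
    by move=> /eqP; rewrite mul0r subr_eq0 => /eqP.
  have [Uu _] := Hr _ (inb _ _ hs hu); have [Uu' _] := Hr _ (inb _ _ hs hu').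
  have [/is_derive_hline[_ <-] _ _ _] := grad_gn0 Uu.
  have [/is_derive_hline[_ <-] _ _ _] := grad_gn0 Uu'.
  by apply: near_eq_derive; near=> t; apply: E; near: t; exact: near_dist.
have c11 s s' u : `|s - x 0 0| < rho -> `|s' - x 0 0| < rho -> `|u - x 0 1| < rho ->
    a11 G (pt s u) = a11 G (pt s' u).
  move=> hs hs' hu.
  have E t : `|t - x 0 1| < rho -> gn1 G (pt s t) = gn1 G (pt s' t).
    move=> ht; have [y hy|y hy] := @MVT_ball _ (fun y => gn1 G (pt y t))
        (fun y => a01 G (pt y t)) (x 0 0) rho s' s _ hs' hs.
      have [Uy _] := Hr _ (inb _ _ hy ht).
      by have [dd _ _ _] := grad_gn1 Uy; exact: is_derive_hline.
    have [-> _ _] := sc _ (inb _ _ hy ht).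
    by move=> /eqP; rewrite mul0r subr_eq0 => /eqP.
  have [Us _] := Hr _ (inb _ _ hs hu); have [Us' _] := Hr _ (inb _ _ hs' hu).
  have [_ /is_derive_vline[_ <-] _ _] := grad_gn1 Us.
  have [_ /is_derive_vline[_ <-] _ _] := grad_gn1 Us'.
  by apply: near_eq_derive; near=> t; apply: E; near: t; exact: near_dist.
have detE y : `|y - x| < rho -> detA G y = a00 G y ^+ 2.
  by move=> /sc[e1 e2 e3]; rewrite /detA e1 -e3; ring.
(* [a00] is moved along the second coordinate and, as it equals [a11], then along the first. *)
have key y : `|y - x| < rho -> a00 G y = a00 G x.
  move=> yx; have := yx; rewrite norm_rV2_lt !mxE => /andP[y0 y1].
  have z0 (c : R) : `|c - c| < rho by rewrite subrr normr0.
  rewrite -[in LHS](pt_eta y) (c00 _ _ (x 0 1))//.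
  have [_ _ ->] := sc _ (inb _ _ y0 (z0 (x 0 1))).
  have [_ _ e] : [/\ a01 G x = 0, a10 G x = 0 & a00 G x = a11 G x].
    by apply: sc; rewrite subrr normr0.
  by rewrite (c11 _ (x 0 0))// pt_eta.
apply/nbhs_normP; exists rho => // y; rewrite /ball_/= distrC => yx.
by rewrite !detE ?key// subrr normr0.
Unshelve. all: by end_near. Qed.

(** The level set of a nonzero value of the Gaussian curvature is closed in the patch by continuity
    and open by [umbilic_detA_const]. The set where the curvature is merely nonzero would be open
    only. *)
Lemma flat_or_umbilic : connected U ->
  (forall y, U y -> detA G y != 0 -> disc G y = 0) ->
  (forall y, U y -> detA G y = 0) \/ (forall y, U y -> disc G y = 0).
Proof.
move=> cU H.
have [flat|] := pselect (forall y, U y -> detA G y = 0); first by left.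
move=> /existsNP[x /not_implyP[Ux /eqP dx]]; right.
suff E : [set y | U y /\ detA G y = detA G x] = U.
  move=> y; rewrite -[in U y]E => -[Uy dy]; apply: H => //; by rewrite dy.
have oB : open [set y | U y /\ detA G y = detA G x].
  rewrite openE => y [Uy dy]; have dy0 : detA G y != 0 by rewrite dy.
  have := umbilic_detA_const Uy dy0 H; rewrite dy => nd.
  rewrite /interior; near=> z; split.
    by near: z; apply: open_nbhs_nbhs; split=> //; exact: dom_open.
  by near: z.
apply: cU.
- by exists x.
- by exists [set y | U y /\ detA G y = detA G x] => //; apply/seteqP; split => y [].
- exists (~` [set y | U y /\ detA G y != detA G x]).
    apply: open_closedC; rewrite openE => y [Uy dy]; rewrite /interior; near=> z; split.
      by near: z; apply: open_nbhs_nbhs; split=> //; exact: dom_open.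
    rewrite -subr_eq0; near: z.
    have cd : {for y, continuous (fun z => detA G z - detA G x)}.
      exact: (continuous_addf (continuous_detA Uy) (@cst_continuous _ _ (- detA G x) y)).
    by apply: (cvgr_neq0 _ cd); rewrite subr_eq0.
  apply/seteqP; split => y /=.
    by move=> [Uy dy]; split=> // -[_]; rewrite dy eqxx.
  move=> [Uy nd]; split=> //; apply/eqP; apply: contra_notT nd => nd; by split.
Unshelve. all: by end_near. Qed.

End dichotomy.

(** * The patch of the theorem *)

Lemma det2 (R : comNzRingType) (A : 'M[R]_2) : \det A = A 0 0 * A 1 1 - A 0 1 * A 1 0.
Proof.
rewrite (expand_det_row _ 0) !big_ord_recl big_ord0 addr0 /cofactor !det_mx11 !mxE.
rewrite (_ : lift 0 0 = 1 :> 'I_2); last exact/val_inj.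
rewrite (_ : lift 1 0 = 0 :> 'I_2); last exact/val_inj.
by rewrite /= !addn0 expr0 expr1 mul1r mulN1r mulrN.
Qed.

Lemma mx2P (R : Type) (A B : 'M[R]_2) : A 0 0 = B 0 0 -> A 0 1 = B 0 1 ->
  A 1 0 = B 1 0 -> A 1 1 = B 1 1 -> A = B.
Proof.
move=> e00 e01 e10 e11; apply/matrixP => -[[|[|//]] Hi] [[|[|//]] Hj].
- by rewrite (_ : Ordinal Hi = 0) 1?(_ : Ordinal Hj = 0)//; apply/val_inj.
- by rewrite (_ : Ordinal Hi = 0) 1?(_ : Ordinal Hj = 1)//; apply/val_inj.
- by rewrite (_ : Ordinal Hi = 1) 1?(_ : Ordinal Hj = 0)//; apply/val_inj.
- by rewrite (_ : Ordinal Hi = 1) 1?(_ : Ordinal Hj = 1)//; apply/val_inj.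
Qed.

Lemma char_poly2 (R : comNzRingType) (A : 'M[R]_2) (k1 k2 : R) :
  k1 + k2 = A 0 0 + A 1 1 -> k1 * k2 = A 0 0 * A 1 1 - A 0 1 * A 1 0 ->
  char_poly A = ('X - k1%:P) * ('X - k2%:P).
Proof.
move=> s p; rewrite /char_poly det2 !mxE /= !mulr1n !mulr0n !sub0r.
transitivity ('X * 'X - (A 0 0 + A 1 1)%:P * 'X + (A 0 0 * A 1 1 - A 0 1 * A 1 0)%:P).
  by rewrite polyCB !polyCM polyCD; ring.
by rewrite -s -p polyCM polyCD; ring.
Qed.

Lemma C1_on_grad (R : realType) (U : set 'rV[R]_2) (F : 'rV[R]_2 -> R) :
  C1_on U F -> has_grad U F (partial 0 F) (partial 1 F).
Proof.
move=> HF x Ux; have [d0 c0] := HF 0 x Ux; have [d1 c1] := HF 1 x Ux.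
by split; [exact: (derivableP d0)|exact: (derivableP d1)|exact: c0|exact: c1].
Qed.

Lemma is_derive_coordinate (R : realType) (n : nat) (x v : 'rV[R]_n) j :
  is_derive x v (fun y : 'rV[R]_n => y 0 j) (v 0 j).
Proof.
apply/is_derive_line; rewrite (_ : (fun h => _) = (fun h => h * v 0 j + x 0 j)).
  by apply: is_derive_eq; rewrite /GRing.scale/=; ring.
by apply/funext => h; rewrite !mxE.
Qed.

Lemma is_derive_affine (R : realType) (n : nat) (x v : 'rV[R]_n) (t : R) :
  is_derive t 1 (fun s : R => s *: v + x) v.
Proof.
apply: is_derive_row => j; rewrite (_ : (fun s => _) = (fun s => s * v 0 j + x 0 j)).
  by apply: is_derive_eq; rewrite /GRing.scale/=; ring.
by apply/funext => s; rewrite !mxE.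
Qed.

Lemma is_derive_comp_row (R : realType) (n : nat) (g : R -> 'rV[R]_n) (phi : R -> R)
    (t d : R) (D : 'rV[R]_n) :
  is_derive t 1 phi d -> is_derive (phi t) 1 g D ->
  is_derive t 1 (fun s => g (phi s)) (d *: D).
Proof.
move=> hp hg; apply: is_derive_row => j; rewrite mxE mulrC.
by have := comp_is_derive hp (is_derive_coord j hg).
Qed.

Section graph_patch_geometry.
Variables (R : realType) (U : set 'rV[R]_2) (a1 a2 : R) (h : 'rV[R]_2 -> R).
Variables (C : set 'rV[R]_3) (nhat : 'rV[R]_2 -> 'rV[R]_3).
Let K0 := graph_patch a1 a2 h.
Hypotheses (oU : open U) (cU : connected U) (U0 : U 0) (Ch : C2_on U h).
Hypotheses (bodyC : convex_body C) (bdC : K0 @` U `<=` boundary C).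
Hypothesis nhatP : forall x, U x -> outward_unit_normal C K0 x (nhat x).
Hypothesis nhat0 : nhat 0 = vec3 0 0 1.

Let f (x : 'rV[R]_2) := - (2^-1 * (a1 * x 0 0 ^+ 2 + a2 * x 0 1 ^+ 2)) - h x.
Let p0 (x : 'rV[R]_2) := - (a1 * x 0 0) - partial 0 h x.
Let p1 (x : 'rV[R]_2) := - (a2 * x 0 1) - partial 1 h x.
Let h00 x := - a1 - partial 0 (partial 0 h) x.
Let h10 x := - partial 1 (partial 0 h) x.
Let h01 x := - partial 0 (partial 1 h) x.
Let h11 x := - a2 - partial 1 (partial 1 h) x.

Let cc (j : 'I_2) x : {for x, continuous (fun x : 'rV[R]_2 => x 0 j)}.
Proof. exact: coord_continuous. Qed.

Let dir00 : (@dir0 R) 0 0 = 1. Proof. by rewrite mxE. Qed.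
Let dir01 : (@dir0 R) 0 1 = 0. Proof. by rewrite mxE. Qed.
Let dir10 : (@dir1 R) 0 0 = 0. Proof. by rewrite mxE. Qed.
Let dir11 : (@dir1 R) 0 1 = 1. Proof. by rewrite mxE. Qed.

Let grad_f : has_grad U f p0 p1.
Proof.
move=> x Ux; have [d0 d1 c0 c1] := C1_on_grad (proj1 Ch) Ux.
have e00 := is_derive_coordinate x dir0 0; have e01 := is_derive_coordinate x dir0 1.
have e10 := is_derive_coordinate x dir1 0; have e11 := is_derive_coordinate x dir1 1.
split.
- by rewrite /f; apply: is_derive_eq; rewrite dir00 dir01 /p0 /GRing.scale/=; field.
- by rewrite /f; apply: is_derive_eq; rewrite dir10 dir11 /p1 /GRing.scale/=; field.
- rewrite /p0; apply: continuous_addf; last exact: (continuous_oppf c0).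
  apply: continuous_oppf; apply: continuous_mulf; first exact: cst_continuous.
  exact: cc.
- rewrite /p1; apply: continuous_addf; last exact: (continuous_oppf c1).
  apply: continuous_oppf; apply: continuous_mulf; first exact: cst_continuous.
  exact: cc.
Qed.

Let grad_p0 : has_grad U p0 h00 h10.
Proof.
move=> x Ux; have [d0 d1 c0 c1] := C1_on_grad (proj2 Ch 0) Ux.
have e00 := is_derive_coordinate x dir0 0; have e10 := is_derive_coordinate x dir1 0.
split.
- rewrite /p0; apply: is_derive_eq; rewrite dir00 /h00 /GRing.scale/=; ring.
- rewrite /p0; apply: is_derive_eq; rewrite dir10 /h10 /GRing.scale/=; ring.
- exact: (continuous_addf (@cst_continuous _ _ (- a1) x) (continuous_oppf c0)).
- exact: (continuous_oppf c1).
Qed.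

Let grad_p1 : has_grad U p1 h01 h11.
Proof.
move=> x Ux; have [d0 d1 c0 c1] := C1_on_grad (proj2 Ch 1) Ux.
have e01 := is_derive_coordinate x dir0 1; have e11 := is_derive_coordinate x dir1 1.
split.
- rewrite /p1; apply: is_derive_eq; rewrite dir01 /h01 /GRing.scale/=; ring.
- rewrite /p1; apply: is_derive_eq; rewrite dir11 /h11 /GRing.scale/=; ring.
- exact: (continuous_oppf c0).
- exact: (continuous_addf (@cst_continuous _ _ (- a2) x) (continuous_oppf c1)).
Qed.

Let K0_C x : U x -> C (K0 x).
Proof.
move=> Ux; have [_ cptC _] := bodyC.
have /closure_id -> := compact_closed (@norm_hausdorff _ _) cptC.
by have [] : boundary C (K0 x) by apply: bdC; exists x.
Qed.

Let is_derive_K0 x (v : 'rV[R]_2) : U x -> is_derive x v K0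
  (vec3 (v 0 0) (v 0 1) (v 0 0 * p0 x + v 0 1 * p1 x)).
Proof.
move=> Ux; apply/is_derive_line.
have hx : is_derive (0:R) 1 (fun s : R => s *: v + x) v.
  exact: is_derive_affine.
have Ux' : U ((fun s : R => s *: v + x) 0) by rewrite scale0r add0r.
have xE : (fun s : R => s *: v + x) 0 = x by rewrite scale0r add0r.
apply: is_derive_vec3; try exact: is_derive_coord.
apply: is_derive_eq (grad_chain oU grad_f Ux' hx) _.
by rewrite xE.
Qed.

Let nhat_eq x : U x -> [/\ nhat x 0 0 = - p0 x * nhat x 0 2,
  nhat x 0 1 = - p1 x * nhat x 0 2 &
  nhat x 0 2 ^+ 2 * (1 + p0 x ^+ 2 + p1 x ^+ 2) = 1].
Proof.
move=> Ux; have [n1 nn _] := nhatP Ux.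
have [_ E0] := is_derive_K0 dir0 Ux; have [_ E1] := is_derive_K0 dir1 Ux.
have := nn 0; rewrite /partial E0 inner3E !vec3E dir00 dir01 => e0.
have := nn 1; rewrite /partial E1 inner3E !vec3E dir10 dir11 => e1.
have q0 : nhat x 0 0 = - p0 x * nhat x 0 2 by lra.
have q1 : nhat x 0 1 = - p1 x * nhat x 0 2 by lra.
split=> //; have := n1; rewrite /enorm => sq1.
have : inner (nhat x) (nhat x) = 1.
  by rewrite -[LHS]sqr_sqrtr ?inner_ge0// sq1 expr1n.
by rewrite inner3E q0 q1 => H; rewrite -[RHS]H; ring.
Qed.

(** [nhat] is not assumed continuous, so its sign is not propagated directly. [M y] is the height of
    the tangent plane at [y] above a fixed interior point [q]. A supporting plane misses interior
    points, so [M] never vanishes; being continuous on a connected set and positive at 0, it is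
    positive, and it determines the sign. *)
Let nhat2_gt0 x : U x -> 0 < nhat x 0 2.
Proof.
have [_ _ [q Cq]] := bodyC.
pose M y : R := (f y - q 0 2) + p0 y * (q 0 0 - y 0 0) + p1 y * (q 0 1 - y 0 1).
have ME y : U y -> inner (nhat y) (q - K0 y) = - nhat y 0 2 * M y.
  by move=> Uy; have [q0 q1 _] := nhat_eq Uy; rewrite inner3E q0 q1 !mxE/= /M /f; ring.
have neg y : U y -> inner (nhat y) (q - K0 y) < 0.
  move=> Uy; have [n1 _ sup] := nhatP Uy.
  have nn : inner (nhat y) (nhat y) = 1.
    by rewrite -[LHS]sqr_sqrtr ?inner_ge0// -/(enorm _) n1 expr1n.
  move: Cq => /nbhs_normP[e /= e0 He].
  have n0 : 0 < `|nhat y|.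
    rewrite normr_gt0; apply/eqP => z; move: nn; rewrite z inner3E !mxE => /eqP.
    by rewrite !mul0r !addr0 eq_sym oner_eq0.
  (* The neighbourhood of [q] is a ball of the sup norm, whereas [nhat y] is a unit vector for the
     Euclidean one. *)
  pose c := e / 2 / `|nhat y|; have c0 : 0 < c by rewrite !divr_gt0.
  have E : inner (nhat y) (q + c *: nhat y - K0 y) = inner (nhat y) (q - K0 y) + c.
    rewrite (addrAC q) (innerDr (q - K0 y)).
    by rewrite innerZr nn mulr1.
  have : inner (nhat y) (q - K0 y) + c <= 0.
    rewrite -E; apply: sup; apply: He; rewrite /ball_/= opprD addrA subrr sub0r normrN normrZ.
    by rewrite gtr0_norm// divfK ?gt_eqF//; lra.
  lra.
have cM y : U y -> {for y, continuous M}.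
  move=> Uy; have cf := grad_continuous oU grad_f Uy.
  have cp0 := grad_continuous oU grad_p0 Uy; have cp1 := grad_continuous oU grad_p1 Uy.
  have k c : {for y, continuous (fun _ : 'rV[R]_2 => c : R)} by exact: cst_continuous.
  have kc c j : {for y, continuous (fun z : 'rV[R]_2 => c - z 0 j)}.
    by apply: continuous_addf; [exact: k|apply: continuous_oppf; exact: cc].
  rewrite /M; apply: continuous_addf; first apply: continuous_addf.
  - by apply: continuous_addf; [exact: cf|exact: k].
  - by apply: continuous_mulf; [exact: cp0|exact: kc].
  - by apply: continuous_mulf; [exact: cp1|exact: kc].
have M0 y : U y -> M y != 0.
  by move=> Uy; apply/eqP => My; have := neg y Uy; rewrite ME// My mulr0 ltxx.
have Mpos0 : 0 < M 0.
  by have := neg 0 U0; rewrite ME// nhat0 vec3E mulN1r oppr_lt0.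
have iM : is_interval [set M y | y in U].
  apply/connected_intervalP/connected_continuous_connected => //.
  by apply: continuous_in_subspaceT => y; rewrite inE => /cM.
move=> Ux; have Mx : 0 < M x.
  rewrite ltNge; apply/negP => Mx.
  have [y Uy /eqP My] : [set M y | y in U] 0.
    by apply: (iM (M x) (M 0)); [exists x|exists 0|rewrite Mx ltW].
  by move: (M0 y Uy); rewrite My.
have := neg x Ux; rewrite ME// mulNr oppr_lt0 pmulr_lgt0//.
Qed.

(** The sum of the supporting inequalities at [x] and at [y]: the gradient of a concave function is
    monotone. *)
Let slope_anti x y : U x -> U y ->
  (p0 y - p0 x) * (y 0 0 - x 0 0) + (p1 y - p1 x) * (y 0 1 - x 0 1) <= 0.
Proof.
have half u v : U u -> U v ->
    f v - f u - p0 u * (v 0 0 - u 0 0) - p1 u * (v 0 1 - u 0 1) <= 0.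
  move=> Uu Uv; have [_ _ /(_ _ (K0_C Uv))] := nhatP Uu.
  have [q0 q1 _] := nhat_eq Uu; rewrite inner3E q0 q1 !mxE/=.
  set E := f v - _ - _ - _; rewrite (_ : _ + _ + _ = nhat u 0 2 * E).
    by rewrite pmulr_rle0// nhat2_gt0.
  by rewrite /E /f; ring.
by move=> Ux Uy; have := half x y Ux Uy; have := half y x Uy Ux; lra.
Qed.

Let sym x : U x -> h01 x = h10 x.
Proof. exact: grad_schwarz grad_f grad_p0 grad_p1. Qed.

(** The Hessian form is the derivative at 0 of the slope along the ray in direction [(a, b)]; by
    [slope_anti] its right difference quotients are non-positive. *)
Let npos x (a b : R) : U x ->
  h00 x * a ^+ 2 + 2 * h01 x * a * b + h11 x * b ^+ 2 <= 0.
Proof.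
move=> Ux; pose v := pt a b; pose y (s : R) := s *: v + x.
have hy : is_derive (0:R) 1 y v by exact: is_derive_affine.
have y0 : y 0 = x by rewrite /y scale0r add0r.
have Uy0 : U (y 0) by rewrite y0.
have d0 := grad_chain oU grad_p0 Uy0 hy; have d1 := grad_chain oU grad_p1 Uy0 hy.
pose psi s := p0 (y s) * a + p1 (y s) * b.
have dpsi : is_derive (0:R) 1 psi
    ((a * h00 x + b * h10 x) * a + (a * h01 x + b * h11 x) * b).
  have lin (u w : R -> R) du dw : is_derive (0:R) 1 u du -> is_derive (0:R) 1 w dw ->
      is_derive (0:R) 1 (fun s => u s * a + w s * b) (du * a + dw * b).
    by move=> hu hw; apply: is_derive_eq; rewrite /GRing.scale/=; ring.
  by apply: is_derive_eq (lin _ _ _ _ d0 d1) _; rewrite y0 !pt0 !pt1.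
have -> : h00 x * a ^+ 2 + 2 * h01 x * a * b + h11 x * b ^+ 2 =
   (a * h00 x + b * h10 x) * a + (a * h01 x + b * h11 x) * b.
  by rewrite -(sym Ux); ring.
have [dd dv] := dpsi; rewrite -dv.
have cv : s^-1 *: (psi (s *: 1 + 0) - psi 0) @[s --> 0^'+] --> 'D_1 psi 0.
  by apply: cvg_dnbhs_at_right; exact: dd.
have cy : {for 0, continuous y}.
  by have [? _] := hy; apply/differentiable_continuous/derivable1_diffP.
apply: (cvgr_to_le cv); near=> s.
have s0 : 0 < s by near: s; exact: nbhs_right_gt.
have Us : U (y s).
  near: s; apply: (cvg_at_right_filter cy).
  by rewrite y0; apply: open_nbhs_nbhs; split.
have := slope_anti Ux Us; rewrite !mxE/= => H.
rewrite addr0 [s *: 1]mulr1 /psi y0 /GRing.scale/= pmulr_rle0 ?invr_gt0//.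
rewrite -(pmulr_rle0 _ s0); apply: le_trans H.
by rewrite le_eqVlt; apply/orP; left; apply/eqP; rewrite /y /v; ring.
Unshelve. all: by end_near. Qed.

Definition patch_graph : concave_graph R :=
  ConcaveGraph oU grad_f grad_p0 grad_p1 sym npos.
Local Notation G := patch_graph.

Lemma nhatE x : U x -> nhat x = gnormal G x.
Proof.
move=> Ux; have [q0 q1 q2] := nhat_eq Ux; have n2 := nhat2_gt0 Ux.
have E2 : nhat x 0 2 = gn2 G x.
  have g2 := gn2_gt0 G x; have gq := gn2_sqr G x.
  have : nhat x 0 2 ^+ 2 = gn2 G x ^+ 2.
    apply: (mulIf (lt0r_neq0 (gq_gt0 G x))); rewrite gq; exact: q2.
  by move/eqP; rewrite eqf_sqr => /orP[/eqP//|/eqP E]; lra.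
by apply: rV3P; rewrite vec3E ?q0 ?q1 E2.
Qed.

(** Uniqueness of the nearest point: for [w = K0 y - K0 x], minimality gives
    [|w|^2 <= 2 r inner nhat w], and the supporting plane makes the right side non-positive. *)
Lemma nearest_point_projectionE r (P : 'rV[R]_3 -> 'rV[R]_3) x : 0 < r ->
  nearest_point_projection (parallel_patch K0 nhat r @` U) (K0 @` U) P ->
  U x -> P (parallel_patch K0 nhat r x) = K0 x.
Proof.
move=> r0 Pp Ux; have [[y Uy yE] /(_ (K0 x)) d] := Pp _ (ex_intro2 _ _ x Ux erefl).
have nn : inner (nhat x) (nhat x) = 1 by rewrite nhatE// gnormal_unit.
have [_ _ /(_ _ (K0_C Uy)) sup] := nhatP Ux.
rewrite -yE in d *; apply/eqP; rewrite -subr_eq0; apply/eqP/inner_eq0.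
have {}d : inner (K0 x + r *: nhat x - K0 y) (K0 x + r *: nhat x - K0 y) <=
    inner (r *: nhat x) (r *: nhat x).
  have := d (ex_intro2 _ _ x Ux erefl); rewrite /enorm ler_sqrt ?inner_ge0//.
  by rewrite /parallel_patch (_ : K0 x + r *: nhat x - K0 x = r *: nhat x)// addrAC subrr add0r.
apply/le_anti; rewrite inner_ge0 andbT; move: d.
have -> : K0 x + r *: nhat x - K0 y = r *: nhat x - (K0 y - K0 x).
  by rewrite opprB addrA; congr (_ - _); exact: addrC.
move: sup; move: (K0 y - K0 x) => w sup; rewrite !innerBl !innerBr !innerZl !innerZr nn.
rewrite (innerC w); have : r * inner (nhat x) w <= 0 by rewrite pmulr_rle0.
lra.
Qed.

End graph_patch_geometry.

(** * From the stated notions of geodesic and curvature to the graph *)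

Section interface.
Variables (R : realType) (G : concave_graph R) (r : R).
Variables (nhat : 'rV[R]_2 -> 'rV[R]_3) (P : 'rV[R]_3 -> 'rV[R]_3).
Hypothesis r0 : 0 < r.
Local Notation U := (dom G).
Local Notation N := (gnormal G).
Local Notation K0 := (gsurf G).
Local Notation Kr := (parallel_patch (gsurf G) nhat r).
Hypothesis nhatN : forall x, U x -> nhat x = N x.

Let near_U x : U x -> \forall y \near x, U y.
Proof. by move=> Ux; apply: open_nbhs_nbhs; split=> //; exact: dom_open. Qed.

Lemma is_derive_scale_row (n : nat) (c : R) (y : R -> 'rV[R]_n) (t : R) d :
  is_derive t 1 y d -> is_derive t 1 (fun s => c *: y s) (c *: d).
Proof.
move=> hy; apply: is_derive_row => j; rewrite mxE.
rewrite (_ : (fun s => _) = (fun s => c * y s 0 j)); last by apply/funext => s; rewrite mxE.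
have hj := is_derive_coord j hy; apply: is_derive_eq; rewrite /GRing.scale/=; ring.
Qed.

Lemma is_derive_parallel (x : R -> 'rV[R]_2) t dx : U (x t) -> is_derive t 1 x dx ->
  is_derive t 1 (fun s => Kr (x s)) (gdiff G (x t) (dx + r *: weingarten G (x t) dx)).
Proof.
move=> Ut hx; rewrite gdiffD gdiffZ.
have dK := is_derive_gsurf Ut hx.
have dN := is_derive_scale_row r (is_derive_gnormal Ut hx).
apply: near_eq_is_derive (is_deriveD dK dN).
have cx : {for t, continuous x}.
  by have [? _] := hx; apply/differentiable_continuous/derivable1_diffP.
have : \forall s \near t, U (x s) by exact: cx (near_U Ut).
by apply: filterS => s Us; rewrite /parallel_patch nhatN.
Qed.

Let line_derive (F : 'rV[R]_2 -> 'rV[R]_3) x v d :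
  is_derive (0:R) 1 (fun s => F (s *: v + x)) d -> 'D_v F x = d.
Proof. by move=> H; have [_ ->] := (@is_derive_line _ _ _ F x v d).2 H. Qed.

Lemma partial_gsurf i x : U x -> partial i K0 x = gdiff G x (delta_mx 0 i).
Proof.
move=> Ux; apply: line_derive.
have E : 0 *: delta_mx 0 i + x = x by rewrite scale0r add0r.
have H := @is_derive_gsurf _ G (fun s : R => s *: delta_mx 0 i + x) 0 (delta_mx 0 i) _
  (is_derive_affine _ _ _).
by move: H; rewrite E; exact.
Qed.

(** These vectors lie in the tangent plane of the original surface: at corresponding points both
    surfaces have normal [N]. *)
Lemma partial_parallel i x : U x -> partial i Kr x =
  gdiff G x (delta_mx 0 i + r *: weingarten G x (delta_mx 0 i)).
Proof.
move=> Ux; apply: line_derive.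
have E : 0 *: delta_mx 0 i + x = x by rewrite scale0r add0r.
have H := @is_derive_parallel (fun s : R => s *: delta_mx 0 i + x) 0 (delta_mx 0 i) _
  (is_derive_affine _ _ _).
by move: H; rewrite E; exact.
Qed.

Lemma gsurf_inj x y : K0 x = K0 y -> x = y.
Proof.
move=> E; apply: rV2P.
  by have := congr1 (fun v : 'rV[R]_3 => v 0 0) E; rewrite !vec3E.
by have := congr1 (fun v : 'rV[R]_3 => v 0 1) E; rewrite !vec3E.
Qed.

Lemma normal_gsurf x v : U x -> normal_at K0 x v -> v = inner v (N x) *: N x.
Proof.
move=> Ux nv; have e0 := nv 0; have e1 := nv 1.
rewrite partial_gsurf// inner3E !vec3E !mxE/= in e0.
rewrite partial_gsurf// inner3E !vec3E !mxE/= in e1.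
have n2 := gn2_sqr G x.
have q0 : v 0 0 = - slope0 G x * v 0 2 by lra.
have q1 : v 0 1 = - slope1 G x * v 0 2 by lra.
have i2 : inner v (N x) * gn2 G x = v 0 2.
  by rewrite inner3E !vec3E /gn0 /gn1 q0 q1 -[RHS]mulr1 -n2; ring.
have i3 c : inner v (N x) * (c * gn2 G x) = c * v 0 2 by rewrite mulrCA i2.
move: (inner v (N x)) i2 i3 => c i2 i3.
by apply: rV3P; rewrite [RHS]mxE vec3E; [rewrite q0 i3|rewrite q1 i3|rewrite i2].
Qed.

Let near_itv (a t : R) : 0 < t < a -> \forall s \near t, 0 < s < a.
Proof.
move=> tin; have := @near_in_itvoo R 0 a t; rewrite in_itv/= => /(_ tin).
by apply: filterS => s; rewrite in_itv.
Qed.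

(** The curve upstairs is already parametrized by arclength, so it is a geodesic with the identity
    as reparametrization; the factor [c] comes entirely from its image. *)
Lemma transports_of_preserves : (forall x, U x -> P (Kr x) = K0 x) ->
  preserves_geodesics Kr K0 U P -> transports_geodesics G r.
Proof.
move=> PE pres a x dx W kap a0 H.
pose I : set R := [set t | 0 < t < a].
have oI : open_interval I.
  split; first by rewrite openE => t /near_itv.
  move=> s t /andP[s0 _] /andP[_ ta] z /andP[sz zt]; apply/andP.
  by split; [exact: lt_le_trans sz|exact: le_lt_trans ta].
have dg t : I t -> is_derive t 1 (fun s => Kr (x s)) (W t).
  by move=> /H[Ut [hx _] E _ _]; rewrite -E; exact: is_derive_parallel.
have dgE t : I t -> derive1 (fun s => Kr (x s)) t = W t.
  by move=> It; rewrite derive1E; have [] := dg t It.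
have dgN t : I t -> \forall s \near t, W s = derive1 (fun s => Kr (x s)) s.
  by move=> /near_itv; apply: filterS => s Is; rewrite dgE.
have ddg t : I t -> is_derive t 1 (derive1 (fun s => Kr (x s))) (- kap t *: N (x t)).
  move=> It; have [_ _ _ [hW _] _] := H t It.
  exact: near_eq_is_derive (dgN t It) hW.
have ddgE t : I t -> derive1 (derive1 (fun s => Kr (x s))) t = - kap t *: N (x t).
  by move=> It; rewrite derive1E; have [] := ddg t It.
have geo : geodesic Kr U I (fun s => Kr (x s)).
  split; first exact: oI.
  exists I, (fun s => Kr (x s)), id; split; last first.
    move=> t It; split; [exact: derivable_id| | |exact: It|by []].
      rewrite (_ : derive1 id = cst 1); first exact: cst_continuous.
      by apply/funext => s; rewrite derive1_id.
    by rewrite derive1_id oner_eq0.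
  split; first exact: oI.
  move=> t It; have [Ut [hx _] E [hW ck] W1] := H t It; split.
  - by have [] := dg t It.
  - by have [] := ddg t It.
  - have cx : {for t, continuous x}.
      by have [? _] := hx; apply/differentiable_continuous/derivable1_diffP.
    have cc : {for t, continuous (fun s => - kap s *: N (x s))}.
      apply: continuous_row => j.
      rewrite (_ : (fun s => _) = (fun s => - kap s * N (x s) 0 j)).
        apply: continuous_mulf; first exact: continuous_oppf.
        by apply: continuous_coord; exact: continuous_gnormal_curve.
      by apply/funext => s; rewrite mxE.
    rewrite /prop_for /continuous_at ddgE//; apply: cvg_trans cc.
    apply: near_eq_cvg; have := near_itv It; apply: filterS => s Is.
    by rewrite ddgE.
  - by rewrite dgE// /enorm W1 sqrtr1.
  - exists (x t); split=> // i.
    by rewrite ddgE// partial_parallel// innerZl gnormal_gdiff mulr0.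
have [_ [J [g [phi [[_ gJ] gphi]]]]] := pres _ _ geo.
have KE t : I t -> K0 (x t) = g (phi t).
  move=> It; have [Ut _ _ _ _] := H t It; have [_ _ _ _ <-] := gphi t It.
  by rewrite /= PE.
(* [T] is the unit tangent of the image geodesic at the reparametrized time; by the chain rule its
   derivative acquires the factor [phi']. *)
exists (fun t => derive1 g (phi t)), (fun t => derive1 phi t),
  (fun t => derive1 phi t * inner (derive1 (derive1 g) (phi t)) (N (x t))).
move=> t It; have [Ut [hx _] _ _ _] := H t It.
have [dphi _ phi0 Jt _] := gphi t It.
have [dg1 ddg1 _ g1 [y [Uy gy ny]]] := gJ _ Jt.
have hphi : is_derive t 1 phi (derive1 phi t) by rewrite derive1E; exact: (derivableP dphi).
have xy : y = x t by apply: gsurf_inj; rewrite -gy KE.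
rewrite {}xy in ny.
split; last exact: phi0.
- have hg : is_derive (phi t) 1 (derive1 g) (derive1 (derive1 g) (phi t)).
    by rewrite derive1E; exact: (derivableP ddg1).
  rewrite -scalerA -(normal_gsurf Ut ny); exact: is_derive_comp_row hphi hg.
- by rewrite -[LHS]sqr_sqrtr ?inner_ge0// -/(enorm _) g1 expr1n.
- have hg : is_derive (phi t) 1 g (derive1 g (phi t)) by rewrite derive1E; exact: (derivableP dg1).
  have [_ E1] := is_derive_comp_row hphi hg.
  have [_ E2] := is_derive_gsurf Ut hx.
  apply: (etrans (esym E2)); apply: etrans E1.
  apply: near_eq_derive; have := near_itv It; apply: filterS => s Is; exact: KE.
Qed.

Lemma partial_partial_gsurf i j x (a b d : R) (F : 'rV[R]_2 -> R) : U x ->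
  (forall y, gdiff G y (delta_mx 0 j) = vec3 a b (F y)) ->
  is_derive x (delta_mx 0 i) F d -> partial i (partial j K0) x = vec3 0 0 d.
Proof.
move=> Ux Fj /is_derive_line hF.
transitivity ('D_(delta_mx 0 i) (fun y => vec3 a b (F y)) x).
  apply: near_eq_derive; have := near_U Ux; apply: filterS => y Uy.
  by rewrite partial_gsurf.
by apply: line_derive; apply: is_derive_vec3; try exact: is_derive_cst; exact: hF.
Qed.

Let gdiff0 y : gdiff G y (delta_mx 0 0) = vec3 1 0 (slope0 G y).
Proof. by apply: rV3P; rewrite !vec3E !mxE/= ?mul1r ?mul0r ?addr0. Qed.

Let gdiff1 y : gdiff G y (delta_mx 0 1) = vec3 0 1 (slope1 G y).
Proof. by apply: rV3P; rewrite !vec3E !mxE/= ?mul1r ?mul0r ?add0r. Qed.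

Definition weingarten_mx x : 'M[R]_2 := \matrix_(i, j)
  (if i == 0 then if j == 0 then a00 G x else a01 G x
   else if j == 0 then a10 G x else a11 G x).

(** The first form is not inverted explicitly: the second form is checked to be [weingarten_mx]
    times the first, which is then cancelled, its determinant being [1 + p0^2 + p1^2]. *)
Lemma shape_operatorE x : U x -> shape_operator K0 nhat x = weingarten_mx x.
Proof.
move=> Ux; have [d00 d10 _ _] := @grad_slope0 _ G x Ux.
have [d01 d11 _ _] := @grad_slope1 _ G x Ux.
have P0 := partial_gsurf 0 Ux; have P1 := partial_gsurf 1 Ux.
rewrite gdiff0 in P0; rewrite gdiff1 in P1.
have n2 := gn2_sqr G x.
have S00 := partial_partial_gsurf Ux gdiff0 d00.
have S10 := partial_partial_gsurf Ux gdiff0 d10.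
have S01 := partial_partial_gsurf Ux gdiff1 d01.
have S11 := partial_partial_gsurf Ux gdiff1 d11.
have FF i j : first_form K0 x i j = inner (partial i K0 x) (partial j K0 x).
  by rewrite mxE.
have SF i j : second_form K0 nhat x i j = - inner (partial i (partial j K0) x) (N x).
  by rewrite mxE nhatN.
have E : second_form K0 nhat x = weingarten_mx x *m first_form K0 x.
  have mul2 i j : (weingarten_mx x *m first_form K0 x) i j =
      weingarten_mx x i 0 * first_form K0 x 0 j +
      weingarten_mx x i 1 * first_form K0 x 1 j.
    rewrite mxE !big_ord_recl big_ord0 addr0.
    by rewrite (_ : lift 0 0 = 1 :> 'I_2)//; exact/val_inj.
  have wE : [/\ weingarten_mx x 0 0 = a00 G x, weingarten_mx x 0 1 = a01 G x,
      weingarten_mx x 1 0 = a10 G x & weingarten_mx x 1 1 = a11 G x] by rewrite !mxE.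
  case: wE => w00 w01 w10 w11.
  have I a b (u v : 'rV[R]_3) : u = vec3 0 0 a -> v = vec3 b.1 b.2 (gn2 G x) ->
      - inner u v = - (a * gn2 G x).
    by move=> -> ->; rewrite inner3E !vec3E !mul0r !add0r.
  have N2 : N x = vec3 (gn0 G x, gn1 G x).1 (gn0 G x, gn1 G x).2 (gn2 G x) by [].
  have D00 : inner (partial 0 K0 x) (partial 0 K0 x) = 1 + slope0 G x ^+ 2.
    by rewrite P0 inner3E !vec3E; ring.
  have D01 : inner (partial 0 K0 x) (partial 1 K0 x) = slope0 G x * slope1 G x.
    by rewrite P0 P1 inner3E !vec3E; ring.
  have D10 : inner (partial 1 K0 x) (partial 0 K0 x) = slope0 G x * slope1 G x.
    by rewrite P0 P1 inner3E !vec3E; ring.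
  have D11 : inner (partial 1 K0 x) (partial 1 K0 x) = 1 + slope1 G x ^+ 2.
    by rewrite P1 inner3E !vec3E; ring.
  (* One identity for both rows: [A] and [B] are the entries of a row of the Hessian. *)
  have alg (g p q A B : R) : g ^+ 2 * (1 + p ^+ 2 + q ^+ 2) = 1 ->
      - (A * g) = - ((1 + q ^+ 2) * A - p * q * B) * g ^+ 3 * (1 + p ^+ 2) +
        - ((1 + p ^+ 2) * B - p * q * A) * g ^+ 3 * (p * q) /\
      - (B * g) = - ((1 + q ^+ 2) * A - p * q * B) * g ^+ 3 * (p * q) +
        - ((1 + p ^+ 2) * B - p * q * A) * g ^+ 3 * (1 + q ^+ 2).
    move=> H; split; apply/subr0_eq.
      transitivity (A * g * (g ^+ 2 * (1 + p ^+ 2 + q ^+ 2) - 1)); first by ring.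
      by rewrite H subrr mulr0.
    transitivity (B * g * (g ^+ 2 * (1 + p ^+ 2 + q ^+ 2) - 1)); first by ring.
    by rewrite H subrr mulr0.
  have [r00 r01] := alg _ _ _ (hess00 G x) (hess01 G x) n2.
  have [r10 r11] := alg _ _ _ (hess10 G x) (hess11 G x) n2.
  have i00 := I _ _ _ _ S00 N2.
  have i01 := I _ _ _ _ S01 N2.
  have i10 := I _ _ _ _ S10 N2.
  have i11 := I _ _ _ _ S11 N2.
  have F00 := etrans (FF 0 0) D00.
  have F01 := etrans (FF 0 1) D01.
  have F10 := etrans (FF 1 0) D10.
  have F11 := etrans (FF 1 1) D11.
  apply: mx2P; rewrite SF mul2.
  - by apply: (etrans i00); rewrite w00 w01 F00 F10.
  - by apply: (etrans i01); rewrite w00 w01 F01 F11.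
  - by apply: (etrans i10); rewrite w10 w11 F00 F10.
  - by apply: (etrans i11); rewrite w10 w11 F01 F11.
have first_unit : first_form K0 x \in unitmx.
  rewrite unitmxE unitfE det2 !FF P0 P1 !inner3E !vec3E gt_eqF//.
  by have := gq_gt0 G x; lra.
by rewrite /shape_operator E mulmxK.
Qed.

(** The roots of the characteristic polynomial, real by [disc_ge0]; [detA] and [disc] thereby become
    the Gaussian curvature and the squared difference of the principal curvatures. *)
Lemma principal_curvatures_exist x : U x -> exists k1 k2,
  [/\ principal_curvatures K0 nhat x k1 k2, k1 * k2 = detA G x
    & (k1 - k2) ^+ 2 = disc G x].
Proof.
move=> Ux; have sd := sqr_sqrtr (disc_ge0 Ux).
exists ((trA G x + Num.sqrt (disc G x)) / 2), ((trA G x - Num.sqrt (disc G x)) / 2).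
have prod : (trA G x + Num.sqrt (disc G x)) / 2 * ((trA G x - Num.sqrt (disc G x)) / 2)
    = detA G x.
  transitivity ((trA G x ^+ 2 - Num.sqrt (disc G x) ^+ 2) / 4); first by field.
  by rewrite sd /disc; field.
split=> //; last by rewrite -[RHS]sd; field.
rewrite /principal_curvatures shape_operatorE//; apply: char_poly2.
  by rewrite !mxE /=; rewrite /trA; field.
by rewrite prod !mxE.
Qed.

Lemma zero_gauss_detA x : U x -> detA G x = 0 -> zero_gauss_curvature_at K0 nhat x.
Proof.
by move=> /principal_curvatures_exist[k1 [k2 [Pk <- _]]] d0; exists k1, k2.
Qed.

Lemma umbilic_disc x : U x -> disc G x = 0 -> umbilic_at K0 nhat x.
Proof.
move=> /principal_curvatures_exist[k1 [k2 [Pk _ <-]]] /eqP.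
by rewrite sqrf_eq0 subr_eq0 => /eqP d0; exists k1, k2.
Qed.

End interface.

Theorem theorem1p2 (R : realType) (U : set 'rV[R]_2) (a1 a2 r : R)
  (h : 'rV[R]_2 -> R) (C : set 'rV[R]_3) (nhat : 'rV[R]_2 -> 'rV[R]_3)
  (Pi : 'rV[R]_3 -> 'rV[R]_3) :
  let K0 := graph_patch a1 a2 h in
  let Kr := parallel_patch K0 nhat r in
  open U -> connected U -> U 0 ->
  0 <= a1 -> 0 <= a2 ->
  C2_on U h ->
  h 0 = 0 ->
  (forall i, partial i h 0 = 0) ->
  (forall i j, partial i (partial j h) 0 = 0) ->
  convex_body C ->
  K0 @` U `<=` boundary C ->
  (forall x, U x -> outward_unit_normal C K0 x (nhat x)) ->
  nhat 0 = vec3 0 0 1 ->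
  0 < r ->
  nearest_point_projection (Kr @` U) (K0 @` U) Pi ->
  preserves_geodesics Kr K0 U Pi ->
  (forall x, U x -> zero_gauss_curvature_at K0 nhat x) \/
  (forall x, U x -> umbilic_at K0 nhat x).
Proof.
move=> K0 Kr oU cU U0 _ _ Ch _ _ _ bodyC bdC nhatP nhat0 r0 projPi presPi.
pose G := patch_graph oU cU U0 Ch bodyC bdC nhatP nhat0.
have nE : forall x, dom G x -> nhat x = gnormal G x by exact: nhatE.
have PE : forall x, dom G x -> Pi (Kr x) = K0 x.
  by move=> x; exact: (nearest_point_projectionE oU cU U0 Ch bodyC bdC nhatP nhat0 r0).
have transport : transports_geodesics G r.
  exact: (transports_of_preserves nE PE presPi).
have nongeneric x : dom G x -> detA G x != 0 -> disc G x = 0.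
  move=> Ux dx; apply/eqP; apply: contraT => cx.
  by have := no_generic_point r0 transport Ux dx cx.
have [flat|umb] := @flat_or_umbilic _ G cU nongeneric; [left|right] => x Ux.
  by apply: (zero_gauss_detA nE Ux); exact: flat.
by apply: (umbilic_disc nE Ux); exact: umb.
Qed.
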